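(* Let $N=2$. For every integer $k\ge3$ there exist $n\in\mathbb{N}$ and $p_k>2$ such that $\mu_k(p_k)=\tau_n(p_k)$.
   Context: For $p>1$ and a bounded domain $\Omega\subset\mathbb{R}^2$, $\lambda_1(\Omega;p)$ denotes the first eigenvalue of $-\Delta_p u=-\mathrm{div}(|\nabla u|^{p-2}\nabla u)$ on $\Omega$ with zero Dirichlet boundary conditions. For $n\ge1$, $B_1^{\pi/n}=\{(\rho\cos\theta,\rho\sin\theta):0<\rho<1,\ 0<\theta<\pi/n\}$ and $\tau_n(p)=\lambda_1(B_1^{\pi/n};p)$. The radial eigenvalues $\mu_1(p)<\mu_2(p)<\dots$ on the unit disk are the numbers $\mu$ for which $-(r|u'|^{p-2}u')'=\mu r|u|^{p-2}u$ on $(0,1)$, $u'(0)=0$, $u(1)=0$, has a nontrivial solution, listed in increasing order. *)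

(* Defs.v *)
From Stdlib Require Import Reals List.
From Coquelicot Require Import Coquelicot.
Open Scope R_scope.

(* |x|^q for x >= 0 with the convention 0^q = 0 (Rpower 0 q would be 1). *)
Definition powp (x q : R) : R := if Req_EM_T x 0 then 0 else Rpower x q.

Definition d1 (u : R * R -> R) (z : R * R) : R := Derive (fun t => u (t, snd z)) (fst z).
Definition d2 (u : R * R -> R) (z : R * R) : R := Derive (fun t => u (fst z, t)) (snd z).

Definition dist2 (z w : R * R) : R :=
  sqrt ((fst z - fst w) ^ 2 + (snd z - snd w) ^ 2).

Definition C1_2d (u : R * R -> R) : Prop :=
  forall z : R * R,
    ex_derive (fun t => u (t, snd z)) (fst z) /\
    ex_derive (fun t => u (fst z, t)) (snd z) /\
    continuous u z /\ continuous (d1 u) z /\ continuous (d2 u) z.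

(* the support of u is a compact subset of the bounded open set Omega:
   u vanishes within distance delta of the complement of Omega *)
Definition compact_supp_in (Omega : R * R -> Prop) (u : R * R -> R) : Prop :=
  exists delta : R, 0 < delta /\
    forall z w : R * R, u z <> 0 -> ~ Omega w -> delta <= dist2 z w.

(* integral over R^2 (iterated; integrands are continuous with compact support) *)
Definition integral2 (f : R * R -> R) : R :=
  RInt_gen (fun x => RInt_gen (fun y => f (x, y))
                       (Rbar_locally m_infty) (Rbar_locally p_infty))
           (Rbar_locally m_infty) (Rbar_locally p_infty).

Definition rayleigh (p : R) (u : R * R -> R) : R :=
  integral2 (fun z => powp (sqrt (d1 u z ^ 2 + d2 u z ^ 2)) p) /
  integral2 (fun z => powp (Rabs (u z)) p).

(* first Dirichlet eigenvalue of the p-Laplacian, variational characterization: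
   infimum of the Rayleigh quotient over C^1_c(Omega) \ {0}
   (dense in W^{1,p}_0(Omega)). *)
Definition lambda1 (Omega : R * R -> Prop) (p : R) : Rbar :=
  Glb_Rbar (fun l => exists u : R * R -> R,
     C1_2d u /\ compact_supp_in Omega u /\ (exists z, u z <> 0) /\ l = rayleigh p u).

Definition sector (n : nat) : R * R -> Prop :=
  fun z => exists rho theta : R, 0 < rho < 1 /\ 0 < theta < PI / INR n /\
     z = (rho * cos theta, rho * sin theta).

Definition tau (n : nat) (p : R) : Rbar := lambda1 (sector n) p.

(* mu is a radial eigenvalue: nontrivial solution of
   -(r |u'|^{p-2} u')' = mu r |u|^{p-2} u on (0,1), u'(0) = 0, u(1) = 0.
   u is taken C^1 (on R, equivalently on [0,1] after extension). *)
Definition radial_eig (p mu : R) : Prop :=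
  exists u : R -> R,
    (forall r, ex_derive u r) /\ (forall r, continuous (Derive u) r) /\
    (forall r, 0 < r < 1 ->
       ex_derive (fun s => s * powp (Rabs (Derive u s)) (p - 2) * Derive u s) r /\
       - Derive (fun s => s * powp (Rabs (Derive u s)) (p - 2) * Derive u s) r
         = mu * r * powp (Rabs (u r)) (p - 2) * u r) /\
    Derive u 0 = 0 /\ u 1 = 0 /\
    (exists r, 0 <= r <= 1 /\ u r <> 0).

Definition kth_radial_eig (p : R) (k : nat) (mu : R) : Prop :=
  radial_eig p mu /\
  exists l : list R, NoDup l /\ length l = (k - 1)%nat /\
    forall x, In x l <-> (radial_eig p x /\ x < mu).

(* Main.v *)
Require Import Defs.
From Stdlib Require Import Reals ZArith Lra Lia List Classical ClassicalChoice FinFun Ranalysis5.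
From Coquelicot Require Import Coquelicot.
Import Defs.
Open Scope R_scope.

(** For fixed [n] compare [mu_k(p)] and [tau_n(p)] at [p = 2] and at a large [p], and apply an
    intermediate value argument in [p].

    Radial side.  With [Y = phi_p(u')] and weighted polar coordinates
    [u = rho^(1/p) cos b], [Y = - rho^(1/p') sin b], the radial equation for [mu = 1] reduces to a scalar
    equation for [b] that is Lipschitz in [b] away from [r = 0], one-sided Lipschitz near [r = 0], and
    Lipschitz in [p].  The zeros [nu_1 < nu_2 < ...] of [u] are the radii where [b] is an odd multiple
    of [pi/2]; they are crossed transversally, hence depend continuously on [p].  By scaling and by
    uniqueness of the initial value problem, [mu_k(p) = nu_k(p)^p].  Moreover [nu_k(p) >= 2k - 1] for
    all [p >= 2], because consecutive zeros and critical points are at distance at least 1, and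
    [nu_k(2) <= k pi] by Sturm comparison.

    Sector side.  At [p = 2] the supersolution [Im(z^n) (1 - |z|^2) exp(- n |z|^2 / 2)] gives
    [tau_n(2) >= n (n + 10)] (Barta).  For large [p] a smoothed distance cone on the incircle, of radius
    [sin a / (1 + sin a)] with [a = pi / (2n)], gives [tau_n(p)^(1/p) < 2k - 1] as soon as
    [1 + 1 / sin a < 2k - 1].  Both conditions hold for [n] the integer part of [(k - 1) pi - 1/10].

    Continuity in [p] of [tau_n] is only needed from the right and upper semicontinuously from the left:
    the latter holds because it is an infimum, the former because [p tau_n(p)^(1/p)] is nondecreasing
    (use [|u|^(q/p)] as a competitor).  This avoids any regularity theory. *)

(** * Real powers and the map [phi_p] *)

(** Two things obstruct a direct ODE argument: the factor 1/r at the origin, and the map phi_{p'},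
    whose slope at 0 is infinite for p > 2, so that the first-order system is not Lipschitz at
    critical points of u. The exponents 1/p and 1/p' of the polar coordinates match the
    homogeneities of u and Y. The radius therefore drops out of the angle equation, and the powers
    |sin b|^p' and |cos b|^p left in it have exponents at least 1, hence are Lipschitz.

    The choice of n is squeezed from two sides. For large p the bound on tau_n^(1/p) is the
    reciprocal inradius 1 + 1/sin a, about 1 + 2n/pi, which forces n slightly below (k-1) pi. At p =
    2 the requirement n (n+10) > (k pi)^2 is roughly n + 5 > k pi, which such an n meets because 5
    exceeds pi with room for rounding. For k = 2 the recipe gives n = 3 and both inequalities fail;
    from k = 3 on they hold. *)

Definition phi (p x : R) : R := powp (Rabs x) (p - 2) * x.

Ltac eval_derive :=
  repeat match goal with
  | D : is_derive ?f ?x ?l |- context [Derive (fun t => ?f t) ?x] =>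
      replace (Derive (fun t => f t) x) with l by (symmetry; now apply is_derive_unique)
  end.

Lemma is_derive_continuous (f : R -> R) x l : is_derive f x l -> continuous f x.
Proof. intros H. apply (ex_derive_continuous f x). now exists l. Qed.

Lemma powp_0 q : powp 0 q = 0.
Proof. unfold powp. destruct (Req_EM_T 0 0); [easy|congruence]. Qed.

Lemma powp_Rpower x q : 0 < x -> powp x q = Rpower x q.
Proof. intros. unfold powp. destruct (Req_EM_T x 0); [lra|easy]. Qed.

Lemma Rpower_pos x q : 0 < Rpower x q.
Proof. apply exp_pos. Qed.

Lemma powp_ge0 x q : 0 <= powp x q.
Proof. unfold powp. destruct (Req_EM_T x 0); [lra|]. left; apply Rpower_pos. Qed.

Lemma powp_gt0 x q : 0 < x -> 0 < powp x q.
Proof. intros. rewrite powp_Rpower by easy. apply Rpower_pos. Qed.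

Lemma powp_neq0 x q : x <> 0 -> powp x q <> 0.
Proof. intros. unfold powp. destruct (Req_EM_T x 0); [lra|].
  apply Rgt_not_eq, Rpower_pos. Qed.

Lemma powp_1l q : powp 1 q = 1.
Proof. rewrite powp_Rpower by lra. unfold Rpower. rewrite ln_1, Rmult_0_r. apply exp_0. Qed.

Lemma powp_1r x : 0 <= x -> powp x 1 = x.
Proof. intros [H|<-]; [rewrite powp_Rpower, Rpower_1|rewrite powp_0]; auto. Qed.

Lemma powp_plus x a b : powp x (a + b) = powp x a * powp x b.
Proof. unfold powp. destruct (Req_EM_T x 0); [lra|]. apply Rpower_plus. Qed.

Lemma powp_2 x : 0 <= x -> powp x 2 = x ^ 2.
Proof. intros. replace 2 with (1 + 1) at 1 by ring.
  rewrite powp_plus, powp_1r by easy. ring. Qed.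

Lemma powp_powp x a b : 0 <= x -> powp (powp x a) b = powp x (a * b).
Proof. intros [H|<-].
  - rewrite (powp_Rpower x), powp_Rpower, powp_Rpower, Rpower_mult;
      auto using Rpower_pos.
  - now rewrite !powp_0.
Qed.

Lemma powp_mult x y q : 0 <= x -> 0 <= y -> powp (x * y) q = powp x q * powp y q.
Proof.
  intros [Hx|<-]; [|now rewrite Rmult_0_l, !powp_0, Rmult_0_l].
  intros [Hy|<-]; [|now rewrite Rmult_0_r, !powp_0, Rmult_0_r].
  rewrite !powp_Rpower; auto using Rmult_lt_0_compat.
  now apply eq_sym, Rpower_mult_distr.
Qed.

Lemma powp_inv x q : 0 < x -> powp x (- q) = / powp x q.
Proof. intros. rewrite !powp_Rpower by easy. apply Rpower_Ropp. Qed.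

Lemma powp_lt x y q : 0 <= x < y -> 0 < q -> powp x q < powp y q.
Proof. intros [[Hx|<-] Hy] Hq.
  - rewrite !powp_Rpower by lra. now apply Rlt_Rpower_l.
  - rewrite powp_0. apply powp_gt0. lra.
Qed.

Lemma powp_le x y q : 0 <= x <= y -> 0 <= q -> powp x q <= powp y q.
Proof. intros [[Hx|<-] Hy] Hq.
  - rewrite !powp_Rpower by lra. now apply Rle_Rpower_l.
  - rewrite powp_0. apply powp_ge0.
Qed.

Lemma powp_le_exp x a b : 0 <= x <= 1 -> a <= b -> powp x b <= powp x a.
Proof.
  intros [[Hx|<-] H1] Hab; [|rewrite !powp_0; lra].
  rewrite !powp_Rpower by easy. unfold Rpower.
  assert (ln x <= 0) by (rewrite <- ln_1; apply ln_le; lra).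
  destruct (Req_dec (b * ln x) (a * ln x)) as [->|]; [lra|].
  left; apply exp_increasing. nra.
Qed.

Lemma powp_le_1 x a : 0 <= x <= 1 -> 0 <= a -> powp x a <= 1.
Proof. intros. rewrite <- (powp_1l a). now apply powp_le. Qed.

Lemma is_derive_powp_abs q x : x <> 0 ->
  is_derive (fun x => powp (Rabs x) q) x (q * phi q x).
Proof.
  intros Hx.
  apply (is_derive_ext_loc (fun y => exp (q * ln (Rabs y)))).
  - exists (mkposreal _ (Rabs_pos_lt x Hx)). intros y Hy.
    rewrite powp_Rpower; [easy|]. apply Rabs_pos_lt. intros ->.
    unfold ball in Hy; simpl in Hy. unfold AbsRing_ball, abs, minus, plus, opp in Hy; simpl in Hy.
    rewrite Rplus_0_l, Rabs_Ropp in Hy. lra.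
  - pose proof (Rabs_pos_lt x Hx).
    auto_derive; [repeat split; auto|].
    unfold phi. replace (q - 2) with (q + - (1 + 1)) by ring.
    rewrite powp_plus, powp_inv, powp_plus, powp_1r by lra.
    rewrite powp_Rpower by easy. unfold Rpower.
    replace (Rabs x * Rabs x) with (x * x)
      by (rewrite <- Rabs_mult; rewrite Rabs_pos_eq; [easy|apply Rle_0_sqr]).
    destruct (Rlt_dec 0 x).
    + rewrite sign_eq_1, Rabs_pos_eq by lra. field. lra.
    + rewrite sign_eq_m1, Rabs_left by lra. field. lra.
Qed.

Lemma powp_continuous q x : 0 < q -> continuous (fun x => powp (Rabs x) q) x.
Proof.
  intros Hq. destruct (Req_dec x 0) as [->|Hx].
  - apply continuity_pt_filterlim. intros eps Heps.
    exists (powp eps (/ q)). split; [now apply powp_gt0|].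
    intros y [_ Hy]. simpl in *. unfold Rdist in *. rewrite Rminus_0_r in Hy.
    rewrite Rabs_R0, powp_0, Rminus_0_r, Rabs_pos_eq by apply powp_ge0.
    replace eps with (powp (powp eps (/ q)) q).
    + apply powp_lt; [|easy]. split; [apply Rabs_pos|easy].
    + rewrite powp_powp, Rinv_l, powp_1r; lra.
  - eapply is_derive_continuous. now apply is_derive_powp_abs.
Qed.

(** At 0 the difference quotient has modulus |h|^(q-1), which tends to 0 because q > 1. *)
Lemma is_derive_powp q x : 1 < q ->
  is_derive (fun x => powp (Rabs x) q) x (q * phi q x).
Proof.
  intros Hq. destruct (Req_dec x 0) as [->|Hx]; [|now apply is_derive_powp_abs].
  unfold phi. rewrite !Rmult_0_r. apply is_derive_Reals. intros eps Heps.
  assert (Hc := powp_continuous (q - 1) 0 ltac:(lra)).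
  apply continuity_pt_filterlim in Hc. destruct (Hc eps Heps) as [d [Hd H]].
  exists (mkposreal d Hd). intros h Hh Hhd. simpl in *.
  specialize (H h). unfold Rdist in H.
  rewrite Rminus_0_r, Rabs_R0, powp_0, Rminus_0_r in H.
  rewrite Rplus_0_l, Rabs_R0, powp_0, !Rminus_0_r. unfold Rdiv.
  rewrite Rabs_mult, (Rabs_pos_eq (powp _ _)) by apply powp_ge0.
  rewrite Rabs_inv.
  pose proof (Rabs_pos_lt h Hh).
  replace q with (q - 1 + 1) by ring.
  rewrite powp_plus, powp_1r by lra.
  rewrite Rmult_assoc, Rinv_r, Rmult_1_r by lra.
  rewrite (Rabs_pos_eq (powp _ _)) in H by apply powp_ge0.
  apply H. repeat split; auto.
Qed.

Lemma phi_0 p : phi p 0 = 0.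
Proof. unfold phi. ring. Qed.

Lemma phi_opp p x : phi p (- x) = - phi p x.
Proof. unfold phi. rewrite Rabs_Ropp. ring. Qed.

Lemma phi_mult p x y : phi p (x * y) = phi p x * phi p y.
Proof. unfold phi. rewrite Rabs_mult, powp_mult by apply Rabs_pos. ring. Qed.

Lemma phi_Rpower p x : 0 < x -> phi p x = Rpower x (p - 1).
Proof.
  intros. unfold phi. rewrite Rabs_pos_eq, powp_Rpower by lra.
  rewrite <- (Rpower_1 x) at 2 by easy. rewrite <- Rpower_plus. f_equal. ring.
Qed.

Lemma phi_powp p x : 0 <= x -> phi p x = powp x (p - 1).
Proof. intros [H|<-]; [rewrite phi_Rpower, powp_Rpower|rewrite phi_0, powp_0]; auto. Qed.

Lemma phi_gt0 p x : 0 < x -> 0 < phi p x.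
Proof. intros. rewrite phi_Rpower by easy. apply Rpower_pos. Qed.

Lemma phi_ge0 p x : 0 <= x -> 0 <= phi p x.
Proof. intros. rewrite phi_powp by easy. apply powp_ge0. Qed.

Lemma phi_abs p x : Rabs (phi p x) = powp (Rabs x) (p - 1).
Proof.
  unfold phi. rewrite Rabs_mult, (Rabs_pos_eq (powp _ _)) by apply powp_ge0.
  replace (p - 1) with (p - 2 + 1) by ring.
  rewrite powp_plus, powp_1r by apply Rabs_pos. ring.
Qed.

Lemma phi_neq0 p x : x <> 0 -> phi p x <> 0.
Proof. intros. unfold phi. apply Rmult_integral_contrapositive; split; auto.
  apply powp_neq0. now apply Rabs_no_R0. Qed.

Lemma phi_mul_id p x : phi p x * x = powp (Rabs x) p.
Proof.
  unfold phi. replace p with (p - 2 + 2) at 2 by ring.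
  rewrite powp_plus, powp_2, <- Rsqr_pow2, <- Rsqr_abs by apply Rabs_pos. unfold Rsqr. ring.
Qed.

Lemma phi_2 x : phi 2 x = x.
Proof.
  unfold phi, powp. destruct (Req_EM_T (Rabs x) 0) as [H|H].
  - destruct (Req_dec x 0); [lra|]. now apply Rabs_no_R0 in H.
  - replace (2 - 2) with 0 by ring. rewrite Rpower_O; [ring|].
    apply Rabs_pos_lt. intros ->. now rewrite Rabs_R0 in H.
Qed.

(** [phi p] is odd and homogeneous of degree p - 1, so composition multiplies the degrees. Conjugate
    exponents give degree 1, the identity. *)
Lemma phi_phi p q x : phi q (phi p x) = phi ((p - 1) * (q - 1) + 1) x.
Proof.
  destruct (Rtotal_order x 0) as [H|[->|H]]; [| now rewrite !phi_0|].
  - replace x with (- (- x)) by ring. rewrite !(phi_opp _ (- x)), phi_opp.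
    f_equal. rewrite (phi_powp p), phi_powp, phi_powp, powp_powp; try lra;
     [|apply powp_ge0]. f_equal. ring.
  - rewrite (phi_powp p), phi_powp, phi_powp, powp_powp; try lra;
     [|apply powp_ge0]. f_equal. ring.
Qed.

Lemma phi_inv p q x : (p - 1) * (q - 1) = 1 -> phi q (phi p x) = x.
Proof. intros H. rewrite phi_phi, H. replace (1 + 1) with 2 by ring. apply phi_2. Qed.

Lemma phi_continuous p x : 1 < p -> continuous (phi p) x.
Proof.
  intros Hp. destruct (Req_dec x 0) as [->|Hx].
  - apply continuity_pt_filterlim. intros eps Heps.
    assert (Hc := powp_continuous (p - 1) 0 ltac:(lra)).
    apply continuity_pt_filterlim in Hc. destruct (Hc eps Heps) as [d [Hd H]].
    exists d. split; [easy|]. intros y Hy. specialize (H y Hy). simpl in *. unfold Rdist in *.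
    rewrite phi_0, Rminus_0_r, phi_abs.
    rewrite Rabs_R0, powp_0, Rminus_0_r, Rabs_pos_eq in H; [easy|apply powp_ge0].
  - apply (continuous_mult (fun x => powp (Rabs x) (p - 2)) (fun x => x)); [|apply continuous_id].
    eapply is_derive_continuous. now apply is_derive_powp_abs.
Qed.

Lemma is_derive_phi p x : x <> 0 ->
  is_derive (phi p) x ((p - 1) * powp (Rabs x) (p - 2)).
Proof.
  intros Hx. unfold phi.
  evar_last.
  apply (is_derive_mult (fun x => powp (Rabs x) (p - 2)) (fun x => x) x _ _
     (is_derive_powp_abs (p - 2) x Hx) (is_derive_id x)).
  exact Rmult_comm.
  unfold mult, plus, one; simpl.
  rewrite Rmult_assoc, phi_mul_id. ring.
Qed.

Lemma powp_lip q x y : 1 <= q -> 0 <= x <= 1 -> 0 <= y <= 1 ->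
  Rabs (powp x q - powp y q) <= q * Rabs (x - y).
Proof.
  intros Hq Hx Hy. destruct (Req_dec q 1) as [->|Hq1].
  { rewrite !powp_1r; lra. }
  destruct (MVT_gen (fun x => powp (Rabs x) q) y x (fun x => q * phi q x)) as [c [Hc E]].
  - intros; apply is_derive_powp; lra.
  - intros. apply continuity_pt_filterlim, powp_continuous; lra.
  - rewrite !Rabs_pos_eq in E by lra. rewrite E, Rabs_mult.
    apply Rmult_le_compat_r; [apply Rabs_pos|].
    rewrite Rabs_mult, phi_abs, (Rabs_pos_eq q) by lra.
    assert (0 <= c <= 1).
    { revert Hc. unfold Rmin, Rmax. destruct (Rle_dec y x); lra. }
    rewrite <- (Rmult_1_r q) at 3. apply Rmult_le_compat_l; [lra|].
    apply powp_le_1; [|lra]. rewrite Rabs_pos_eq; lra.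
Qed.

Lemma is_derive_powp_exp x q : 0 < x -> is_derive (fun q => powp x q) q (powp x q * ln x).
Proof.
  intros Hx. apply (is_derive_ext (fun q => exp (q * ln x))).
  - intros t. now rewrite powp_Rpower.
  - rewrite powp_Rpower by easy. unfold Rpower. auto_derive; auto. ring.
Qed.

Lemma powp_continuous_exp x q : 0 <= x -> continuous (fun q => powp x q) q.
Proof.
  intros [Hx|<-].
  - eapply is_derive_continuous. now apply is_derive_powp_exp.
  - apply (continuous_ext (fun _ => 0)); [intros; now rewrite powp_0|apply continuous_const].
Qed.

(** The derivative in the exponent is x^c ln x, and c >= 1 gives x^c |ln x| <= x |ln x| <= 1,
    uniformly down to x = 0. *)
Lemma powp_lip_exp x a b : 0 <= x <= 1 -> 1 <= a -> 1 <= b ->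
  Rabs (powp x a - powp x b) <= Rabs (a - b).
Proof.
  intros [[Hx|<-] H1] Ha Hb; [|rewrite !powp_0, Rminus_diag, Rabs_R0; apply Rabs_pos].
  destruct (MVT_gen (fun q => powp x q) b a (fun q => powp x q * ln x)) as [c [Hc E]].
  - intros; now apply is_derive_powp_exp.
  - intros. apply continuity_pt_filterlim, powp_continuous_exp; lra.
  - rewrite E, Rabs_mult. rewrite <- (Rmult_1_l (Rabs (a - b))) at 2.
    apply Rmult_le_compat_r; [apply Rabs_pos|].
    assert (1 <= c).
    { revert Hc. unfold Rmin, Rmax. destruct (Rle_dec b a); lra. }
    assert (powp x c <= x).
    { rewrite <- (powp_1r x) at 2 by lra. apply powp_le_exp; lra. }
    assert (0 <= - ln x) by (pose proof (ln_le x 1 Hx H1); rewrite ln_1 in *; lra).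
    assert (x * - ln x <= 1).
    { rewrite <- ln_Rinv by easy.
      assert (ln (/ x) <= / x).
      { assert (0 < / x) by now apply Rinv_0_lt_compat.
        pose proof (exp_ineq1_le (ln (/ x))) as He. rewrite exp_ln in He; lra. }
      apply Rle_trans with (x * / x); [apply Rmult_le_compat_l; lra|].
      rewrite Rinv_r; lra. }
    rewrite Rabs_mult, (Rabs_pos_eq (powp _ _)) by apply powp_ge0.
    rewrite Rabs_left1 by lra.
    pose proof (powp_ge0 x c). nra.
Qed.

(** * Differential inequalities and scalar initial value problems *)

Lemma mean_value (f df : R -> R) a b : a < b ->
  (forall t, a < t < b -> is_derive f t (df t)) ->
  (forall t, a <= t <= b -> continuous f t) ->
  exists c, a < c < b /\ f b - f a = df c * (b - a).
Proof.
  intros Hab Hd Hc.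
  assert (pr : forall c, a < c < b -> derivable_pt f c).
  { intros c Hcc. exists (df c). now apply is_derive_Reals, Hd. }
  destruct (MVT f (fun x => x) a b pr (fun c _ => derivable_pt_id c) Hab) as [c [P E]].
  - intros. now apply continuity_pt_filterlim, Hc.
  - intros. apply derivable_continuous_pt, derivable_pt_id.
  - exists c. split; [easy|]. rewrite derive_pt_id in E.
    rewrite (derive_pt_eq_0 f c (df c) (pr c P)) in E; [lra|].
    now apply is_derive_Reals, Hd.
Qed.

Lemma deriv_nonpos_le (f df : R -> R) a b : a <= b ->
  (forall t, a < t < b -> is_derive f t (df t)) ->
  (forall t, a < t < b -> df t <= 0) ->
  (forall t, a <= t <= b -> continuous f t) -> f b <= f a.
Proof.
  intros [Hab|<-] Hd Hn Hc; [|lra].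
  destruct (mean_value f df a b Hab Hd Hc) as [c [H E]].
  specialize (Hn c H). nra.
Qed.

Lemma deriv_nonneg_le (f df : R -> R) a b : a <= b ->
  (forall t, a < t < b -> is_derive f t (df t)) ->
  (forall t, a < t < b -> 0 <= df t) ->
  (forall t, a <= t <= b -> continuous f t) -> f a <= f b.
Proof.
  intros [Hab|<-] Hd Hn Hc; [|lra].
  destruct (mean_value f df a b Hab Hd Hc) as [c [H E]].
  specialize (Hn c H). nra.
Qed.

Lemma deriv_zero_eq (f : R -> R) a b : a <= b ->
  (forall t, a < t < b -> is_derive f t 0) ->
  (forall t, a <= t <= b -> continuous f t) -> f a = f b.
Proof.
  intros Hab Hd Hc. apply Rle_antisym.
  - apply (deriv_nonneg_le f (fun _ => 0)); auto; intros; lra.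
  - apply (deriv_nonpos_le f (fun _ => 0)); auto; intros; lra.
Qed.

Lemma gronwall (g dg : R -> R) a b K e : a <= b -> 0 <= K -> 0 <= e ->
  (forall t, a < t < b -> is_derive g t (dg t)) ->
  (forall t, a < t < b -> dg t <= K * g t + e) ->
  (forall t, a <= t <= b -> continuous g t) ->
  g b <= exp (K * (b - a)) * (g a + e * (b - a)).
Proof.
  intros Hab HK He Hd Hn Hc.
  assert (H : g b * exp (- (K * (b - a))) - e * (b - a)
              <= g a * exp (- (K * (a - a))) - e * (a - a)).
  { apply (deriv_nonpos_le (fun t => g t * exp (- (K * (t - a))) - e * (t - a))
      (fun t => (dg t - K * g t) * exp (- (K * (t - a))) - e)); auto.
    - intros t Ht. specialize (Hd t Ht).
      auto_derive; [now exists (dg t)|]. eval_derive. unfold Rminus. ring.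
    - intros t Ht. specialize (Hn t Ht).
      assert (0 < exp (- (K * (t - a))) <= 1).
      { split; [apply exp_pos|]. rewrite <- exp_0.
        destruct (Req_dec (K * (t - a)) 0) as [->|]; [rewrite Ropp_0; lra|].
        left. apply exp_increasing. assert (0 <= K * (t - a)) by (apply Rmult_le_pos; lra). lra. }
      nra.
    - intros t Ht. apply (continuous_minus (fun t => g t * exp (- (K * (t - a)))) (fun t => e * (t - a))).
      + apply (continuous_mult g); [now apply Hc|].
        apply is_derive_continuous with (- K * exp (- (K * (t - a)))). auto_derive; auto. unfold Rminus. ring.
      + apply is_derive_continuous with e. auto_derive; auto. ring. }
  rewrite Rminus_diag, !Rmult_0_r, Ropp_0, exp_0 in H.
  rewrite exp_Ropp in H.
  assert (Hp : 0 < exp (K * (b - a))) by apply exp_pos.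
  assert (g b * / exp (K * (b - a)) <= g a + e * (b - a)) as H1 by lra.
  apply (Rmult_le_compat_l (exp (K * (b - a)))) in H1; [|lra].
  replace (exp (K * (b - a)) * (g b * / exp (K * (b - a)))) with (g b) in H1; [easy|].
  field. lra.
Qed.

(** Only the product d d' is bounded, so a one-sided Lipschitz condition on the field is enough. The
    defect is absorbed by 2 eta |d| <= eta^2 + d^2, which costs the extra 1 in the exponent. *)
Lemma gronwall_diff (d dd : R -> R) a b L eta : a <= b -> 0 <= L ->
  (forall t, a < t < b -> is_derive d t (dd t)) ->
  (forall t, a < t < b -> d t * dd t <= L * d t ^ 2 + eta * Rabs (d t)) ->
  (forall t, a <= t <= b -> continuous d t) ->
  d b ^ 2 <= exp ((2 * L + 1) * (b - a)) * (d a ^ 2 + eta ^ 2 * (b - a)).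
Proof.
  intros Hab HL Hd Hn Hc.
  apply (gronwall (fun t => d t ^ 2) (fun t => 2 * (d t * dd t))); auto.
  - lra.
  - apply pow2_ge_0.
  - intros t Ht. specialize (Hd t Ht). auto_derive; [now exists (dd t)|].
    eval_derive. ring.
  - intros t Ht. specialize (Hn t Ht).
    assert (2 * (eta * Rabs (d t)) <= eta ^ 2 + d t ^ 2).
    { rewrite <- (pow2_abs (d t)). pose proof (pow2_ge_0 (eta - Rabs (d t))). lra. }
    lra.
  - intros t Ht. apply (continuous_ext (fun t => d t * d t)); [intros x; change (@eq R (d x * d x) (d x ^ 2)); ring|].
    apply (continuous_mult d d); now apply Hc.
Qed.

Lemma deriv_abs_le (d dd w dw : R -> R) a b : a <= b ->
  (forall t, a < t < b -> is_derive d t (dd t)) ->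
  (forall t, a < t < b -> is_derive w t (dw t)) ->
  (forall t, a < t < b -> Rabs (dd t) <= dw t) ->
  (forall t, a <= t <= b -> continuous d t) ->
  (forall t, a <= t <= b -> continuous w t) ->
  Rabs (d a) <= w a -> Rabs (d b) <= w b.
Proof.
  intros Hab Hd Hw Hl Hcd Hcw H0.
  apply Rabs_le_between in H0. apply Rabs_le_between. split.
  - assert (H : d a + w a <= d b + w b); [|lra].
    apply (deriv_nonneg_le (fun t => d t + w t) (fun t => dd t + dw t)); auto; intros.
    + apply (is_derive_plus d w); auto.
    + specialize (Hl t H). apply Rabs_le_between in Hl. lra.
    + apply (continuous_plus d w); auto.
  - assert (H : d b - w b <= d a - w a); [|lra].
    apply (deriv_nonpos_le (fun t => d t - w t) (fun t => dd t - dw t)); auto; intros.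
    + apply (is_derive_minus d w); auto.
    + specialize (Hl t H). apply Rabs_le_between in Hl. lra.
    + apply (continuous_minus d w); auto.
Qed.

Lemma cauchy_bound_lim (a e : nat -> R) :
  (forall n m, (n <= m)%nat -> Rabs (a n - a m) <= e n) ->
  is_lim_seq e 0 ->
  is_lim_seq a (real (Lim_seq a)) /\ forall n, Rabs (a n - real (Lim_seq a)) <= e n.
Proof.
  intros H He.
  assert (Hl : ex_finite_lim_seq a).
  { apply ex_lim_seq_cauchy_corr. intros eps.
    apply is_lim_seq_spec in He. destruct (He (pos_div_2 eps)) as [N HN].
    exists N. intros n m Hn Hm.
    specialize (HN N (le_n _)). simpl in HN. rewrite Rminus_0_r in HN.
    pose proof (H N n Hn) as H1. pose proof (H N m Hm) as H2.
    apply Rabs_lt_between in HN. apply Rabs_le_between in H1, H2.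
    apply Rabs_lt_between. simpl. lra. }
  apply Lim_seq_correct' in Hl. split; [easy|].
  intros n.
  assert (Hl' : is_lim_seq (fun m => Rabs (a n - a m)) (Rabs (a n - Lim_seq a))).
  { apply (is_lim_seq_abs (fun m => a n - a m) (a n - Lim_seq a)).
    apply is_lim_seq_minus'; [apply is_lim_seq_const|easy]. }
  apply (is_lim_seq_le_loc (fun m => Rabs (a n - a m)) (fun _ => e n)
     (Rabs (a n - Lim_seq a)) (e n)); auto.
  - exists n. intros m Hm. now apply H.
  - apply is_lim_seq_const.
Qed.

(** A quadratic remainder bound is a closed condition: unlike differentiability it survives
    pointwise limits. *)
Lemma is_derive_of_quadratic (y : R -> R) a s D K : a < s ->
  (forall t, a < t -> Rabs (y t - y s - (t - s) * D) <= K * (t - s) ^ 2) ->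
  is_derive y s D.
Proof.
  intros Has H. apply is_derive_Reals. intros eps Heps.
  assert (HK : 0 < Rabs K + 1) by (pose proof (Rabs_pos K); lra).
  assert (Hd : 0 < Rmin (s - a) (eps / (Rabs K + 1))).
  { apply Rmin_glb_lt; [lra|]. now apply Rdiv_lt_0_compat. }
  exists (mkposreal _ Hd). simpl. intros h Hh Hl.
  assert (Hl1 : Rabs h < s - a) by (eapply Rlt_le_trans; [apply Hl|apply Rmin_l]).
  assert (Hl2 : Rabs h < eps / (Rabs K + 1)) by (eapply Rlt_le_trans; [apply Hl|apply Rmin_r]).
  apply Rabs_lt_between in Hl1.
  specialize (H (s + h) ltac:(lra)).
  replace (s + h - s) with h in H by ring.
  replace ((y (s + h) - y s) / h - D) with ((y (s + h) - y s - h * D) / h) by (field; easy).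
  unfold Rdiv. rewrite Rabs_mult, Rabs_inv.
  pose proof (Rabs_pos_lt h Hh) as Hp.
  apply Rle_lt_trans with (Rabs K * Rabs h).
  - apply Rmult_le_reg_r with (Rabs h); [easy|].
    rewrite Rmult_assoc, Rinv_l, Rmult_1_r by lra.
    eapply Rle_trans; [apply H|]. rewrite <- pow2_abs.
    pose proof (RRle_abs K). pose proof (pow2_ge_0 (Rabs h)). nra.
  - apply Rle_lt_trans with (Rabs K * (eps / (Rabs K + 1))).
    + apply Rmult_le_compat_l; [apply Rabs_pos|lra].
    + apply Rmult_lt_reg_r with (Rabs K + 1); [easy|].
      replace (Rabs K * (eps / (Rabs K + 1)) * (Rabs K + 1)) with (Rabs K * eps) by (field; lra).
      lra.
Qed.

(** Passing to the limit in the remainder bound replaces any exchange of limit and integral. The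
    sequences [x] and [y] are kept apart because the derivative of a Picard iterate involves the
    previous iterate. *)
Lemma ode_limit (F : R -> R -> R) (x y : nat -> R -> R) (z : R -> R) a s K : a < s ->
  (forall t, a < t -> exists N, forall n, (N <= n)%nat ->
     Rabs (y n t - y n s - (t - s) * F s (x n s)) <= K * (t - s) ^ 2) ->
  (forall t, a < t -> is_lim_seq (fun n => y n t) (z t)) ->
  is_lim_seq (fun n => F s (x n s)) (F s (z s)) ->
  is_derive z s (F s (z s)).
Proof.
  intros Has H Hy HF.
  apply (is_derive_of_quadratic z a s _ K Has).
  intros t Ht. destruct (H t Ht) as [N HN].
  apply (is_lim_seq_le_loc (fun n => Rabs (y n t - y n s - (t - s) * F s (x n s)))
    (fun _ => K * (t - s) ^ 2) (Rabs (z t - z s - (t - s) * F s (z s))) (K * (t - s) ^ 2)).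
  - now exists N.
  - apply (is_lim_seq_abs _ (Finite _)).
    apply is_lim_seq_minus'.
    + apply is_lim_seq_minus'; now apply Hy.
    + apply is_lim_seq_mult'; [apply is_lim_seq_const|easy].
  - apply is_lim_seq_const.
Qed.

Lemma quadratic_remainder (F : R -> R -> R) (x y : R -> R) a L M s t : 0 <= L ->
  a <= s -> a <= t ->
  (forall t s u v, a <= t -> a <= s -> Rabs (F t u - F s v) <= L * (Rabs (t - s) + Rabs (u - v))) ->
  (forall t s, a <= t -> a <= s -> Rabs (x t - x s) <= M * Rabs (t - s)) ->
  (forall t, a <= t -> is_derive y t (F t (x t))) ->
  Rabs (y t - y s - (t - s) * F s (x s)) <= L * (1 + M) * (t - s) ^ 2.
Proof.
  intros HL Hs Ht HF Hx Hy.
  destruct (MVT_gen y s t (fun t => F t (x t))) as [c [Hc E]].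
  - intros r Hr. apply Hy. revert Hr. unfold Rmin. destruct (Rle_dec s t); lra.
  - intros r Hr. apply continuity_pt_filterlim. eapply is_derive_continuous, Hy.
    revert Hr. unfold Rmin. destruct (Rle_dec s t); lra.
  - rewrite E.
    assert (Hc' : a <= c /\ Rabs (c - s) <= Rabs (t - s)).
    { revert Hc. unfold Rmin, Rmax. destruct (Rle_dec s t); intros; split; try lra.
      - rewrite !Rabs_pos_eq; lra.
      - rewrite !Rabs_left1; lra. }
    replace (F c (x c) * (t - s) - (t - s) * F s (x s))
      with ((F c (x c) - F s (x s)) * (t - s)) by ring.
    rewrite Rabs_mult, <- (pow2_abs (t - s)).
    pose proof (HF c s (x c) (x s) (proj1 Hc') Hs).
    pose proof (Hx c s (proj1 Hc') Hs).
    pose proof (Rabs_pos (t - s)). pose proof (Rabs_pos (c - s)).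
    assert (0 <= M * Rabs (c - s)) by (pose proof (Rabs_pos (x c - x s)); lra).
    (* The sign of [M] is not given; it can be read off the Lipschitz bound only at two distinct
       points. *)
    destruct (Req_dec (Rabs (c - s)) 0) as [Z|Z].
    + rewrite Z in *. rewrite Rmult_0_r in *.
      destruct (Req_dec (Rabs (t - s)) 0) as [Z'|Z']; [rewrite Z'; lra|].
      assert (Rabs (F c (x c) - F s (x s)) <= 0) by nra.
      pose proof (Hx t s Ht Hs). pose proof (Rabs_pos (x t - x s)).
      assert (0 <= M) by (destruct (Rle_dec 0 M); [easy|nra]).
      assert (0 <= L * (1 + M)) by nra.
      assert (0 <= L * (1 + M) * Rabs (t - s) ^ 2) by (apply Rmult_le_pos; [easy|apply pow2_ge_0]).
      nra.
    + assert (0 <= M) by (destruct (Rle_dec 0 M); [easy|nra]).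
      assert (Rabs (F c (x c) - F s (x s)) <= L * (1 + M) * Rabs (t - s)).
      { assert (M * Rabs (c - s) <= M * Rabs (t - s)) by (apply Rmult_le_compat_l; lra).
        eapply Rle_trans; [apply H|].
        rewrite Rmult_assoc. apply Rmult_le_compat_l; [easy|]. lra. }
      nra.
Qed.

(** * Global Picard iteration for a bounded Lipschitz field *)

Section Picard.
Variables (F : R -> R -> R) (L M y0 : R).
Hypothesis HL : 0 < L.
Hypothesis HF : forall t s u v, Rabs (F t u - F s v) <= L * (Rabs (t - s) + Rabs (u - v)).
Hypothesis HM : forall t u, Rabs (F t u) <= M.

Fixpoint picard_iter (n : nat) : R -> R :=
  match n with
  | O => fun _ => y0
  | S n => fun t => y0 + RInt (fun s => F s (picard_iter n s)) 0 t
  end.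

Lemma field_continuous (x : R -> R) t : continuous x t -> continuous (fun s => F s (x s)) t.
Proof.
  intros Hx. apply continuity_pt_filterlim. apply continuity_pt_filterlim in Hx.
  intros eps Heps.
  assert (Hp : 0 < eps / (2 * L)) by (apply Rdiv_lt_0_compat; lra).
  destruct (Hx _ Hp) as [d [Hd H]].
  exists (Rmin d (eps / (2 * L))). split; [now apply Rmin_glb_lt|].
  intros s [Hs Hs']. simpl in *. unfold Rdist in *.
  assert (H1 : Rabs (s - t) < eps / (2 * L)) by (eapply Rlt_le_trans; [apply Hs'|apply Rmin_r]).
  assert (H2 : Rabs (x s - x t) < eps / (2 * L)).
  { apply H. split; [easy|]. eapply Rlt_le_trans; [apply Hs'|apply Rmin_l]. }
  eapply Rle_lt_trans; [apply HF|].
  replace eps with (L * (eps / (2 * L) + eps / (2 * L))) by (field; lra).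
  apply Rmult_lt_compat_l; lra.
Qed.

Lemma picard_iter_continuous n t : continuous (picard_iter n) t.
Proof.
  revert t. induction n as [|n IH]; intros t; [apply continuous_const|].
  apply (is_derive_continuous _ _ (F t (picard_iter n t))). simpl.
  replace (F t (picard_iter n t)) with (0 + F t (picard_iter n t)) by ring.
  apply (is_derive_plus (fun _ => y0)); [exact (is_derive_const y0 t)|].
  apply (is_derive_RInt (fun s => F s (picard_iter n s)) _ 0).
  - exists (mkposreal 1 Rlt_0_1). intros y _. apply (RInt_correct (V := R_CompleteNormedModule)).
    apply ex_RInt_continuous. intros z _. now apply field_continuous.
  - now apply field_continuous.
Qed.

Lemma picard_iter_derive n t : is_derive (picard_iter (S n)) t (F t (picard_iter n t)).
Proof.
  simpl. replace (F t (picard_iter n t)) with (0 + F t (picard_iter n t)) by ring.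
  apply (is_derive_plus (fun _ => y0)); [exact (is_derive_const y0 t)|].
  apply (is_derive_RInt (fun s => F s (picard_iter n s)) _ 0).
  - exists (mkposreal 1 Rlt_0_1). intros y _. apply (RInt_correct (V := R_CompleteNormedModule)).
    apply ex_RInt_continuous. intros z _. apply field_continuous, picard_iter_continuous.
  - apply field_continuous, picard_iter_continuous.
Qed.

Lemma picard_iter_0 n : picard_iter n 0 = y0.
Proof. destruct n; simpl; [easy|]. rewrite RInt_point. apply Rplus_0_r. Qed.

(** With the weight exp(2 L t) each iteration contracts by the factor 1/2 on the whole half-line, so
    existence is global without any continuation argument. *)
Lemma picard_step n t : 0 <= t ->
  Rabs (picard_iter (S n) t - picard_iter n t) <= M / L * (1 / 2) ^ n * exp (2 * L * t).
Proof.
  assert (HM0 : 0 <= M) by (pose proof (HM 0 0); pose proof (Rabs_pos (F 0 0)); lra).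
  assert (HML : 0 <= M / L) by (apply Rdiv_le_0_compat; lra).
  revert t. induction n as [|n IH]; intros t Ht.
  - apply (deriv_abs_le (fun t => picard_iter 1 t - picard_iter 0 t) (fun t => F t (picard_iter 0 t))
     (fun t => M / L * (1 / 2) ^ 0 * exp (2 * L * t)) (fun t => 2 * M * exp (2 * L * t)) 0 t Ht).
    + intros s _. replace (F s (picard_iter 0 s)) with (F s (picard_iter 0 s) - 0) by ring.
      apply (is_derive_minus (picard_iter 1) (picard_iter 0)); [apply picard_iter_derive|].
      exact (is_derive_const y0 s).
    + intros s _. auto_derive; auto. simpl. field. lra.
    + intros s Hs. eapply Rle_trans; [apply HM|].
      assert (1 <= exp (2 * L * s)); [|nra].
      rewrite <- exp_0. left. apply exp_increasing. nra.
    + intros s _. apply (continuous_minus (picard_iter 1) (picard_iter 0)); apply picard_iter_continuous.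
    + intros s _. eapply is_derive_continuous. auto_derive; auto.
    + rewrite !picard_iter_0, Rminus_diag, Rabs_R0. simpl. rewrite Rmult_0_r, exp_0. lra.
  - set (C := M / L * (1 / 2) ^ n) in *.
    assert (HC : 0 <= C) by (apply Rmult_le_pos; [easy|apply pow_le; lra]).
    replace (M / L * (1 / 2) ^ S n) with (C / 2) by (unfold C; simpl; field; lra).
    apply (deriv_abs_le (fun t => picard_iter (S (S n)) t - picard_iter (S n) t)
      (fun t => F t (picard_iter (S n) t) - F t (picard_iter n t))
     (fun t => C / 2 * exp (2 * L * t)) (fun t => L * C * exp (2 * L * t)) 0 t Ht).
    + intros s _. apply (is_derive_minus (picard_iter (S (S n))) (picard_iter (S n)));
        apply picard_iter_derive.
    + intros s _. auto_derive; auto. field.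
    + intros s Hs. eapply Rle_trans; [apply HF|].
      rewrite Rminus_diag, Rabs_R0, Rplus_0_l, Rmult_assoc.
      apply Rmult_le_compat_l; [lra|]. apply IH; lra.
    + intros s _. apply (continuous_minus (picard_iter (S (S n))) (picard_iter (S n)));
        apply picard_iter_continuous.
    + intros s _. eapply is_derive_continuous. auto_derive; auto.
    + rewrite !picard_iter_0, Rminus_diag, Rabs_R0, Rmult_0_r, exp_0. lra.
Qed.

Lemma picard_cauchy t n m : 0 <= t -> (n <= m)%nat ->
  Rabs (picard_iter n t - picard_iter m t) <= 2 * (M / L) * exp (2 * L * t) * (1 / 2) ^ n.
Proof.
  intros Ht Hnm. set (C := M / L * exp (2 * L * t)).
  assert (HC : 0 <= C).
  { pose proof (HM 0 0). pose proof (Rabs_pos (F 0 0)).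
    apply Rmult_le_pos; [apply Rdiv_le_0_compat; lra|left; apply exp_pos]. }
  assert (H : Rabs (picard_iter n t - picard_iter m t) <= 2 * C * ((1 / 2) ^ n - (1 / 2) ^ m)).
  { induction Hnm as [|m Hnm IH].
    - rewrite !Rminus_diag, Rabs_R0. lra.
    - pose proof (picard_step m t Ht) as Hs.
      rewrite Rabs_minus_sym in Hs.
      pose proof (Rabs_triang (picard_iter n t - picard_iter m t) (picard_iter m t - picard_iter (S m) t)) as HT.
      replace (picard_iter n t - picard_iter m t + (picard_iter m t - picard_iter (S m) t))
        with (picard_iter n t - picard_iter (S m) t) in HT by ring.
      replace (M / L * (1 / 2) ^ m * exp (2 * L * t)) with (C * (1 / 2) ^ m) in Hs by (unfold C; ring).
      change ((1 / 2) ^ S m) with (1 / 2 * (1 / 2) ^ m). lra. }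
  assert (0 <= (1 / 2) ^ m) by (apply pow_le; lra).
  replace (2 * (M / L) * exp (2 * L * t) * (1 / 2) ^ n) with (2 * C * (1 / 2) ^ n) by (unfold C; ring).
  nra.
Qed.

(** The Lipschitz bound includes the endpoint 0, where no derivative is claimed; it is what ties the
    initial value to the solution for t > 0. *)
Theorem picard : exists y : R -> R, y 0 = y0 /\
  (forall t, 0 < t -> is_derive y t (F t (y t))) /\
  (forall s t, 0 <= s -> 0 <= t -> Rabs (y t - y s) <= M * Rabs (t - s)).
Proof.
  assert (HM0 : 0 <= M) by (pose proof (HM 0 0); pose proof (Rabs_pos (F 0 0)); lra).
  assert (Hlip : forall n s t, Rabs (picard_iter n t - picard_iter n s) <= M * Rabs (t - s)).
  { intros [|n] s t.
    - simpl. rewrite Rminus_diag, Rabs_R0. apply Rmult_le_pos; [easy|apply Rabs_pos].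
    - destruct (MVT_gen (picard_iter (S n)) s t (fun t => F t (picard_iter n t))) as [c [_ E]].
      + intros; apply picard_iter_derive.
      + intros; apply continuity_pt_filterlim, picard_iter_continuous.
      + rewrite E, Rabs_mult. apply Rmult_le_compat_r; [apply Rabs_pos|apply HM]. }
  set (y := fun t => real (Lim_seq (fun n => picard_iter n t))).
  assert (Hgeo : forall C, is_lim_seq (fun n => C * (1 / 2) ^ n) 0).
  { intros C. replace (Finite 0) with (Rbar_mult C 0) by (simpl; f_equal; ring).
    apply is_lim_seq_scal_l. apply is_lim_seq_geom. rewrite Rabs_pos_eq; lra. }
  assert (Hy : forall t, 0 <= t -> is_lim_seq (fun n => picard_iter n t) (y t)).
  { intros t Ht.
    apply (cauchy_bound_lim (fun n => picard_iter n t)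
      (fun n => 2 * (M / L) * exp (2 * L * t) * (1 / 2) ^ n)); [|apply Hgeo].
    intros; now apply picard_cauchy. }
  exists y. split; [|split].
  - unfold y. rewrite (Lim_seq_ext _ (fun _ => y0)) by (intros; apply picard_iter_0).
    now rewrite Lim_seq_const.
  - intros s Hs.
    apply (ode_limit F picard_iter (fun n => picard_iter (S n)) y 0 s (L * (1 + M)) Hs).
    + intros t Ht. exists O. intros n _.
      apply (quadratic_remainder F (picard_iter n) (picard_iter (S n)) 0); try lra; auto.
      intros; apply picard_iter_derive.
    + intros t Ht. apply (is_lim_seq_incr_1 (fun n => picard_iter n t)). apply Hy; lra.
    + apply (is_lim_seq_continuous (F s)); [|apply Hy; lra].
      intros eps Heps. exists (eps / L). split; [now apply Rdiv_lt_0_compat|].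
      intros x [_ Hx]. simpl in *. unfold Rdist in *.
      eapply Rle_lt_trans; [apply HF|]. rewrite Rminus_diag, Rabs_R0, Rplus_0_l.
      replace eps with (L * (eps / L)) by (field; lra). apply Rmult_lt_compat_l; lra.
  - intros s t Hs Ht.
    apply (is_lim_seq_le (fun n => Rabs (picard_iter n t - picard_iter n s))
       (fun _ => M * Rabs (t - s)) (Rabs (y t - y s)) (M * Rabs (t - s))); auto.
    + apply (is_lim_seq_abs _ (Finite _)). apply is_lim_seq_minus'; now apply Hy.
    + apply is_lim_seq_const.
Qed.
End Picard.

(** * The angle equation *)

(** Let s be the supremum of the times where f <= 0. If f b > 0, continuity forces f s = 0 with s <
    b, and the hypothesis at s then contradicts the supremum. Invariant regions and the continuation
    of uniqueness both go through this lemma. *)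
Lemma barrier (f : R -> R) a b : a <= b -> f a <= 0 ->
  (forall t, a <= t <= b -> continuous f t) ->
  (forall s, a <= s < b -> f s = 0 -> exists d, 0 < d /\ forall t, s < t < s + d -> f t <= 0) ->
  f b <= 0.
Proof.
  intros Hab Ha Hc H. destruct (Rle_dec (f b) 0) as [|Hb]; [easy|exfalso].
  set (E := fun t => a <= t <= b /\ f t <= 0).
  destruct (completeness E) as [s [Hub Hlub]].
  { exists b. intros t [Ht _]. lra. }
  { exists a. split; lra. }
  assert (Has : a <= s) by (apply Hub; split; lra).
  assert (Hsb : s <= b) by (apply Hlub; intros t [Ht _]; lra).
  assert (Habove : forall t, s < t <= b -> 0 < f t).
  { intros t Ht. destruct (Rle_dec (f t) 0); [|lra].
    assert (t <= s) by (apply Hub; split; lra). lra. }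
  assert (Hcs := Hc s (conj Has Hsb)). apply continuity_pt_filterlim in Hcs.
  assert (Hs0 : f s <= 0).
  { destruct (Rle_dec (f s) 0) as [|Hn]; [easy|exfalso].
    destruct (Hcs (f s) ltac:(lra)) as [d [Hd Hcl]].
    assert (s <= s - d); [|lra].
    apply Hlub. intros t [Ht Hft]. destruct (Rle_dec t (s - d)); [easy|exfalso].
    assert (t <= s) by (apply Hub; split; easy).
    destruct (Req_dec t s) as [->|]; [lra|].
    assert (Hx : Rabs (f t - f s) < f s).
    { apply Hcl. split; [split; [easy|auto]|]. simpl. unfold Rdist. apply Rabs_lt_between. lra. }
    apply Rabs_lt_between in Hx. lra. }
  assert (Hsb' : s < b) by (destruct Hsb as [Hsb|Hsb]; [easy|subst s; lra]).
  assert (Hs : f s = 0).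
  { apply Rle_antisym; [easy|]. destruct (Rle_dec 0 (f s)) as [|Hn]; [easy|exfalso].
    destruct (Hcs (- f s) ltac:(lra)) as [d [Hd Hcl]].
    set (t := s + Rmin (d / 2) (b - s)).
    assert (0 < Rmin (d / 2) (b - s)) by (apply Rmin_glb_lt; lra).
    pose proof (Rmin_l (d / 2) (b - s)). pose proof (Rmin_r (d / 2) (b - s)).
    assert (Hx : Rabs (f t - f s) < - f s).
    { apply Hcl. split; [split; [easy|unfold t; lra]|]. simpl. unfold Rdist, t. apply Rabs_lt_between. lra. }
    assert (0 < f t) by (apply Habove; unfold t; lra).
    apply Rabs_lt_between in Hx. lra. }
  destruct (H s (conj Has Hsb') Hs) as [d [Hd Hle]].
  set (t := s + Rmin (d / 2) (b - s)).
  assert (0 < Rmin (d / 2) (b - s)) by (apply Rmin_glb_lt; lra).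
  pose proof (Rmin_l (d / 2) (b - s)). pose proof (Rmin_r (d / 2) (b - s)).
  assert (0 < f t) by (apply Habove; unfold t; lra).
  assert (f t <= 0) by (apply Hle; unfold t; lra). lra.
Qed.

Lemma sin_lip x y : Rabs (sin x - sin y) <= Rabs (x - y).
Proof.
  destruct (MVT_gen sin y x cos) as [c [_ E]].
  - intros. apply is_derive_Reals, derivable_pt_lim_sin.
  - intros. apply continuity_sin.
  - rewrite E, Rabs_mult. rewrite <- (Rmult_1_l (Rabs (x - y))) at 2.
    apply Rmult_le_compat_r; [apply Rabs_pos|]. apply Rabs_le, COS_bound.
Qed.

Lemma cos_lip x y : Rabs (cos x - cos y) <= Rabs (x - y).
Proof.
  rewrite !cos_sin. eapply Rle_trans; [apply sin_lip|]. right; f_equal; ring.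
Qed.

Lemma sin_abs_le1 x : 0 <= Rabs (sin x) <= 1.
Proof. split; [apply Rabs_pos|]. apply Rabs_le, SIN_bound. Qed.

Lemma cos_abs_le1 x : 0 <= Rabs (cos x) <= 1.
Proof. split; [apply Rabs_pos|]. apply Rabs_le, COS_bound. Qed.

Definition conj_exp (p : R) : R := p / (p - 1).

(* With Y = phi p u', weighted polar coordinates u = rho^(1/p) cos b, Y = - rho^(1/p') sin b
   turn -(r phi p u')' = r phi p u into b' = angle_field p r b. *)
Definition angle_den p b := (p - 1) * sin b ^ 2 + cos b ^ 2.
Definition angle_num p b := (p - 1) * powp (Rabs (sin b)) (conj_exp p) + powp (Rabs (cos b)) p.
Definition angle_drag p b := sin b * cos b / angle_den p b.
Definition angle_field p r b := angle_num p b / angle_den p b - angle_drag p b / r.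

Lemma conj_exp_bounds p : 2 <= p -> 1 < conj_exp p <= 2.
Proof.
  intros. unfold conj_exp. split.
  - apply Rmult_lt_reg_r with (p - 1); [lra|]. unfold Rdiv. rewrite Rmult_assoc, Rinv_l; lra.
  - apply Rmult_le_reg_r with (p - 1); [lra|]. unfold Rdiv. rewrite Rmult_assoc, Rinv_l; lra.
Qed.

Lemma conj_exp_mult p : 2 <= p -> (p - 1) * conj_exp p = p.
Proof. intros. unfold conj_exp. field. lra. Qed.

Lemma angle_den_ge1 p b : 2 <= p -> 1 <= angle_den p b <= p.
Proof.
  intros. unfold angle_den. pose proof (sin2_cos2 b). unfold Rsqr in *.
  pose proof (pow2_ge_0 (sin b)). pose proof (pow2_ge_0 (cos b)). split; nra.
Qed.

Lemma angle_num_bounds p b : 2 <= p -> 0 <= angle_num p b <= p.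
Proof.
  intros. unfold angle_num. pose proof (conj_exp_bounds p H).
  pose proof (powp_ge0 (Rabs (sin b)) (conj_exp p)).
  pose proof (powp_ge0 (Rabs (cos b)) p).
  pose proof (powp_le_1 _ (conj_exp p) (sin_abs_le1 b) ltac:(lra)).
  pose proof (powp_le_1 _ p (cos_abs_le1 b) ltac:(lra)). split; nra.
Qed.

Lemma quotient_diff a b a' b' A : 1 <= b -> 1 <= b' -> Rabs a' <= A ->
  Rabs (a / b - a' / b') <= Rabs (a - a') + A * Rabs (b - b').
Proof.
  intros Hb Hb' Ha.
  replace (a / b - a' / b') with ((a - a') * / b + a' * (b' - b) * (/ b * / b')) by (field; lra).
  assert (Hi : 0 <= / b <= 1).
  { split; [left; apply Rinv_0_lt_compat; lra|]. rewrite <- Rinv_1. apply Rinv_le_contravar; lra. }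
  assert (Hi' : 0 <= / b' <= 1).
  { split; [left; apply Rinv_0_lt_compat; lra|]. rewrite <- Rinv_1. apply Rinv_le_contravar; lra. }
  assert (0 <= / b * / b' <= 1) by (split; nra).
  eapply Rle_trans; [apply Rabs_triang|]. rewrite !Rabs_mult, (Rabs_minus_sym b' b).
  rewrite <- !Rabs_mult.
  rewrite !Rabs_mult, (Rabs_pos_eq (/ b)), (Rabs_pos_eq (/ b')) by lra.
  pose proof (Rabs_pos (a - a')). pose proof (Rabs_pos (b - b')). pose proof (Rabs_pos a').
  assert (Rabs a' * Rabs (b - b') <= A * Rabs (b - b')) by nra.
  assert (0 <= Rabs a' * Rabs (b - b')) by nra.
  apply Rplus_le_compat; nra.
Qed.

Lemma angle_den_lip p x y : 2 <= p ->
  Rabs (angle_den p x - angle_den p y) <= 2 * p * Rabs (x - y).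
Proof.
  intros. unfold angle_den.
  replace ((p - 1) * sin x ^ 2 + cos x ^ 2 - ((p - 1) * sin y ^ 2 + cos y ^ 2))
    with ((p - 2) * ((sin x - sin y) * (sin x + sin y))).
  2:{ pose proof (sin2_cos2 x). pose proof (sin2_cos2 y). unfold Rsqr in *. nra. }
  rewrite !Rabs_mult, (Rabs_pos_eq (p - 2)) by lra.
  pose proof (sin_lip x y). pose proof (Rabs_pos (sin x - sin y)).
  pose proof (Rabs_triang (sin x) (sin y)). pose proof (sin_abs_le1 x). pose proof (sin_abs_le1 y).
  pose proof (Rabs_pos (sin x + sin y)).
  assert (Rabs (sin x - sin y) * Rabs (sin x + sin y) <= Rabs (x - y) * 2)
    by (apply Rmult_le_compat; lra).
  assert (0 <= Rabs (sin x - sin y) * Rabs (sin x + sin y)) by nra.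
  nra.
Qed.

Lemma angle_num_lip p x y : 2 <= p ->
  Rabs (angle_num p x - angle_num p y) <= 2 * p * Rabs (x - y).
Proof.
  intros. unfold angle_num.
  replace ((p - 1) * powp (Rabs (sin x)) (conj_exp p) + powp (Rabs (cos x)) p -
   ((p - 1) * powp (Rabs (sin y)) (conj_exp p) + powp (Rabs (cos y)) p))
   with ((p - 1) * (powp (Rabs (sin x)) (conj_exp p) - powp (Rabs (sin y)) (conj_exp p))
     + (powp (Rabs (cos x)) p - powp (Rabs (cos y)) p)) by ring.
  eapply Rle_trans; [apply Rabs_triang|].
  rewrite Rabs_mult, (Rabs_pos_eq (p - 1)) by lra.
  pose proof (conj_exp_bounds p H).
  pose proof (powp_lip (conj_exp p) _ _ ltac:(lra) (sin_abs_le1 x) (sin_abs_le1 y)) as H1.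
  pose proof (powp_lip p _ _ ltac:(lra) (cos_abs_le1 x) (cos_abs_le1 y)) as H2.
  pose proof (Rabs_triang_inv2 (sin x) (sin y)). pose proof (Rabs_triang_inv2 (cos x) (cos y)).
  pose proof (sin_lip x y). pose proof (cos_lip x y).
  pose proof (conj_exp_mult p H).
  assert (conj_exp p * Rabs (Rabs (sin x) - Rabs (sin y)) <= conj_exp p * Rabs (x - y))
    by (apply Rmult_le_compat_l; lra).
  assert (p * Rabs (Rabs (cos x) - Rabs (cos y)) <= p * Rabs (x - y))
    by (apply Rmult_le_compat_l; lra).
  assert ((p - 1) * Rabs (powp (Rabs (sin x)) (conj_exp p) - powp (Rabs (sin y)) (conj_exp p))
     <= (p - 1) * (conj_exp p * Rabs (x - y))) by (apply Rmult_le_compat_l; lra).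
  rewrite <- Rmult_assoc, H7 in H10. lra.
Qed.

Lemma angle_ratio_lip p x y : 2 <= p ->
  Rabs (angle_num p x / angle_den p x - angle_num p y / angle_den p y)
    <= (2 * p + 2 * p * p) * Rabs (x - y).
Proof.
  intros. pose proof (angle_num_bounds p y H). pose proof (angle_den_ge1 p x H).
  pose proof (angle_den_ge1 p y H).
  eapply Rle_trans; [apply (quotient_diff _ _ _ _ p); try lra; rewrite Rabs_pos_eq; lra|].
  pose proof (angle_num_lip p x y H). pose proof (angle_den_lip p x y H). nra.
Qed.

Lemma sin_cos_abs_le1 x : Rabs (sin x * cos x) <= 1.
Proof.
  rewrite Rabs_mult. pose proof (sin_abs_le1 x). pose proof (cos_abs_le1 x). nra.
Qed.

Lemma angle_drag_lip p x y : 2 <= p ->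
  Rabs (angle_drag p x - angle_drag p y) <= (2 * p + 2 * p * p) * Rabs (x - y).
Proof.
  intros. unfold angle_drag. pose proof (angle_den_ge1 p x H). pose proof (angle_den_ge1 p y H).
  eapply Rle_trans; [apply (quotient_diff _ _ _ _ 1); try lra; apply sin_cos_abs_le1|].
  pose proof (angle_den_lip p x y H).
  replace (sin x * cos x - sin y * cos y)
    with ((sin x - sin y) * cos x + sin y * (cos x - cos y)) by ring.
  pose proof (Rabs_triang ((sin x - sin y) * cos x) (sin y * (cos x - cos y))) as HT.
  rewrite !Rabs_mult in HT.
  pose proof (sin_lip x y). pose proof (cos_lip x y).
  pose proof (sin_abs_le1 y). pose proof (cos_abs_le1 x).
  pose proof (Rabs_pos (sin x - sin y)). pose proof (Rabs_pos (cos x - cos y)).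
  assert (Rabs (sin x - sin y) * Rabs (cos x) <= Rabs (x - y)) by nra.
  assert (Rabs (sin y) * Rabs (cos x - cos y) <= Rabs (x - y)) by nra.
  pose proof (Rabs_pos (x - y)).
  assert (2 * Rabs (x - y) <= 2 * p * p * Rabs (x - y)) by (apply Rmult_le_compat_r; nra). lra.
Qed.

Lemma angle_drag_le1 p x : 2 <= p -> Rabs (angle_drag p x) <= 1.
Proof.
  intros. pose proof (angle_den_ge1 p x H). unfold angle_drag, Rdiv. rewrite Rabs_mult.
  rewrite (Rabs_pos_eq (/ _)) by (left; apply Rinv_0_lt_compat; lra).
  assert (0 < / angle_den p x <= 1).
  { split; [apply Rinv_0_lt_compat; lra|]. rewrite <- Rinv_1. apply Rinv_le_contravar; lra. }
  pose proof (sin_cos_abs_le1 x). pose proof (Rabs_pos (sin x * cos x)). nra.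
Qed.

Lemma angle_drag_ge0 p x : 2 <= p -> 0 <= x <= PI / 2 -> 0 <= angle_drag p x.
Proof.
  intros. pose proof (angle_den_ge1 p x H). pose proof PI_RGT_0. apply Rdiv_le_0_compat; [|lra].
  apply Rmult_le_pos; [apply sin_ge_0|apply cos_ge_0]; lra.
Qed.

Lemma cos_ge_half x : 0 <= x <= 1 / 4 -> 1 / 2 <= cos x.
Proof.
  intros. pose proof PI2_1. pose proof (cos_ge_0 x ltac:(lra) ltac:(lra)).
  pose proof (sin2_cos2 x). unfold Rsqr in *.
  pose proof (sin_lip x 0). rewrite sin_0, !Rminus_0_r, (Rabs_pos_eq x) in H3 by lra.
  apply Rabs_le_between in H3. nra.
Qed.

(** The difference is sin (x - y) (cos x cos y - (p - 1) sin x sin y) over the two denominators, and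
    the bracket is positive near 0. This monotonicity gives the singular term - [angle_drag] / r the
    favourable sign in one-sided estimates. *)
Lemma angle_drag_mono p x y : 2 <= p -> 0 <= y <= x -> x <= / (2 * p) ->
  angle_drag p y <= angle_drag p x.
Proof.
  intros Hp Hy Hx.
  assert (Hi : 0 < / (2 * p) <= 1 / 4).
  { split; [apply Rinv_0_lt_compat; lra|]. replace (1 / 4) with (/ 4) by field. apply Rinv_le_contravar; lra. }
  pose proof (angle_den_ge1 p x Hp). pose proof (angle_den_ge1 p y Hp).
  assert (E : angle_drag p x - angle_drag p y =
    sin (x - y) * (cos x * cos y - (p - 1) * sin x * sin y) / (angle_den p x * angle_den p y)).
  { unfold angle_drag. rewrite sin_minus.
    apply Rmult_eq_reg_r with (angle_den p x * angle_den p y); [|nra].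
    unfold Rdiv. rewrite (Rmult_assoc _ (/ _) (_ * _)), Rinv_l by nra.
    replace ((sin x * cos x * / angle_den p x - sin y * cos y * / angle_den p y) * (angle_den p x * angle_den p y))
      with (sin x * cos x * angle_den p y - sin y * cos y * angle_den p x) by (field; lra).
    unfold angle_den. ring. }
  assert (Hs : 0 <= sin (x - y)).
  { pose proof PI2_1. apply sin_ge_0; lra. }
  assert (Hsb : forall z, 0 <= z <= / (2 * p) -> 0 <= sin z <= / (2 * p)).
  { intros z Hz. pose proof PI2_1. split; [apply sin_ge_0; lra|].
    pose proof (sin_lip z 0) as H3. rewrite sin_0, !Rminus_0_r, (Rabs_pos_eq z) in H3 by lra.
    apply Rabs_le_between in H3. lra. }
  pose proof (Hsb x ltac:(lra)). pose proof (Hsb y ltac:(lra)).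
  pose proof (cos_ge_half x ltac:(lra)). pose proof (cos_ge_half y ltac:(lra)).
  assert ((p - 1) * sin x * sin y <= 1 / 8).
  { assert (p * / (2 * p) = 1 / 2) by (field; lra).
    assert ((p - 1) * sin x <= p * / (2 * p)) by (apply Rmult_le_compat; lra).
    assert (0 <= (p - 1) * sin x) by (apply Rmult_le_pos; lra). nra. }
  assert (0 <= angle_drag p x - angle_drag p y); [|lra].
  rewrite E. apply Rdiv_le_0_compat; [|nra]. apply Rmult_le_pos; nra.
Qed.

Lemma angle_field_osl P p r x y : 2 <= p <= P -> 0 < r ->
  (r <= / (2 * P * P) -> 0 <= x <= P * r /\ 0 <= y <= P * r) ->
  (x - y) * (angle_field p r x - angle_field p r y)
    <= (2 * P + 2 * P * P) * (1 + 2 * P * P) * (x - y) ^ 2.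
Proof.
  intros Hp Hr H. unfold angle_field.
  set (h := fun z => angle_num p z / angle_den p z). fold (h x); fold (h y).
  replace ((x - y) * (h x - angle_drag p x / r - (h y - angle_drag p y / r)))
    with ((x - y) * (h x - h y) - (x - y) * (angle_drag p x - angle_drag p y) / r) by (field; lra).
  pose proof (angle_ratio_lip p x y ltac:(lra)) as Hh. fold (h x) (h y) in Hh.
  pose proof (angle_drag_lip p x y ltac:(lra)) as HD.
  set (K := 2 * p + 2 * p * p) in *. set (K' := 2 * P + 2 * P * P).
  assert (HK : 0 <= K <= K') by (unfold K, K'; split; nra).
  assert (A1 : (x - y) * (h x - h y) <= K' * (x - y) ^ 2).
  { eapply Rle_trans; [apply Rle_abs|]. rewrite Rabs_mult, <- (pow2_abs (x - y)).
    pose proof (Rabs_pos (x - y)). nra. }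
  assert (A2 : - ((x - y) * (angle_drag p x - angle_drag p y) / r) <= K' * (2 * P * P) * (x - y) ^ 2).
  { destruct (Rle_dec r (/ (2 * P * P))) as [Hs|Hs].
    - destruct (H Hs) as [Hx Hy].
      assert (HPr : P * r <= / (2 * p)).
      { apply Rle_trans with (P * / (2 * P * P)); [apply Rmult_le_compat_l; lra|].
        replace (P * / (2 * P * P)) with (/ (2 * P)) by (field; lra).
        apply Rinv_le_contravar; lra. }
      assert (0 <= (x - y) * (angle_drag p x - angle_drag p y)).
      { destruct (Rle_dec y x).
        - pose proof (angle_drag_mono p x y ltac:(lra) ltac:(lra) ltac:(lra)). nra.
        - pose proof (angle_drag_mono p y x ltac:(lra) ltac:(lra) ltac:(lra)). nra. }
      assert (0 <= (x - y) * (angle_drag p x - angle_drag p y) / r) by (apply Rdiv_le_0_compat; lra).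
      assert (0 <= K' * (2 * P * P) * (x - y) ^ 2).
      { apply Rmult_le_pos; [nra|apply pow2_ge_0]. }
      lra.
    - assert (Hi : 0 < / r <= 2 * P * P).
      { split; [now apply Rinv_0_lt_compat|]. rewrite <- (Rinv_inv (2 * P * P)).
        apply Rinv_le_contravar; [apply Rinv_0_lt_compat; nra|lra]. }
      eapply Rle_trans; [apply Rle_abs|]. rewrite Rabs_Ropp. unfold Rdiv.
      rewrite !Rabs_mult, (Rabs_pos_eq (/ r)), <- (pow2_abs (x - y)) by lra.
      pose proof (Rabs_pos (x - y)). pose proof (Rabs_pos (angle_drag p x - angle_drag p y)).
      assert (Rabs (angle_drag p x - angle_drag p y) <= K' * Rabs (x - y)) by nra.
      assert (Rabs (x - y) * Rabs (angle_drag p x - angle_drag p y) <= K' * Rabs (x - y) ^ 2) by nra.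
      replace (K' * (2 * P * P) * Rabs (x - y) ^ 2) with (K' * Rabs (x - y) ^ 2 * (2 * P * P)) by ring.
      apply Rmult_le_compat; try lra. nra. }
  fold K'. unfold Rminus at 1. lra.
Qed.

(** Freezing 1/r below radius e makes the field globally Lipschitz and bounded, as Picard iteration
    requires; for r >= e nothing is changed. *)
Definition reg_field p e r b :=
  angle_num p b / angle_den p b - angle_drag p b / Rmax r e.

Lemma Rmax_lip x y e : Rabs (Rmax x e - Rmax y e) <= Rabs (x - y).
Proof.
  unfold Rmax. destruct (Rle_dec x e), (Rle_dec y e); unfold Rabs;
  repeat destruct Rcase_abs; lra.
Qed.

Lemma reg_field_lip p e t s u v : 2 <= p -> 0 < e ->
  Rabs (reg_field p e t u - reg_field p e s v)
   <= (2 * p + 2 * p * p) * (1 + / e) * (1 + / e) * (Rabs (t - s) + Rabs (u - v)).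
Proof.
  intros Hp He. unfold reg_field.
  set (m := Rmax t e). set (k := Rmax s e).
  assert (Hm : e <= m) by apply Rmax_r. assert (Hk : e <= k) by apply Rmax_r.
  replace (angle_num p u / angle_den p u - angle_drag p u / m -
    (angle_num p v / angle_den p v - angle_drag p v / k))
    with (angle_num p u / angle_den p u - angle_num p v / angle_den p v
      + - ((angle_drag p u - angle_drag p v) * / m) + angle_drag p v * ((m - k) * (/ m * / k))).
  2:{ set (a := angle_num p u / angle_den p u). set (b := angle_num p v / angle_den p v). field. lra. }
  pose proof (angle_ratio_lip p u v Hp) as H1. pose proof (angle_drag_lip p u v Hp) as H2.
  pose proof (angle_drag_le1 p v Hp) as H3. pose proof (Rmax_lip t s e) as H4. fold m k in H4.
  set (K := 2 * p + 2 * p * p) in *. assert (1 <= K) by (unfold K; nra).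
  assert (Hie : 0 < / e) by now apply Rinv_0_lt_compat.
  assert (Him : 0 <= / m <= / e).
  { split; [left; apply Rinv_0_lt_compat; lra|apply Rinv_le_contravar; lra]. }
  assert (Hik : 0 <= / k <= / e).
  { split; [left; apply Rinv_0_lt_compat; lra|apply Rinv_le_contravar; lra]. }
  eapply Rle_trans; [apply Rabs_triang|]. eapply Rle_trans; [apply Rplus_le_compat_r, Rabs_triang|].
  rewrite Rabs_Ropp, !Rabs_mult, (Rabs_pos_eq (/ m)), (Rabs_pos_eq (/ k)) by lra.
  pose proof (Rabs_pos (angle_drag p u - angle_drag p v)).
  pose proof (Rabs_pos (angle_drag p v)). pose proof (Rabs_pos (m - k)).
  pose proof (Rabs_pos (t - s)). pose proof (Rabs_pos (u - v)).
  assert (A2 : Rabs (angle_drag p u - angle_drag p v) * / m <= K * Rabs (u - v) * / e)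
    by (apply Rmult_le_compat; lra).
  assert (A3 : Rabs (angle_drag p v) * (Rabs (m - k) * (/ m * / k)) <= 1 * (Rabs (t - s) * (/ e * / e))).
  { assert (0 <= / m * / k <= / e * / e) by (split; [nra|apply Rmult_le_compat; lra]).
    apply Rmult_le_compat; [lra|apply Rmult_le_pos; lra|lra|].
    apply Rmult_le_compat; lra. }
  set (i := / e) in *. set (ts := Rabs (t - s)) in *. set (uv := Rabs (u - v)) in *.
  assert (1 + i <= (1 + i) * (1 + i)) by nra.
  assert (i * i <= K * ((1 + i) * (1 + i))) by nra.
  assert (K * uv + K * uv * i <= K * ((1 + i) * (1 + i)) * uv) by nra.
  assert (1 * (ts * (i * i)) <= K * ((1 + i) * (1 + i)) * ts) by nra.
  lra.
Qed.

Lemma reg_field_bound p e t u : 2 <= p -> 0 < e -> Rabs (reg_field p e t u) <= p + / e.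
Proof.
  intros Hp He. unfold reg_field.
  pose proof (angle_num_bounds p u Hp). pose proof (angle_den_ge1 p u Hp).
  pose proof (angle_drag_le1 p u Hp).
  assert (Hm : e <= Rmax t e) by apply Rmax_r.
  assert (Him : 0 <= / Rmax t e <= / e).
  { split; [left; apply Rinv_0_lt_compat; lra|apply Rinv_le_contravar; lra]. }
  unfold Rminus. eapply Rle_trans; [apply Rabs_triang|]. rewrite Rabs_Ropp. unfold Rdiv.
  rewrite !Rabs_mult, (Rabs_pos_eq (/ Rmax t e)), (Rabs_pos_eq (angle_num p u)) by lra.
  assert (0 <= / angle_den p u <= 1).
  { split; [left; apply Rinv_0_lt_compat; lra|]. rewrite <- Rinv_1. apply Rinv_le_contravar; lra. }
  rewrite (Rabs_pos_eq (/ angle_den p u)) by lra.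
  pose proof (Rabs_pos (angle_drag p u)). apply Rplus_le_compat; nra.
Qed.

Lemma reg_field_eq p e r b : e <= r -> reg_field p e r b = angle_field p r b.
Proof. intros. unfold reg_field, angle_field. now rewrite Rmax_left. Qed.

Lemma angle_field_lip p a t s u v : 2 <= p -> 0 < a -> a <= t -> a <= s ->
  Rabs (angle_field p t u - angle_field p s v)
   <= (2 * p + 2 * p * p) * (1 + / a) * (1 + / a) * (Rabs (t - s) + Rabs (u - v)).
Proof. intros. rewrite <- !(reg_field_eq p a) by easy. now apply reg_field_lip. Qed.

Lemma angle_at_zero p : angle_num p 0 = 1 /\ angle_den p 0 = 1 /\ angle_drag p 0 = 0.
Proof.
  unfold angle_num, angle_den, angle_drag.
  rewrite sin_0, cos_0, Rabs_R0, Rabs_R1, powp_0, powp_1l. repeat split; try ring.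
  unfold Rdiv. ring.
Qed.

Lemma reg_field_at0 p e t : reg_field p e t 0 = 1.
Proof.
  unfold reg_field. destruct (angle_at_zero p) as [-> [-> ->]].
  unfold Rdiv. rewrite Rmult_0_l, Rinv_1. ring.
Qed.

Lemma is_derive_pos_locally (f : R -> R) s l : is_derive f s l -> 0 < l ->
  exists d, 0 < d /\ (forall t, s < t < s + d -> f s < f t) /\ (forall t, s - d < t < s -> f t < f s).
Proof.
  intros H Hl. apply is_derive_Reals in H. destruct (H l Hl) as [[d Hd] Hq]. simpl in Hq.
  assert (G : forall h, h <> 0 -> Rabs h < d -> 0 < (f (s + h) - f s) / h).
  { intros h Hh Hhd. specialize (Hq h Hh Hhd). apply Rabs_lt_between in Hq. lra. }
  exists d. split; [easy|]. split; intros t Ht.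
  - specialize (G (t - s) ltac:(lra) ltac:(rewrite Rabs_pos_eq; lra)).
    replace (s + (t - s)) with t in G by ring.
    apply (Rmult_lt_compat_r (t - s)) in G; [|lra].
    unfold Rdiv in G. rewrite Rmult_assoc, Rinv_l in G; lra.
  - specialize (G (t - s) ltac:(lra) ltac:(rewrite Rabs_left; lra)).
    replace (s + (t - s)) with t in G by ring.
    apply (Rmult_lt_compat_r (s - t)) in G; [|lra].
    unfold Rdiv in G. rewrite Rmult_assoc in G. replace (/ (t - s) * (s - t)) with (-1) in G by (field; lra). lra.
Qed.

Lemma lipschitz_continuous_from (f : R -> R) M a t :
  (forall s t, a <= s -> a <= t -> Rabs (f t - f s) <= M * Rabs (t - s)) -> a < t -> continuous f t.
Proof.
  intros H Ht. apply continuity_pt_filterlim. intros eps Heps.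
  assert (HM : 0 < Rabs M + 1) by (pose proof (Rabs_pos M); lra).
  exists (Rmin (t - a) (eps / (Rabs M + 1))). split.
  { apply Rmin_glb_lt; [lra|now apply Rdiv_lt_0_compat]. }
  intros s [_ Hs]. simpl in *. unfold Rdist in *.
  assert (H1 : Rabs (s - t) < t - a) by (eapply Rlt_le_trans; [apply Hs|apply Rmin_l]).
  assert (H2 : Rabs (s - t) < eps / (Rabs M + 1)) by (eapply Rlt_le_trans; [apply Hs|apply Rmin_r]).
  apply Rabs_lt_between in H1.
  eapply Rle_lt_trans; [apply H; lra|].
  apply Rle_lt_trans with ((Rabs M + 1) * Rabs (s - t)).
  - apply Rmult_le_compat_r; [apply Rabs_pos|]. pose proof (RRle_abs M). lra.
  - replace eps with ((Rabs M + 1) * (eps / (Rabs M + 1))) by (field; lra).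
    now apply Rmult_lt_compat_l.
Qed.

(** The wedge 0 <= b <= p t does not depend on e, which is what allows e to tend to 0. The lower
    side holds because the field equals 1 at b = 0. The upper side holds because the drag is
    nonnegative while 0 <= b <= pi/2, leaving b' <= p. *)
Lemma angle_regularized p e : 2 <= p -> 0 < e ->
  exists b : R -> R, (forall t, 0 < t -> is_derive b t (reg_field p e t (b t))) /\
    (forall t, 0 <= t <= / (2 * p) -> 0 <= b t <= p * t).
Proof.
  intros Hp He.
  assert (Hie : 0 < / e) by now apply Rinv_0_lt_compat.
  set (L := (2 * p + 2 * p * p) * (1 + / e) * (1 + / e)).
  assert (HL : 0 < L) by (unfold L; repeat apply Rmult_lt_0_compat; nra).
  destruct (picard (reg_field p e) L (p + / e) 0 HL) as [y [Hy0 [Hy Hlip]]].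
  { intros. now apply reg_field_lip. }
  { intros. now apply reg_field_bound. }
  set (M := p + / e) in *.
  (* Constant extension to t < 0, so that continuity at 0 is two-sided as [barrier] demands. *)
  set (b := fun t => y (Rmax t 0)).
  assert (Hb : forall t, 0 <= t -> b t = y t) by (intros; unfold b; now rewrite Rmax_left).
  assert (Hbc : forall t, continuous b t).
  { intros t. apply (lipschitz_continuous_from b M (t - 1)); [|lra].
    intros s r _ _. unfold b. eapply Rle_trans; [apply Hlip; apply Rmax_r|].
    apply Rmult_le_compat_l; [unfold M; lra|apply Rmax_lip]. }
  assert (Hbd : forall t, 0 < t -> is_derive b t (reg_field p e t (b t))).
  { intros t Ht. rewrite Hb by lra. apply (is_derive_ext_loc y); [|now apply Hy].
    exists (mkposreal t Ht). intros s Hs. unfold ball in Hs; simpl in Hs.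
    unfold AbsRing_ball, abs, minus, plus, opp in Hs; simpl in Hs.
    apply Rabs_lt_between in Hs. rewrite Hb by lra. easy. }
  assert (HM : 0 < M) by (unfold M; lra).
  assert (Hpos : forall t, 0 <= t -> 0 <= b t).
  { intros t Ht. assert (- b t <= 0); [|lra].
    apply (barrier (fun t => - b t) 0); auto.
    - rewrite Hb, Hy0 by lra. lra.
    - intros s _. apply (continuous_opp b), Hbc.
    (* On this length |b| <= M (x - s) <= 1/L, so the field differs from its value 1 at b = 0 by at
       most 1 and stays nonnegative. *)
    - intros s Hs Hz. exists (/ (L * M)).
      split; [apply Rinv_0_lt_compat; nra|]. intros r Hr.
      assert (b s <= b r); [|lra].
      apply (deriv_nonneg_le b (fun t => reg_field p e t (b t))); auto; try lra.
      + intros x Hx; apply Hbd; lra.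
      + intros x Hx.
        pose proof (reg_field_lip p e x x (b x) 0 Hp He) as HF. fold L in HF.
        rewrite reg_field_at0, Rminus_diag, Rabs_R0, Rplus_0_l, Rminus_0_r in HF.
        assert (Rabs (b x) <= M * (x - s)).
        { replace (b x) with (b x - b s) by lra.
          rewrite (Hb x), (Hb s) by lra. rewrite <- (Rabs_pos_eq (x - s)) by lra. apply Hlip; lra. }
        assert (L * Rabs (b x) <= 1).
        { apply Rle_trans with (L * (M * / (L * M))).
          - apply Rmult_le_compat_l; [lra|]. eapply Rle_trans; [apply H|]. apply Rmult_le_compat_l; lra.
          - right. field. lra. }
        apply Rabs_le_between in HF. lra. }
  exists b. split; [easy|]. intros t Ht. split; [apply Hpos; lra|].
  assert (b t - p * t <= 0); [|lra].
  assert (H2p : p * / (2 * p) = 1 / 2) by (field; lra).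
  pose proof PI2_1 as HPI.
  apply (barrier (fun t => b t - p * t) 0); try lra.
  - rewrite Hb, Hy0 by lra. lra.
  - intros s _. apply (continuous_minus b (fun t => p * t)); [apply Hbc|].
    apply is_derive_continuous with p. auto_derive; auto. ring.
  (* At contact b s = p s <= 1/2 < pi/2, so the drag stays nonnegative shortly after s. *)
  - intros s Hs Hz.
    assert (b s < PI / 2).
    { assert (p * s <= p * / (2 * p)) by (apply Rmult_le_compat_l; lra). lra. }
    assert (Hcs := Hbc s). apply continuity_pt_filterlim in Hcs.
    destruct (Hcs (PI / 2 - b s) ltac:(lra)) as [d [Hd Hcl]].
    exists d. split; [easy|]. intros r Hr.
    assert (b r - p * r <= b s - p * s); [|lra].
    apply (deriv_nonpos_le (fun t => b t - p * t) (fun t => reg_field p e t (b t) - p)); try lra.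
    + intros x Hx. apply (is_derive_minus b (fun t => p * t)); [apply Hbd; lra|].
      auto_derive; auto. ring.
    + intros x Hx. unfold reg_field.
      assert (Hbx : Rabs (b x - b s) < PI / 2 - b s).
      { apply Hcl. split; [split; [easy|lra]|]. simpl. unfold Rdist. apply Rabs_lt_between. lra. }
      apply Rabs_lt_between in Hbx.
      pose proof (Hpos x ltac:(lra)).
      pose proof (angle_drag_ge0 p (b x) Hp ltac:(lra)).
      assert (0 <= angle_drag p (b x) / Rmax x e).
      { apply Rdiv_le_0_compat; [lra|]. pose proof (Rmax_r x e). lra. }
      pose proof (angle_num_bounds p (b x) Hp). pose proof (angle_den_ge1 p (b x) Hp).
      assert (angle_num p (b x) / angle_den p (b x) <= p).
      { apply Rmult_le_reg_r with (angle_den p (b x)); [lra|].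
        unfold Rdiv. rewrite Rmult_assoc, Rinv_l by lra. nra. }
      lra.
    + intros x _. apply (continuous_minus b (fun t => p * t)); [apply Hbc|].
      apply is_derive_continuous with p. auto_derive; auto. ring.
Qed.

(** The field is singular at 0, so the equation is imposed for r > 0 only. The second clause
    contains the initial condition b 0 = 0 and confines b to the wedge in which the one-sided
    Lipschitz estimate holds. *)
Definition angle_solution p (b : R -> R) :=
  (forall r, 0 < r -> is_derive b r (angle_field p r (b r))) /\
  (forall r, 0 <= r <= / (2 * p * p) -> 0 <= b r <= p * r).

Lemma abs_le_of_sq x y : 0 <= y -> x ^ 2 <= y ^ 2 -> Rabs x <= y.
Proof. intros. apply Rabs_le_between. nra. Qed.

(** The curve [y] only has to solve the equation up to a defect [eta]. This serves both for two
    solutions of one equation and for solutions with two different exponents. *)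
Lemma angle_field_cmp p P (x y : R -> R) (dy : R -> R) a b eta :
  2 <= p <= P -> 0 < a <= b ->
  (forall t, a <= t <= b -> is_derive x t (angle_field p t (x t))) ->
  (forall t, a <= t <= b -> is_derive y t (dy t)) ->
  (forall t, a <= t <= b -> Rabs (angle_field p t (y t) - dy t) <= eta) ->
  (forall t, a <= t <= b -> t <= / (2 * P * P) -> 0 <= x t <= P * t /\ 0 <= y t <= P * t) ->
  (x b - y b) ^ 2 <=
  exp ((2 * ((2 * P + 2 * P * P) * (1 + 2 * P * P)) + 1) * (b - a)) *
    ((x a - y a) ^ 2 + eta ^ 2 * (b - a)).
Proof.
  intros Hp Hab Hx Hy He Hs.
  apply (gronwall_diff (fun t => x t - y t) (fun t => angle_field p t (x t) - dy t)); try lra.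
  - repeat apply Rmult_le_pos; nra.
  - intros t Ht. apply (is_derive_minus x y); [apply Hx|apply Hy]; lra.
  - intros t Ht.
    replace ((x t - y t) * (angle_field p t (x t) - dy t)) with
      ((x t - y t) * (angle_field p t (x t) - angle_field p t (y t)) +
       (x t - y t) * (angle_field p t (y t) - dy t)) by ring.
    pose proof (angle_field_osl P p t (x t) (y t) Hp ltac:(lra)
      (Hs t ltac:(lra))).
    assert ((x t - y t) * (angle_field p t (y t) - dy t) <= eta * Rabs (x t - y t)); [|lra].
    eapply Rle_trans; [apply Rle_abs|]. rewrite Rabs_mult.
    specialize (He t ltac:(lra)). pose proof (Rabs_pos (x t - y t)). nra.
  - intros t Ht. apply (continuous_minus x y).
    + eapply is_derive_continuous, Hx; lra.
    + eapply is_derive_continuous, Hy; lra.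
Qed.

(** The regularized solutions form a Cauchy sequence: up to radius [eps n] the wedge keeps them
    within p [eps n] of each other, and beyond it both solve the true equation, so the one-sided
    estimate propagates this distance. *)
Lemma angle_exists p : 2 <= p -> exists b, angle_solution p b.
Proof.
  intros Hp.
  set (r1 := / (2 * p * p)).
  assert (Hr1 : 0 < r1) by (apply Rinv_0_lt_compat; nra).
  assert (Hr1' : r1 <= / (2 * p)) by (apply Rinv_le_contravar; nra).
  set (eps := fun n : nat => r1 / (INR n + 1)).
  assert (Heps : forall n, 0 < eps n <= r1).
  { intros n. pose proof (pos_INR n). split; [apply Rdiv_lt_0_compat; lra|].
    unfold eps, Rdiv. rewrite <- (Rmult_1_r r1) at 2. apply Rmult_le_compat_l; [lra|].
    rewrite <- Rinv_1. apply Rinv_le_contravar; lra. }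
  assert (Hmono : forall n m, (n <= m)%nat -> eps m <= eps n).
  { intros n m Hnm. unfold eps, Rdiv. apply Rmult_le_compat_l; [lra|].
    pose proof (pos_INR n). apply le_INR in Hnm. apply Rinv_le_contravar; lra. }
  assert (Hlim : is_lim_seq eps 0).
  { replace (Finite 0) with (Rbar_mult r1 0) by (simpl; f_equal; ring).
    apply (is_lim_seq_scal_l (fun n => / (INR n + 1)) r1 0).
    replace (Finite 0) with (Rbar_inv p_infty) by easy.
    apply is_lim_seq_inv; [|easy].
    apply (is_lim_seq_ext (fun n => INR (S n))); [intros; apply S_INR|].
    apply (is_lim_seq_incr_1 INR), is_lim_seq_INR. }
  assert (Hch : forall n, exists b : R -> R,
     (forall t, 0 < t -> is_derive b t (reg_field p (eps n) t (b t))) /\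
     (forall t, 0 <= t <= / (2 * p) -> 0 <= b t <= p * t)).
  { intros n. apply angle_regularized; [easy|apply Heps]. }
  apply choice in Hch. destruct Hch as [bb Hbb].
  set (K := 2 * ((2 * p + 2 * p * p) * (1 + 2 * p * p)) + 1).
  assert (HK : 0 < K) by (unfold K; nra).
  assert (Hcl : forall t, 0 <= t -> forall n m, (n <= m)%nat ->
     Rabs (bb n t - bb m t) <= p * exp (K * t) * eps n).
  { intros t Ht n m Hnm. pose proof (Heps n). pose proof (Heps m).
    pose proof (Hmono n m Hnm).
    assert (1 <= exp (K * t)).
    { rewrite <- exp_0. destruct Ht as [Ht|<-]; [left; apply exp_increasing; nra|].
      rewrite Rmult_0_r. lra. }
    assert (Hclose : forall s, 0 <= s <= eps n -> Rabs (bb n s - bb m s) <= p * eps n).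
    { intros s Hs. pose proof (proj2 (Hbb n) s ltac:(lra)). pose proof (proj2 (Hbb m) s ltac:(lra)).
      apply Rabs_le_between. nra. }
    destruct (Rle_dec t (eps n)).
    { eapply Rle_trans; [apply Hclose; lra|].
      assert (0 <= p * eps n) by nra. nra. }
    apply abs_le_of_sq; [apply Rmult_le_pos; [nra|lra]|].
    pose proof (angle_field_cmp p p (bb n) (bb m) (fun t => angle_field p t (bb m t)) (eps n) t 0) as HC.
    eapply Rle_trans; [apply HC|].
    - lra.
    - lra.
    - intros s Hs. rewrite <- (reg_field_eq p (eps n)) by lra. apply Hbb; lra.
    - intros s Hs. rewrite <- (reg_field_eq p (eps m)) by lra. apply Hbb; lra.
    - intros s Hs. rewrite Rminus_diag, Rabs_R0. lra.
    - intros s Hs Hs1. split; apply Hbb; fold r1 in Hs1; lra.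
    - fold K. specialize (Hclose (eps n) ltac:(lra)).
      assert ((bb n (eps n) - bb m (eps n)) ^ 2 <= (p * eps n) ^ 2).
      { rewrite <- (pow2_abs (bb n (eps n) - bb m (eps n))).
        apply pow_incr. split; [apply Rabs_pos|easy]. }
      assert (exp (K * (t - eps n)) <= exp (K * t)).
      { left; apply exp_increasing. nra. }
      replace ((p * exp (K * t) * eps n) ^ 2) with (exp (K * t) * exp (K * t) * (p * eps n) ^ 2) by ring.
      rewrite (pow_i 2), Rmult_0_l, Rplus_0_r by lia.
      pose proof (pow2_ge_0 (bb n (eps n) - bb m (eps n))).
      apply Rmult_le_compat; try easy.
      + left; apply exp_pos.
      + nra. }
  set (b := fun t => real (Lim_seq (fun n => bb n t))).
  assert (Hb : forall t, 0 <= t -> is_lim_seq (fun n => bb n t) (b t)).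
  { intros t Ht. apply (cauchy_bound_lim (fun n => bb n t) (fun n => p * exp (K * t) * eps n)).
    - intros; now apply Hcl.
    - replace (Finite 0) with (Rbar_mult (p * exp (K * t)) 0) by (simpl; f_equal; ring).
      now apply is_lim_seq_scal_l. }
  exists b. split.
  (* Beyond s/2 the regularization is eventually inactive and the field is Lipschitz, so the limit
     can be taken in the remainder bound. *)
  - intros s Hs. set (a := s / 2). assert (Ha : 0 < a < s) by (unfold a; lra).
    assert (HN : exists N, forall n, (N <= n)%nat -> eps n <= a).
    { apply is_lim_seq_spec in Hlim. destruct (Hlim (mkposreal a (proj1 Ha))) as [N HN].
      exists N. intros n Hn. specialize (HN n Hn). simpl in HN. apply Rabs_lt_between in HN. lra. }
    destruct HN as [N HN].
    set (L := (2 * p + 2 * p * p) * (1 + / a) * (1 + / a)).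
    assert (0 < / a) by (apply Rinv_0_lt_compat; lra).
    assert (HL : 0 < L) by (unfold L; repeat apply Rmult_lt_0_compat; nra).
    assert (Hd : forall n, (N <= n)%nat -> forall t, a <= t -> is_derive (bb n) t (angle_field p t (bb n t))).
    { intros n Hn t Ht. rewrite <- (reg_field_eq p (eps n)) by (specialize (HN n Hn); lra).
      apply Hbb; lra. }
    apply (ode_limit (angle_field p) bb bb b a s (L * (1 + (p + / a)))); [lra| | |].
    + intros t Ht. exists N. intros n Hn.
      apply (quadratic_remainder (angle_field p) (bb n) (bb n) a); try lra.
      * intros. now apply angle_field_lip.
      * intros t' s' Ht' Hs'.
        destruct (MVT_gen (bb n) s' t' (fun t => angle_field p t (bb n t))) as [c [Hc E]].
        -- intros x Hx. apply Hd; auto. revert Hx. unfold Rmin. destruct (Rle_dec s' t'); lra.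
        -- intros x Hx. apply continuity_pt_filterlim. eapply is_derive_continuous, Hd; auto.
           revert Hx. unfold Rmin. destruct (Rle_dec s' t'); lra.
        -- rewrite E, Rabs_mult. apply Rmult_le_compat_r; [apply Rabs_pos|].
           rewrite <- (reg_field_eq p a).
           ++ apply reg_field_bound; lra.
           ++ revert Hc. unfold Rmin. destruct (Rle_dec s' t'); lra.
      * now apply Hd.
    + intros t Ht. apply Hb; lra.
    + apply (is_lim_seq_continuous (angle_field p s)); [|apply Hb; lra].
      intros e He. exists (e / L). split; [now apply Rdiv_lt_0_compat|].
      intros x [_ Hx]. simpl in *. unfold Rdist in *.
      eapply Rle_lt_trans; [apply (angle_field_lip p a); lra|]. fold L.
      rewrite Rminus_diag, Rabs_R0, Rplus_0_l.
      replace e with (L * (e / L)) by (field; lra). apply Rmult_lt_compat_l; lra.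
  - intros r Hr. fold r1 in Hr. split.
    + apply (is_lim_seq_le (fun _ => 0) (fun n => bb n r) 0 (b r)).
      * intros n. apply Hbb; lra.
      * apply is_lim_seq_const.
      * apply Hb; lra.
    + apply (is_lim_seq_le (fun n => bb n r) (fun _ => p * r) (b r) (p * r)).
      * intros n. apply Hbb; lra.
      * apply Hb; lra.
      * apply is_lim_seq_const.
Qed.

(** The conjugate exponent moves by |p - q| / ((p - 1)(q - 1)), which the factor q - 1 in front of
    the sine power compensates. *)
Lemma angle_field_exp_lip p q P r x : 2 <= p <= P -> 2 <= q <= P -> 0 < r ->
  Rabs (angle_field p r x - angle_field q r x) <= (P + 3) * (1 + / r) * Rabs (p - q).
Proof.
  intros Hp Hq Hr. unfold angle_field.
  assert (Hi : 0 < / r) by now apply Rinv_0_lt_compat.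
  pose proof (angle_den_ge1 p x ltac:(lra)). pose proof (angle_den_ge1 q x ltac:(lra)).
  pose proof (angle_num_bounds q x ltac:(lra)).
  pose proof (conj_exp_bounds p ltac:(lra)). pose proof (conj_exp_bounds q ltac:(lra)).
  assert (Hden : Rabs (angle_den p x - angle_den q x) <= Rabs (p - q)).
  { unfold angle_den. replace ((p - 1) * sin x ^ 2 + cos x ^ 2 - ((q - 1) * sin x ^ 2 + cos x ^ 2))
      with ((p - q) * sin x ^ 2) by ring.
    rewrite Rabs_mult, <- (Rmult_1_r (Rabs (p - q))) at 1.
    rewrite Rmult_1_r.
    rewrite (Rabs_pos_eq (sin x ^ 2)) by apply pow2_ge_0.
    pose proof (sin2_cos2 x). unfold Rsqr in *. pose proof (pow2_ge_0 (cos x)).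
    pose proof (Rabs_pos (p - q)). nra. }
  assert (Hconj : (q - 1) * Rabs (conj_exp p - conj_exp q) <= Rabs (p - q)).
  { replace (conj_exp p - conj_exp q) with (- (p - q) * / (p - 1) * / (q - 1))
      by (unfold conj_exp; field; lra).
    rewrite !Rabs_mult, Rabs_Ropp, (Rabs_pos_eq (/ (p - 1))), (Rabs_pos_eq (/ (q - 1)))
      by (left; apply Rinv_0_lt_compat; lra).
    replace ((q - 1) * (Rabs (p - q) * / (p - 1) * / (q - 1))) with (Rabs (p - q) * / (p - 1)) by (field; lra).
    rewrite <- (Rmult_1_r (Rabs (p - q))) at 2. apply Rmult_le_compat_l; [apply Rabs_pos|].
    rewrite <- Rinv_1. apply Rinv_le_contravar; lra. }
  assert (Hnum : Rabs (angle_num p x - angle_num q x) <= 3 * Rabs (p - q)).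
  { unfold angle_num. set (s := Rabs (sin x)). set (c := Rabs (cos x)).
    replace ((p - 1) * powp s (conj_exp p) + powp c p - ((q - 1) * powp s (conj_exp q) + powp c q))
      with ((p - q) * powp s (conj_exp p) + (q - 1) * (powp s (conj_exp p) - powp s (conj_exp q))
         + (powp c p - powp c q)) by ring.
    eapply Rle_trans; [apply Rabs_triang|].
    eapply Rle_trans; [apply Rplus_le_compat_r, Rabs_triang|].
    rewrite !Rabs_mult, (Rabs_pos_eq (q - 1)) by lra.
    pose proof (powp_lip_exp s (conj_exp p) (conj_exp q) (sin_abs_le1 x) ltac:(lra) ltac:(lra)).
    pose proof (powp_lip_exp c p q (cos_abs_le1 x) ltac:(lra) ltac:(lra)).
    pose proof (powp_le_1 s (conj_exp p) (sin_abs_le1 x) ltac:(lra)).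
    rewrite (Rabs_pos_eq (powp s _)) by apply powp_ge0.
    pose proof (powp_ge0 s (conj_exp p)). pose proof (Rabs_pos (p - q)).
    assert (Rabs (p - q) * powp s (conj_exp p) <= Rabs (p - q)) by nra.
    assert ((q - 1) * Rabs (powp s (conj_exp p) - powp s (conj_exp q)) <=
       (q - 1) * Rabs (conj_exp p - conj_exp q)) by (apply Rmult_le_compat_l; lra).
    lra. }
  replace (angle_num p x / angle_den p x - angle_drag p x / r - (angle_num q x / angle_den q x - angle_drag q x / r))
    with ((angle_num p x / angle_den p x - angle_num q x / angle_den q x) + - (angle_drag p x - angle_drag q x) * / r)
    by (unfold Rdiv; ring).
  eapply Rle_trans; [apply Rabs_triang|]. rewrite Rabs_mult, Rabs_Ropp, (Rabs_pos_eq (/ r)) by lra.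
  assert (A1 : Rabs (angle_num p x / angle_den p x - angle_num q x / angle_den q x) <= (P + 3) * Rabs (p - q)).
  { eapply Rle_trans; [apply (quotient_diff _ _ _ _ P); try lra; rewrite Rabs_pos_eq; lra|].
    assert (P * Rabs (angle_den p x - angle_den q x) <= P * Rabs (p - q)) by (apply Rmult_le_compat_l; lra).
    lra. }
  assert (A2 : Rabs (angle_drag p x - angle_drag q x) <= (P + 3) * Rabs (p - q)).
  { unfold angle_drag.
    eapply Rle_trans; [apply (quotient_diff _ _ _ _ 1); try lra; apply sin_cos_abs_le1|].
    rewrite Rminus_diag, Rabs_R0. pose proof (Rabs_pos (p - q)). nra. }
  assert (Rabs (angle_drag p x - angle_drag q x) * / r <= (P + 3) * Rabs (p - q) * / r)
    by (apply Rmult_le_compat_r; lra).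
  lra.
Qed.

(** The defect caused by a change of exponent is only controlled by |p - q| / r, so the comparison
    starts at a small radius [a], below which the wedge keeps both angles within P [a]. The radius
    is fixed first, and [d] is chosen depending on it. *)
Lemma angle_continuous_exp p P (b : R -> R) r eta : 2 <= p <= P -> angle_solution p b -> 0 < r -> 0 < eta ->
  exists d, 0 < d /\ forall q c, 2 <= q <= P -> Rabs (p - q) < d -> angle_solution q c ->
    Rabs (b r - c r) < eta.
Proof.
  intros Hp [Hb Hb0] Hr Heta.
  set (K := 2 * ((2 * P + 2 * P * P) * (1 + 2 * P * P)) + 1).
  set (E := exp (K * r)). assert (HE : 0 < E) by apply exp_pos.
  set (r1 := / (2 * P * P)).
  assert (Hr1 : 0 < r1) by (apply Rinv_0_lt_compat; nra).
  set (e0 := eta / (2 * P * (E + 1))).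
  assert (He0 : 0 < e0) by (apply Rdiv_lt_0_compat; nra).
  set (a := Rmin (Rmin r r1) e0).
  assert (Ha : 0 < a) by (repeat apply Rmin_glb_lt; lra).
  assert (Har : a <= r) by (eapply Rle_trans; [apply Rmin_l|apply Rmin_l]).
  assert (Har1 : a <= r1) by (eapply Rle_trans; [apply Rmin_l|apply Rmin_r]).
  assert (Hae0 : a <= e0) by apply Rmin_r.
  assert (Hia : 0 < / a) by now apply Rinv_0_lt_compat.
  set (C := (P + 3) * (1 + / a)).
  assert (HC : 0 < C).
  { unfold C. nra. }
  set (d := eta / (2 * C * (E + 1) * (1 + r))).
  assert (Hd : 0 < d) by (apply Rdiv_lt_0_compat; [lra|]; repeat apply Rmult_lt_0_compat; lra).
  exists d. split; [easy|]. intros q c Hq Hpq [Hc Hc0].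
  assert (Hsmall : forall t, 0 < t -> t <= r1 -> 0 <= b t <= P * t /\ 0 <= c t <= P * t).
  { intros t Ht Ht1.
    assert (t <= / (2 * p * p)).
    { eapply Rle_trans; [apply Ht1|]. apply Rinv_le_contravar; nra. }
    assert (t <= / (2 * q * q)).
    { eapply Rle_trans; [apply Ht1|]. apply Rinv_le_contravar; nra. }
    specialize (Hb0 t ltac:(lra)). specialize (Hc0 t ltac:(lra)). nra. }
  assert (H : (b r - c r) ^ 2 <= exp (K * (r - a)) * ((b a - c a) ^ 2 + (C * d) ^ 2 * (r - a))).
  { apply (angle_field_cmp p P b c (fun t => angle_field q t (c t))); try lra.
    - intros; apply Hb; lra.
    - intros; apply Hc; lra.
    - intros t Ht. eapply Rle_trans; [apply (angle_field_exp_lip p q P); lra|].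
      apply Rmult_le_compat; [|apply Rabs_pos| |lra].
      + assert (0 < / t) by (apply Rinv_0_lt_compat; lra). nra.
      + unfold C. assert (/ t <= / a) by (apply Rinv_le_contravar; lra). nra.
    - intros t Ht Ht1. apply Hsmall; [lra|easy]. }
  assert (H1 : (b a - c a) ^ 2 <= (P * a) ^ 2).
  { destruct (Hsmall a Ha Har1). nra. }
  assert (HEE : exp (K * (r - a)) <= E).
  { unfold E. assert (0 < K) by (unfold K; nra).
    destruct (Req_dec a 0); [lra|]. left. apply exp_increasing. nra. }
  assert (H2 : P * a <= eta / (2 * (E + 1))).
  { apply Rle_trans with (P * e0); [apply Rmult_le_compat_l; lra|].
    right. unfold e0. field. lra. }
  assert (H3 : (C * d) ^ 2 * (r - a) <= (eta / (2 * (E + 1))) ^ 2).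
  { assert (C * d = eta / (2 * (E + 1)) * / (1 + r)) as -> by (unfold d; field; lra).
    set (g := eta / (2 * (E + 1))).
    assert (0 < / (1 + r)) by (apply Rinv_0_lt_compat; lra).
    assert (/ (1 + r) ^ 2 * (r - a) <= 1).
    { apply Rle_trans with (/ (1 + r) ^ 2 * (1 + r) ^ 2); [|right; field; lra].
      apply Rmult_le_compat_l; [|nra]. left; apply Rinv_0_lt_compat; nra. }
    replace ((g * / (1 + r)) ^ 2 * (r - a)) with (g ^ 2 * (/ (1 + r) ^ 2 * (r - a))) by (field; lra).
    pose proof (pow2_ge_0 g). nra. }
  set (g := eta / (2 * (E + 1))) in *.
  assert (Hg : 0 < g) by (apply Rdiv_lt_0_compat; lra).
  assert (H4 : (P * a) ^ 2 <= g ^ 2) by (apply pow_incr; split; [nra|lra]).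
  assert (H5 : (b r - c r) ^ 2 <= E * (2 * g ^ 2)).
  { eapply Rle_trans; [apply H|]. apply Rmult_le_compat; try lra.
    - left; apply exp_pos.
    - pose proof (pow2_ge_0 (b a - c a)). assert (0 <= (C * d) ^ 2 * (r - a)); [|lra].
      apply Rmult_le_pos; [apply pow2_ge_0|lra]. }
  assert (H6 : E * (2 * g ^ 2) < eta ^ 2).
  { replace (eta ^ 2) with (4 * (E + 1) ^ 2 * g ^ 2) by (unfold g; field; lra).
    assert (0 < g ^ 2) by nra. nra. }
  apply Rabs_lt_between. nra.
Qed.

(** * Crossing times *)

Lemma continuous_eps (f : R -> R) t e : continuous f t -> 0 < e ->
  exists d, 0 < d /\ forall s, Rabs (s - t) < d -> Rabs (f s - f t) < e.
Proof.
  intros H He. apply continuity_pt_filterlim in H. destruct (H e He) as [d [Hd Hc]].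
  exists d. split; [easy|]. intros s Hs. destruct (Req_dec t s) as [->|Hn].
  - rewrite Rminus_diag, Rabs_R0. easy.
  - apply Hc. split; [split; [easy|exact Hn]|exact Hs].
Qed.

Lemma sin_cos_quarter j : sin (INR j * (PI / 2)) * cos (INR j * (PI / 2)) = 0.
Proof.
  assert (H : sin (2 * (INR j * (PI / 2))) = 0).
  { apply sin_eq_0_1. exists (Z.of_nat j). rewrite <- INR_IZR_INZ. field. }
  rewrite sin_2a in H. lra.
Qed.

(** Here sin b cos b = 0 removes the drag, and the remaining ratio is 1/1 or (p-1)/(p-1). Hence b
    passes every multiple of pi/2 upwards with unit slope, whatever r and p are. *)
Lemma angle_field_quarter p r j : 2 <= p -> angle_field p r (INR j * (PI / 2)) = 1.
Proof.
  intros Hp. set (x := INR j * (PI / 2)). pose proof (sin_cos_quarter j) as H. fold x in H.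
  pose proof (sin2_cos2 x) as Hsc. unfold Rsqr in Hsc.
  unfold angle_field, angle_drag. rewrite H. unfold angle_num, angle_den.
  apply Rmult_integral in H. destruct H as [H|H]; rewrite H in *.
  - assert (HA : Rabs (cos x) = 1).
    { rewrite <- (sqrt_Rsqr_abs (cos x)). unfold Rsqr. replace (cos x * cos x) with 1 by lra. apply sqrt_1. }
    rewrite HA, Rabs_R0, powp_0, powp_1l. replace (cos x ^ 2) with 1 by lra.
    replace ((p - 1) * 0 ^ 2 + 1) with 1 by ring. unfold Rdiv. rewrite Rinv_1. ring.
  - assert (HA : Rabs (sin x) = 1).
    { rewrite <- (sqrt_Rsqr_abs (sin x)). unfold Rsqr. replace (sin x * sin x) with 1 by lra. apply sqrt_1. }
    rewrite HA, Rabs_R0, powp_0, powp_1l. replace (sin x ^ 2) with 1 by lra.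
    replace ((p - 1) * 1 + 0 ^ 2) with (p - 1) by ring.
    replace ((p - 1) * 1 + 0) with (p - 1) by ring.
    unfold Rdiv. rewrite Rinv_r by lra. ring.
Qed.

Section Crossing.
Variables (p : R) (b : R -> R).
Hypothesis Hp : 2 <= p.
Hypothesis Hb : angle_solution p b.

Lemma angle_continuous r : 0 < r -> continuous b r.
Proof. intros. eapply is_derive_continuous, Hb; easy. Qed.

(** Unit slope at the level prevents b from falling back through it. Equality at r is also
    impossible, since b would then be below the level just before r. *)
Lemma angle_above j a r : 0 < a < r -> INR j * (PI / 2) <= b a -> INR j * (PI / 2) < b r.
Proof.
  intros Hr Ha. set (x := INR j * (PI / 2)) in *.
  assert (Hd : forall s, 0 < s -> b s = x -> is_derive b s 1).
  { intros s Hs E. replace 1 with (angle_field p s (b s)); [now apply Hb|].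
    rewrite E. now apply angle_field_quarter. }
  assert (Hge : forall t, a <= t -> x <= b t).
  { intros t Ht. assert (x - b t <= 0); [|lra].
    apply (barrier (fun t => x - b t) a); try lra.
    - intros s Hs. apply (continuous_minus (fun _ => x) b); [apply continuous_const|].
      apply angle_continuous; lra.
    - intros s Hs E. destruct (is_derive_pos_locally b s 1) as [d [H0 [H1 _]]]; try lra.
      { apply Hd; lra. }
      exists d. split; [easy|]. intros t' Ht'. specialize (H1 t' Ht'). lra. }
  destruct (Hge r ltac:(lra)) as [|E]; [easy|exfalso].
  destruct (is_derive_pos_locally b r 1) as [d [H0 [_ H1]]]; try lra.
  { apply Hd; lra. }
  set (t := Rmax a (r - d / 2)).
  assert (a <= t) by apply Rmax_l. assert (r - d / 2 <= t) by apply Rmax_r.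
  assert (t < r) by (apply Rmax_lub_lt; lra).
  specialize (H1 t ltac:(lra)). specialize (Hge t ltac:(lra)). lra.
Qed.

(** Odd j give the zeros of u, even j >= 2 its critical points away from the origin. *)
Definition crossing j t := 0 < t /\ b t = INR j * (PI / 2).

Lemma crossing_before j t r : crossing j t -> 0 < r < t -> b r < INR j * (PI / 2).
Proof.
  intros [H0 H] Hr. destruct (Rlt_dec (b r) (INR j * (PI / 2))) as [|Hn]; [easy|exfalso].
  pose proof (angle_above j r t Hr ltac:(lra)). lra.
Qed.

Lemma crossing_after j t r : crossing j t -> t < r -> INR j * (PI / 2) < b r.
Proof. intros [H0 H] Hr. apply (angle_above j t r); lra. Qed.

Lemma crossing_lt i j s t : crossing i s -> crossing j t -> (i < j)%nat -> s < t.
Proof.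
  intros Hs Ht Hij. destruct (Rlt_dec s t) as [|Hn]; [easy|exfalso].
  apply lt_INR in Hij. pose proof PI2_1. destruct Hs as [Hs0 Hs], Ht as [Ht0 Ht].
  destruct (Req_dec s t) as [->|]; [nra|].
  pose proof (crossing_after j t s (conj Ht0 Ht) ltac:(lra)). nra.
Qed.

Lemma crossing_unique j s t : crossing j s -> crossing j t -> s = t.
Proof.
  intros Hs Ht. destruct (Rtotal_order s t) as [H|[H|H]]; [exfalso|easy|exfalso].
  - pose proof (crossing_after j s t Hs H). destruct Ht. lra.
  - pose proof (crossing_after j t s Ht H). destruct Hs. lra.
Qed.

(** For large r the drag term is at most half of the minimum of the ratio, so b grows at least
    linearly and reaches every level. The bound k = (1/2)^p on the numerator holds because sin^2 >=
    1/2 or |cos| >= 1/2. *)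
Lemma angle_field_lower : exists R0 w, 0 < R0 /\ 0 < w /\ forall r x, R0 <= r -> w <= angle_field p r x.
Proof.
  set (k := powp (1 / 2) p). assert (Hk : 0 < k) by (apply powp_gt0; lra).
  assert (Hk4 : k <= 1 / 4).
  { apply Rle_trans with (powp (1 / 2) 2); [apply powp_le_exp; lra|]. rewrite powp_2; lra. }
  exists (2 * p / k), (k / (2 * p)).
  split; [apply Rdiv_lt_0_compat; lra|]. split; [apply Rdiv_lt_0_compat; lra|].
  intros r x Hr. pose proof (angle_den_ge1 p x Hp). pose proof (conj_exp_bounds p Hp).
  assert (0 < 2 * p / k) by (apply Rdiv_lt_0_compat; lra).
  assert (Hnum : k <= angle_num p x).
  { unfold angle_num. pose proof (sin2_cos2 x) as Hsc. rewrite !Rsqr_pow2 in Hsc.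
    pose proof (sin_abs_le1 x). pose proof (cos_abs_le1 x).
    pose proof (powp_ge0 (Rabs (sin x)) (conj_exp p)). pose proof (powp_ge0 (Rabs (cos x)) p).
    destruct (Rle_dec (1 / 2) (sin x ^ 2)).
    - assert (sin x ^ 2 <= powp (Rabs (sin x)) (conj_exp p)).
      { rewrite <- pow2_abs, <- powp_2 by lra. apply powp_le_exp; lra. }
      nra.
    - assert (1 / 2 <= Rabs (cos x)).
      { rewrite <- (pow2_abs (cos x)) in Hsc. nra. }
      assert (k <= powp (Rabs (cos x)) p) by (apply powp_le; lra). nra. }
  unfold angle_field. pose proof (angle_drag_le1 p x Hp) as HD.
  assert (A1 : k / p <= angle_num p x / angle_den p x).
  { unfold Rdiv. apply Rmult_le_compat; try lra.
    - left; apply Rinv_0_lt_compat; lra.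
    - apply Rinv_le_contravar; lra. }
  assert (A2 : angle_drag p x / r <= k / (2 * p)).
  { apply Rle_trans with (1 * / (2 * p / k)).
    - unfold Rdiv at 1. apply Rle_trans with (1 * / r).
      + apply Rmult_le_compat_r; [left; apply Rinv_0_lt_compat; lra|].
        apply Rabs_le_between in HD. lra.
      + apply Rmult_le_compat_l; [lra|]. apply Rinv_le_contravar; lra.
    - right. field. lra. }
  replace (k / (2 * p)) with (k / p - k / (2 * p)) by (field; lra). lra.
Qed.

Lemma crossing_exists j : (1 <= j)%nat -> exists t, crossing j t.
Proof.
  intros Hj. set (x := INR j * (PI / 2)).
  assert (Hx : 1 < x).
  { apply le_INR in Hj. pose proof PI2_1. unfold x. simpl in Hj. nra. }
  destruct angle_field_lower as [R0 [w [HR0 [Hw Hlow]]]].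
  set (a := / (2 * p * p)).
  assert (Ha : 0 < a) by (apply Rinv_0_lt_compat; nra).
  assert (Hba : b a < x).
  { destruct Hb as [_ Hb0]. specialize (Hb0 a ltac:(unfold a in *; lra)).
    assert (p * a = / (2 * p)) as E by (unfold a; field; lra).
    assert (/ (2 * p) < 1) by (rewrite <- Rinv_1; apply Rinv_lt_contravar; lra). lra. }
  set (R1 := Rmax R0 a + 1). pose proof (Rmax_l R0 a). pose proof (Rmax_r R0 a).
  set (c := R1 + (Rabs (x - b R1) + 1) / w).
  assert (Hc1 : 0 < (Rabs (x - b R1) + 1) / w).
  { apply Rdiv_lt_0_compat; [|easy]. pose proof (Rabs_pos (x - b R1)). lra. }
  assert (Hbc : x < b c).
  { destruct (mean_value b (fun t => angle_field p t (b t)) R1 c) as [y [Hy E]].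
    - unfold c; lra.
    - intros t Ht. apply Hb. unfold R1 in Ht. lra.
    - intros t Ht. apply angle_continuous. unfold R1 in Ht. lra.
    - assert (w <= angle_field p y (b y)) by (apply Hlow; unfold R1 in Hy; lra).
      assert (w * (c - R1) <= angle_field p y (b y) * (c - R1))
        by (apply Rmult_le_compat_r; unfold c; lra).
      assert (w * (c - R1) = Rabs (x - b R1) + 1) as E2 by (unfold c; field; lra).
      pose proof (Rle_abs (x - b R1)). lra. }
  destruct (IVT_interv (fun t => b t - x) a c) as [t [Ht E]].
  - intros t Ht. apply continuity_pt_filterlim.
    apply (continuous_minus b (fun _ => x)); [apply angle_continuous; lra|apply continuous_const].
  - assert (a < R1) by (unfold R1; lra). unfold c. lra.
  - lra.
  - lra.
  - exists t. split; [lra|]. fold x. lra.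
Qed.
End Crossing.

(** Just before and just after t the angle is strictly on either side of the level, and strict
    inequalities at two fixed radii persist for nearby exponents. *)
Lemma crossing_continuous p P b j t eta : 2 <= p <= P -> angle_solution p b -> crossing b j t -> 0 < eta ->
  exists d, 0 < d /\ forall q c s, 2 <= q <= P -> Rabs (p - q) < d ->
    angle_solution q c -> crossing c j s -> Rabs (s - t) < eta.
Proof.
  intros Hp Hb Hc Heta. pose proof (proj1 Hc) as Ht.
  set (e := Rmin (eta / 2) (t / 2)).
  assert (He : 0 < e) by (apply Rmin_glb_lt; lra).
  assert (He1 : e <= eta / 2) by apply Rmin_l. assert (He2 : e <= t / 2) by apply Rmin_r.
  pose proof (crossing_before p b (proj1 Hp) Hb j t (t - e) Hc ltac:(lra)) as H1.
  pose proof (crossing_after p b (proj1 Hp) Hb j t (t + e) Hc ltac:(lra)) as H2.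
  destruct (angle_continuous_exp p P b (t - e) (INR j * (PI / 2) - b (t - e)) Hp Hb ltac:(lra) ltac:(lra)) as [d1 [Hd1 A1]].
  destruct (angle_continuous_exp p P b (t + e) (b (t + e) - INR j * (PI / 2)) Hp Hb ltac:(lra) ltac:(lra)) as [d2 [Hd2 A2]].
  exists (Rmin d1 d2). split; [now apply Rmin_glb_lt|].
  intros q c s Hq Hpq Hcs Hs.
  specialize (A1 q c Hq ltac:(eapply Rlt_le_trans; [apply Hpq|apply Rmin_l]) Hcs).
  specialize (A2 q c Hq ltac:(eapply Rlt_le_trans; [apply Hpq|apply Rmin_r]) Hcs).
  apply Rabs_lt_between in A1, A2.
  apply Rabs_lt_between.
  destruct (Rle_dec s (t - e)).
  { exfalso. destruct (Req_dec s (t - e)) as [E|].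
    - rewrite <- E in *. destruct Hs as [_ Hs]. lra.
    - pose proof (crossing_after q c (proj1 Hq) Hcs j s (t - e) Hs ltac:(lra)). lra. }
  destruct (Rle_dec (t + e) s).
  { exfalso. destruct (Req_dec s (t + e)) as [E|].
    - rewrite <- E in *. destruct Hs as [_ Hs]. lra.
    - pose proof (crossing_before q c (proj1 Hq) Hcs j s (t + e) Hs ltac:(lra)). lra. }
  lra.
Qed.

(** * The radial flow *)

Lemma conj_exp_inv p : 2 <= p -> (conj_exp p - 1) * (p - 1) = 1.
Proof. intros. unfold conj_exp. field. lra. Qed.

Lemma phi_exp p x : phi p (exp x) = exp ((p - 1) * x).
Proof. rewrite phi_Rpower by apply exp_pos. unfold Rpower. now rewrite ln_exp. Qed.

Lemma phi_exp_mult p x y : phi p (exp x * y) = exp ((p - 1) * x) * phi p y.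
Proof. now rewrite phi_mult, phi_exp. Qed.

(* First-order form of -(r phi_p(U'))' = mu r phi_p(U) with Y = phi_p(U'). *)
Definition radial_flow (p mu b : R) (U Y : R -> R) :=
  (forall r, is_derive U r (phi (conj_exp p) (Y r))) /\
  (forall r, continuous Y r) /\ Y 0 = 0 /\
  (forall r, 0 < r < b -> is_derive Y r (- mu * phi p (U r) - Y r / r)).

Section Existence.
Variables (p : R) (b : R -> R).
Hypothesis Hp : 2 <= p.
Hypothesis Hb : angle_solution p b.

(** The derivative of log rho. It depends on the angle alone, so rho is recovered by a quadrature,
    normalized to rho = 1 at r = 1. *)
Definition log_radius_rate r :=
  p * (- phi (conj_exp p) (sin (b r)) * cos (b r) + phi p (cos (b r)) * sin (b r) - sin (b r) ^ 2 / r)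
    / angle_den p (b r).

Lemma continuous_sin_angle r : 0 < r -> continuous (fun r => sin (b r)) r.
Proof.
  intros. apply (continuous_comp b sin); [now apply (angle_continuous p)|].
  apply continuity_pt_filterlim, continuity_sin.
Qed.

Lemma continuous_cos_angle r : 0 < r -> continuous (fun r => cos (b r)) r.
Proof.
  intros. apply (continuous_comp b cos); [now apply (angle_continuous p)|].
  apply continuity_pt_filterlim, continuity_cos.
Qed.

Lemma log_radius_rate_continuous r : 0 < r -> continuous log_radius_rate r.
Proof.
  intros Hr. pose proof (continuous_sin_angle r Hr) as Hs. pose proof (continuous_cos_angle r Hr) as Hc.
  pose proof (conj_exp_bounds p Hp). pose proof (angle_den_ge1 p (b r) Hp).
  assert (Hs2 : continuous (fun r => sin (b r) ^ 2) r).
  { apply (continuous_ext (fun r => sin (b r) * sin (b r))).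
    - intros x. change (@eq R (sin (b x) * sin (b x)) (sin (b x) ^ 2)). ring.
    - now apply (continuous_mult (fun r => sin (b r))). }
  assert (Hc2 : continuous (fun r => cos (b r) ^ 2) r).
  { apply (continuous_ext (fun r => cos (b r) * cos (b r))).
    - intros x. change (@eq R (cos (b x) * cos (b x)) (cos (b x) ^ 2)). ring.
    - now apply (continuous_mult (fun r => cos (b r))). }
  unfold log_radius_rate, Rdiv.
  apply (continuous_mult (fun r => p * _)).
  - apply (continuous_mult (fun _ => p)); [apply continuous_const|].
    apply (continuous_minus (fun r => _ + _)).
    + apply (continuous_plus (fun r => _ * _)).
      * apply (continuous_mult (fun r => - _)); [|easy].
        apply (continuous_opp (fun r => phi (conj_exp p) (sin (b r)))).
        apply (continuous_comp (fun r => sin (b r)) (phi (conj_exp p))); [easy|].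
        apply phi_continuous; lra.
      * apply (continuous_mult (fun r => phi p (cos (b r)))); [|easy].
        apply (continuous_comp (fun r => cos (b r)) (phi p)); [easy|].
        apply phi_continuous; lra.
    + apply (continuous_mult (fun r => sin (b r) ^ 2) Rinv); [easy|].
      apply continuous_Rinv. lra.
  - apply (continuous_comp (fun r => angle_den p (b r)) Rinv); [|apply continuous_Rinv; lra].
    unfold angle_den. apply (continuous_plus (fun r => (p - 1) * _)); [|easy].
    now apply (continuous_mult (fun _ => p - 1)); [apply continuous_const|].
Qed.

Definition log_radius r := RInt log_radius_rate 1 r.

Lemma log_radius_derive r : 0 < r -> is_derive log_radius r (log_radius_rate r).
Proof.
  intros Hr. apply (is_derive_RInt log_radius_rate _ 1).
  - exists (mkposreal r Hr). intros s Hs. unfold ball in Hs; simpl in Hs.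
    unfold AbsRing_ball, abs, minus, plus, opp in Hs; simpl in Hs.
    apply Rabs_lt_between in Hs.
    apply (RInt_correct (V := R_CompleteNormedModule)).
    apply (ex_RInt_continuous (V := R_CompleteNormedModule)). intros z Hz.
    apply log_radius_rate_continuous.
    revert Hz. unfold Rmin. destruct (Rle_dec 1 s); lra.
  - now apply log_radius_rate_continuous.
Qed.

Definition flow_u r := exp (log_radius r / p) * cos (b r).
Definition flow_y r := - exp (log_radius r / conj_exp p) * sin (b r).

Lemma flow_u_derive r : 0 < r -> is_derive flow_u r (phi (conj_exp p) (flow_y r)).
Proof.
  intros Hr. pose proof (conj_exp_bounds p Hp). pose proof (angle_den_ge1 p (b r) Hp).
  pose proof (log_radius_derive r Hr) as Hl. pose proof (proj1 Hb r Hr) as Hd.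
  unfold flow_u, flow_y.
  rewrite <- Ropp_mult_distr_l, phi_opp, phi_exp_mult.
  (* The weights fit because (p' - 1) / p' = 1/p. *)
  replace ((conj_exp p - 1) * (log_radius r / conj_exp p)) with (log_radius r / p).
  2:{ unfold conj_exp. field. lra. }
  auto_derive; [repeat split; first [exact I | now exists (log_radius_rate r) | now exists (angle_field p r (b r))]|].
  eval_derive.
  unfold log_radius_rate, angle_field, angle_drag, angle_num.
  rewrite <- (phi_mul_id (conj_exp p)), <- (phi_mul_id p).
  change (log_radius r * / p) with (log_radius r / p).
  set (E := exp (log_radius r / p)). set (s := sin (b r)) in *. set (c := cos (b r)) in *.
  set (f := phi (conj_exp p) s). set (g := phi p c).
  assert (HN : angle_den p (b r) = (p - 1) * s ^ 2 + c ^ 2) by easy.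
  set (N := angle_den p (b r)) in *.
  replace (- (E * f)) with (- (E * f * N) / N) by (field; lra).
  rewrite HN at 4. field. lra.
Qed.

Lemma flow_y_derive r : 0 < r -> is_derive flow_y r (- 1 * phi p (flow_u r) - flow_y r / r).
Proof.
  intros Hr. pose proof (conj_exp_bounds p Hp). pose proof (angle_den_ge1 p (b r) Hp).
  pose proof (log_radius_derive r Hr) as Hl. pose proof (proj1 Hb r Hr) as Hd.
  unfold flow_u, flow_y.
  rewrite phi_exp_mult.
  replace ((p - 1) * (log_radius r / p)) with (log_radius r / conj_exp p).
  2:{ unfold conj_exp. field. lra. }
  auto_derive; [repeat split; first [exact I | now exists (log_radius_rate r) | now exists (angle_field p r (b r))]|].
  eval_derive.
  unfold log_radius_rate, angle_field, angle_drag, angle_num.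
  rewrite <- (phi_mul_id (conj_exp p)), <- (phi_mul_id p).
  change (log_radius r * / conj_exp p) with (log_radius r / conj_exp p).
  set (E := exp (log_radius r / conj_exp p)). set (s := sin (b r)) in *. set (c := cos (b r)) in *.
  set (f := phi (conj_exp p) s). set (g := phi p c).
  assert (HN : angle_den p (b r) = (p - 1) * s ^ 2 + c ^ 2) by easy.
  set (N := angle_den p (b r)) in *.
  replace (/ conj_exp p) with ((p - 1) / p) by (unfold conj_exp; field; lra).
  replace (-1 * (E * g) - - E * s / r) with ((-1 * (E * g) - - E * s / r) * N / N) by (field; lra).
  rewrite HN at 4. field. lra.
Qed.

Lemma sin_le_id x : 0 <= x -> Rabs (sin x) <= x.
Proof. intros. pose proof (sin_lip x 0) as HS. rewrite sin_0, !Rminus_0_r, (Rabs_pos_eq x) in HS; lra. Qed.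

(** In the wedge sin^2 b / r stays bounded, so log rho is bounded above as r tends to 0, while |sin
    b| <= p r. This makes the extension of Y by 0 continuous at the origin. *)
Lemma flow_y_small : exists C r1, 0 < r1 /\ 0 <= C /\ forall r, 0 < r <= r1 -> Rabs (flow_y r) <= C * r.
Proof.
  set (r1 := / (2 * p * p)). assert (Hr1 : 0 < r1) by (apply Rinv_0_lt_compat; nra).
  pose proof (conj_exp_bounds p Hp).
  assert (Hrate : forall r, 0 < r <= r1 -> Rabs (log_radius_rate r) <= p * (2 + p * p)).
  { intros r Hr. unfold log_radius_rate.
    pose proof (angle_den_ge1 p (b r) Hp). pose proof (proj2 Hb r ltac:(unfold r1 in Hr; lra)) as Hbr.
    assert (r1 <= 1) by (unfold r1; rewrite <- Rinv_1; apply Rinv_le_contravar; nra).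
    unfold Rdiv. rewrite Rabs_mult.
    assert (0 < / angle_den p (b r) <= 1).
    { split; [apply Rinv_0_lt_compat; lra|]. rewrite <- Rinv_1. apply Rinv_le_contravar; lra. }
    rewrite (Rabs_pos_eq (/ angle_den p (b r))) by lra.
    rewrite Rabs_mult, (Rabs_pos_eq p) by lra.
    set (s := sin (b r)). set (c := cos (b r)).
    assert (Hs : Rabs s <= p * r) by (eapply Rle_trans; [apply sin_le_id; lra|lra]).
    assert (HX : Rabs (- phi (conj_exp p) s * c + phi p c * s - s ^ 2 * / r) <= 2 + p * p).
    { unfold Rminus. eapply Rle_trans; [apply Rabs_triang|].
      eapply Rle_trans; [apply Rplus_le_compat_r, Rabs_triang|].
      rewrite !Rabs_mult, !Rabs_Ropp, !Rabs_mult, !phi_abs.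
      pose proof (sin_abs_le1 (b r)) as S1. pose proof (cos_abs_le1 (b r)) as C1. fold s in S1. fold c in C1.
      pose proof (powp_le_1 (Rabs s) (conj_exp p - 1) S1 ltac:(lra)).
      pose proof (powp_le_1 (Rabs c) (p - 1) C1 ltac:(lra)).
      pose proof (powp_ge0 (Rabs s) (conj_exp p - 1)). pose proof (powp_ge0 (Rabs c) (p - 1)).
      rewrite (Rabs_pos_eq (/ r)) by (left; apply Rinv_0_lt_compat; lra).
      rewrite <- RPow_abs.
      assert (Rabs s ^ 2 * / r <= p * p).
      { apply Rmult_le_reg_r with r; [lra|]. rewrite Rmult_assoc, Rinv_l by lra. nra. }
      assert (powp (Rabs s) (conj_exp p - 1) * Rabs c <= 1) by nra.
      assert (powp (Rabs c) (p - 1) * Rabs s <= 1) by nra. lra. }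
    set (X := Rabs (- phi (conj_exp p) s * c + phi p c * s - s ^ 2 * / r)) in *.
    assert (0 <= X) by apply Rabs_pos.
    rewrite <- (Rmult_1_r (p * (2 + p * p))).
    apply Rmult_le_compat; [apply Rmult_le_pos; lra|lra|apply Rmult_le_compat_l; lra|lra]. }
  set (M := p * (2 + p * p) * r1 + Rabs (log_radius r1)).
  assert (Hlog : forall r, 0 < r <= r1 -> log_radius r <= M).
  { intros r Hr. destruct (Req_dec r r1) as [->|Hne].
    - unfold M. pose proof (Rle_abs (log_radius r1)). assert (0 <= p * (2 + p * p) * r1) by (apply Rmult_le_pos; nra). lra.
    - destruct (mean_value log_radius log_radius_rate r r1) as [c [Hc E]]; [lra| | |].
      + intros; apply log_radius_derive; lra.
      + intros; eapply is_derive_continuous, log_radius_derive; lra.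
      + specialize (Hrate c ltac:(lra)). apply Rabs_le_between in Hrate.
        pose proof (Rle_abs (log_radius r1)). unfold M. nra. }
  exists (exp (Rabs M) * p), r1. split; [easy|]. split; [apply Rmult_le_pos; [left; apply exp_pos|lra]|].
  intros r Hr. unfold flow_y. rewrite Rabs_mult, Rabs_Ropp.
  rewrite (Rabs_pos_eq (exp _)) by (left; apply exp_pos). rewrite Rmult_assoc.
  apply Rmult_le_compat; [left; apply exp_pos|apply Rabs_pos| |].
  - assert (log_radius r / conj_exp p <= Rabs M).
    { specialize (Hlog r Hr). pose proof (Rle_abs M). pose proof (Rabs_pos M).
      apply Rmult_le_reg_r with (conj_exp p); [lra|]. unfold Rdiv. rewrite Rmult_assoc, Rinv_l by lra. nra. }
    destruct H0 as [H0|H0]; [left; now apply exp_increasing|rewrite H0; lra].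
  - pose proof (proj2 Hb r ltac:(unfold r1 in Hr; lra)) as Hbr.
    eapply Rle_trans; [apply sin_le_id; lra|lra].
Qed.

(** Y is extended by 0 to r <= 0 and U is the integral of phi_{p'}(Y) over the line: an
    eigenfunction has to be C^1 on all of R, in particular at 0. The positive factors A and B keep
    the link between the signs of U, Y and the angle. *)
Lemma radial_flow_exists : exists U Y, (forall R, radial_flow p 1 R U Y) /\
  forall r, 0 < r -> exists A B, 0 < A /\ 0 < B /\ U r = A * cos (b r) /\ Y r = - B * sin (b r).
Proof.
  pose proof (conj_exp_bounds p Hp).
  set (Y := fun r => if Rlt_dec 0 r then flow_y r else 0).
  assert (HYp : forall r, 0 < r -> Y r = flow_y r).
  { intros r Hr. unfold Y. destruct (Rlt_dec 0 r); [easy|lra]. }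
  assert (HYn : forall r, r <= 0 -> Y r = 0).
  { intros r Hr. unfold Y. destruct (Rlt_dec 0 r); [lra|easy]. }
  assert (Hnear : forall r, 0 < r -> locally r (fun s => 0 < s)).
  { intros r Hr. exists (mkposreal r Hr). intros s Hs. unfold ball in Hs; simpl in Hs.
    unfold AbsRing_ball, abs, minus, plus, opp in Hs; simpl in Hs.
    apply Rabs_lt_between in Hs. lra. }
  assert (HYd : forall r, 0 < r -> is_derive Y r (- 1 * phi p (flow_u r) - flow_y r / r)).
  { intros r Hr. apply (is_derive_ext_loc flow_y); [|now apply flow_y_derive].
    apply (filter_imp (fun s => 0 < s)); [|now apply Hnear]. intros. now rewrite HYp. }
  assert (HYc : forall r, continuous Y r).
  { intros r. destruct (Rtotal_order r 0) as [Hr|[->|Hr]].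
    - apply (continuous_ext_loc _ (fun _ => 0)); [|apply continuous_const].
      assert (Hr' : 0 < - r) by lra. exists (mkposreal _ Hr'). intros s Hs.
      unfold ball in Hs; simpl in Hs. unfold AbsRing_ball, abs, minus, plus, opp in Hs; simpl in Hs.
      apply Rabs_lt_between in Hs. rewrite HYn; lra.
    - destruct flow_y_small as [C [r1 [Hr1 [HC Hs]]]].
      apply continuity_pt_filterlim. intros e He.
      exists (Rmin r1 (e / (C + 1))). split; [apply Rmin_glb_lt; [easy|apply Rdiv_lt_0_compat; lra]|].
      intros s [_ Hse]. simpl in *. unfold Rdist in *. rewrite Rminus_0_r in Hse.
      rewrite (HYn 0), Rminus_0_r by lra.
      destruct (Rle_dec s 0); [rewrite HYn, Rabs_R0; lra|].
      rewrite Rabs_pos_eq in Hse by lra. rewrite HYp by lra.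
      pose proof (Rmin_l r1 (e / (C + 1))). pose proof (Rmin_r r1 (e / (C + 1))).
      specialize (Hs s ltac:(lra)). eapply Rle_lt_trans; [apply Hs|].
      assert ((C + 1) * s < e); [|nra].
      replace e with ((C + 1) * (e / (C + 1))) by (field; lra). apply Rmult_lt_compat_l; lra.
    - eapply is_derive_continuous. now apply HYd. }
  set (g := fun r => phi (conj_exp p) (Y r)).
  assert (Hg : forall r, continuous g r).
  { intros r. apply (continuous_comp Y (phi (conj_exp p))); [apply HYc|apply phi_continuous; lra]. }
  set (U := fun r => flow_u 1 + RInt g 1 r).
  assert (HU : forall r, is_derive U r (g r)).
  { intros r. replace (g r) with (0 + g r) by ring.
    apply (is_derive_plus (fun _ => flow_u 1)); [exact (is_derive_const (flow_u 1) r)|].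
    apply (is_derive_RInt g _ 1); [|apply Hg].
    exists (mkposreal 1 Rlt_0_1). intros y _. apply (RInt_correct (V := R_CompleteNormedModule)).
    apply (ex_RInt_continuous (V := R_CompleteNormedModule)). intros z _. apply Hg. }
  assert (HUu : forall r, 0 < r -> U r = flow_u r).
  { intros r Hr.
    assert (Hc : forall s t, 0 < s -> s <= t -> flow_u s - U s = flow_u t - U t).
    { intros s t Hs Hst. apply (deriv_zero_eq (fun r => flow_u r - U r)); [easy| |].
      - intros x Hx. replace 0 with (phi (conj_exp p) (flow_y x) - g x).
        + apply (is_derive_minus flow_u U); [apply flow_u_derive; lra|apply HU].
        + unfold g. rewrite HYp by lra. ring.
      - intros x Hx. apply (continuous_minus flow_u U).
        + eapply is_derive_continuous, flow_u_derive; lra.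
        + eapply is_derive_continuous, HU. }
    assert (H1 : U 1 = flow_u 1).
    { unfold U. rewrite RInt_point. apply Rplus_0_r. }
    destruct (Rle_dec r 1).
    - specialize (Hc r 1 Hr ltac:(lra)). lra.
    - specialize (Hc 1 r ltac:(lra) ltac:(lra)). lra. }
  exists U, Y. split.
  - intros R. split; [exact HU|]. split; [exact HYc|]. split; [apply HYn; lra|].
    intros r Hr. rewrite HUu, HYp by lra. apply HYd; lra.
  - intros r Hr. exists (exp (log_radius r / p)), (exp (log_radius r / conj_exp p)).
    split; [apply exp_pos|]. split; [apply exp_pos|]. split; [now apply HUu|now apply HYp].
Qed.
End Existence.

Lemma powp_eq0 x q : powp x q = 0 -> x = 0.
Proof. intros H. destruct (Req_dec x 0) as [|Hn]; [easy|]. now apply (powp_neq0 x q) in Hn. Qed.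

Lemma abs_eq0 x : Rabs x = 0 -> x = 0.
Proof. intros H. destruct (Req_dec x 0) as [|Hn]; [easy|]. now apply Rabs_no_R0 in Hn. Qed.

Lemma flow_u_continuous p mu R U Y r : radial_flow p mu R U Y -> continuous U r.
Proof. intros [H _]. eapply is_derive_continuous, H. Qed.

(** Dilation by a multiplies the eigenvalue by a^p and amplitude is free. Taking a equal to a zero
    of U moves that zero to 1. *)
Lemma flow_scale p mu R U Y a c : 2 <= p -> 0 < a -> radial_flow p mu R U Y ->
  radial_flow p (mu * powp a p) (R / a) (fun r => c * U (a * r)) (fun r => phi p (c * a) * Y (a * r)).
Proof.
  intros Hp Ha [HU [HYc [HY0 HY]]]. pose proof (conj_exp_inv p Hp) as Hq.
  split; [|split; [|split]].
  - intros r. rewrite phi_mult, phi_inv by lra.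
    specialize (HU (a * r)). auto_derive; [now eexists; exact HU|].
    eval_derive. ring.
  - intros r. apply (continuous_mult (fun _ => phi p (c * a))); [apply continuous_const|].
    apply (continuous_comp (fun r => a * r) Y); [|apply HYc].
    apply is_derive_continuous with a. auto_derive; auto. ring.
  - rewrite Rmult_0_r, HY0. ring.
  - intros r Hr. assert (Har : 0 < a * r < R).
    { destruct Hr as [Hr1 Hr2]. split; [nra|]. apply (Rmult_lt_compat_l a) in Hr2; [|easy].
      replace (a * (R / a)) with R in Hr2 by (field; lra). easy. }
    specialize (HY (a * r) Har). auto_derive; [now eexists; exact HY|].
    eval_derive.
    replace (powp a p) with (phi p a * a) by (rewrite phi_mul_id, Rabs_pos_eq; lra).
    rewrite !phi_mult. field. lra.
Qed.

Lemma radial_eig_flow p mu : 2 <= p -> radial_eig p mu ->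
  exists U Y, radial_flow p mu 1 U Y /\ U 1 = 0 /\ exists r, 0 <= r <= 1 /\ U r <> 0.
Proof.
  intros Hp [u [Hex [Hdc [Heq [H0 [H1 Hn]]]]]].
  pose proof (conj_exp_inv p Hp) as Hq.
  exists u, (fun r => phi p (Derive u r)). split; [|easy].
  split; [|split; [|split]].
  - intros r. rewrite phi_inv by lra. now apply Derive_correct.
  - intros r. apply (continuous_comp (Derive u) (phi p)); [apply Hdc|apply phi_continuous; lra].
  - now rewrite H0, phi_0.
  - intros r Hr. destruct (Heq r Hr) as [Hw Hv].
    apply Derive_correct in Hw.
    set (w := fun s => s * powp (Rabs (Derive u s)) (p - 2) * Derive u s) in *.
    (* Differentiability is given for the flux r phi_p(u') only; dividing by s recovers it for Y
       away from the origin. *)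
    apply (is_derive_ext_loc (fun s => w s / s)).
    + exists (mkposreal r (proj1 Hr)). intros s Hs. unfold ball in Hs; simpl in Hs.
      unfold AbsRing_ball, abs, minus, plus, opp in Hs; simpl in Hs.
      apply Rabs_lt_between in Hs. unfold w, phi. match goal with |- ?a = ?b => change (@eq R a b) end. field. lra.
    + auto_derive; [split; [now eexists; exact Hw|lra]|].
      replace (Derive (fun x => w x) r) with (- (mu * r * powp (Rabs (u r)) (p - 2) * u r))
        by (rewrite <- Hv; change (Derive (fun x => w x) r) with (Derive w r); ring).
      unfold w, phi. field. lra.
Qed.

Lemma flow_radial_eig p mu R U Y : 2 <= p -> 1 <= R -> radial_flow p mu R U Y -> U 1 = 0 ->
  (exists r, 0 <= r <= 1 /\ U r <> 0) -> radial_eig p mu.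
Proof.
  intros Hp HR [HU [HYc [HY0 HY]]] H1 Hn. pose proof (conj_exp_inv p Hp) as Hq.
  pose proof (conj_exp_bounds p Hp).
  assert (HD : forall r, Derive U r = phi (conj_exp p) (Y r)) by (intros; now apply is_derive_unique).
  assert (HP : forall r, powp (Rabs (Derive U r)) (p - 2) * Derive U r = Y r).
  { intros r. rewrite HD. fold (phi p (phi (conj_exp p) (Y r))). apply phi_inv; lra. }
  exists U. split; [intros r; eexists; apply HU|]. split; [|split; [|split; [|easy]]].
  - intros r. apply (continuous_ext (fun r => phi (conj_exp p) (Y r))); [intros; now rewrite HD|].
    apply (continuous_comp Y (phi (conj_exp p))); [apply HYc|apply phi_continuous; lra].
  - intros r Hr. specialize (HY r ltac:(lra)).
    assert (Hd : is_derive (fun s => s * powp (Rabs (Derive U s)) (p - 2) * Derive U s) r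
       (- (mu * r * phi p (U r)))).
    { apply (is_derive_ext (fun s => s * Y s)).
      - intros s. rewrite Rmult_assoc, HP. easy.
      - auto_derive; [now eexists; exact HY|].
        eval_derive. field. lra. }
    split; [now eexists; exact Hd|]. 
    apply is_derive_unique in Hd.
    match goal with |- - Derive ?f r = _ => replace (Derive f r) with (- (mu * r * phi p (U r))) end.
    unfold phi. ring.
  - now rewrite HD, HY0, phi_0.
Qed.

(** Testing with u: (r Y U)' = r (|Y|^p' - mu |U|^p), which is nonnegative if mu <= 0. Since r Y U
    vanishes at both ends, Y = 0, so U is constant and equal to U 1 = 0. *)
Lemma flow_eigenvalue_pos p mu U Y : 2 <= p -> radial_flow p mu 1 U Y -> U 1 = 0 ->
  (exists r, 0 <= r <= 1 /\ U r <> 0) -> 0 < mu.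
Proof.
  intros Hp HF H1 [r0 [Hr0 Hn]]. pose proof (conj_exp_bounds p Hp).
  destruct (Rlt_dec 0 mu) as [|Hmu]; [easy|exfalso].
  destruct HF as [HU [HYc [HY0 HY]]].
  set (f := fun r => r * Y r * U r).
  set (df := fun r => r * (powp (Rabs (Y r)) (conj_exp p) - mu * powp (Rabs (U r)) p)).
  assert (Hf : forall r, 0 < r < 1 -> is_derive f r (df r)).
  { intros r Hr. specialize (HY r Hr). specialize (HU r). unfold f, df.
    auto_derive; [repeat split; first [exact I | now eexists; exact HY | now eexists; exact HU]|].
    eval_derive.
    rewrite <- !phi_mul_id. field. lra. }
  assert (Hfc : forall r, continuous f r).
  { intros r. apply (continuous_mult (fun r => r * Y r) U).
    - apply (continuous_mult (fun r => r) Y); [apply continuous_id|apply HYc].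
    - eapply is_derive_continuous, HU. }
  assert (Hdf : forall r, 0 < r < 1 -> 0 <= df r).
  { intros r Hr. apply Rmult_le_pos; [lra|].
    pose proof (powp_ge0 (Rabs (Y r)) (conj_exp p)). pose proof (powp_ge0 (Rabs (U r)) p). nra. }
  assert (Hmono : forall a b, 0 <= a -> a <= b -> b <= 1 -> f a <= f b).
  { intros a b Ha Hab Hb. apply (deriv_nonneg_le f df); auto; intros; [apply Hf|apply Hdf]; lra. }
  assert (HYz : forall c, 0 < c < 1 -> Y c = 0).
  { intros c Hc. destruct (Req_dec (Y c) 0) as [|HYc0]; [easy|exfalso].
    destruct (is_derive_pos_locally f c (df c) (Hf c Hc)) as [d [Hd [Hp1 _]]].
    { apply Rmult_lt_0_compat; [lra|].
      pose proof (powp_gt0 (Rabs (Y c)) (conj_exp p) (Rabs_pos_lt _ HYc0)).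
      pose proof (powp_ge0 (Rabs (U c)) p). nra. }
    set (t := c + Rmin (d / 2) (1 - c)).
    assert (0 < Rmin (d / 2) (1 - c)) by (apply Rmin_glb_lt; lra).
    pose proof (Rmin_l (d / 2) (1 - c)). pose proof (Rmin_r (d / 2) (1 - c)).
    specialize (Hp1 t ltac:(unfold t; lra)).
    pose proof (Hmono 0 c ltac:(lra) ltac:(lra) ltac:(lra)).
    pose proof (Hmono t 1 ltac:(unfold t; lra) ltac:(unfold t; lra) ltac:(lra)).
    assert (f 0 = 0) by (unfold f; ring). assert (f 1 = 0) by (unfold f; rewrite H1; ring). lra. }
  apply Hn. rewrite <- H1. apply (deriv_zero_eq U); [lra| |].
  - intros t Ht. specialize (HU t). now rewrite HYz, phi_0 in HU by lra.
  - intros t Ht. eapply is_derive_continuous, HU.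
Qed.

(** The Hamiltonian of the system without the friction term Y / r. Friction makes it nonincreasing,
    and r^2 times it is nondecreasing. *)
Definition energy p (U Y : R -> R) r :=
  powp (Rabs (Y r)) (conj_exp p) / conj_exp p + powp (Rabs (U r)) p / p.

Lemma energy_derive p R U Y r : 2 <= p -> radial_flow p 1 R U Y -> 0 < r < R ->
  is_derive (energy p U Y) r (- powp (Rabs (Y r)) (conj_exp p) / r).
Proof.
  intros Hp [HU [_ [_ HY]]] Hr. pose proof (conj_exp_bounds p Hp).
  specialize (HU r). specialize (HY r Hr). unfold energy.
  pose proof (is_derive_comp (fun y => powp (Rabs y) (conj_exp p)) Y r _ _
    (is_derive_powp (conj_exp p) (Y r) ltac:(lra)) HY) as D1.
  pose proof (is_derive_comp (fun y => powp (Rabs y) p) U r _ _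
    (is_derive_powp p (U r) ltac:(lra)) HU) as D2.
  unfold scal in D1, D2; simpl in D1, D2; unfold mult in D1, D2; simpl in D1, D2.
  set (f := fun x => powp (Rabs (Y x)) (conj_exp p)) in *.
  set (g := fun x => powp (Rabs (U x)) p) in *.
  apply (is_derive_ext (fun r => f r / conj_exp p + g r / p)); [easy|].
  change (powp (Rabs (Y r)) (conj_exp p)) with (f r).
  auto_derive; [repeat split; first [exact I | now eexists; exact D1 | now eexists; exact D2]|].
  eval_derive.
  unfold f. rewrite <- phi_mul_id. field. lra.
Qed.

Lemma energy_continuous p R U Y r : 2 <= p -> radial_flow p 1 R U Y -> continuous (energy p U Y) r.
Proof.
  intros Hp HF. pose proof (conj_exp_bounds p Hp).
  unfold energy, Rdiv.
  apply (continuous_plus (fun r => powp (Rabs (Y r)) (conj_exp p) * _) (fun r => powp (Rabs (U r)) p * _)).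
  - apply (continuous_mult _ (fun _ => / conj_exp p)); [|apply continuous_const].
    apply (continuous_comp Y (fun y => powp (Rabs y) (conj_exp p))); [apply HF|apply powp_continuous; lra].
  - apply (continuous_mult _ (fun _ => / p)); [|apply continuous_const].
    apply (continuous_comp U (fun y => powp (Rabs y) p)); [eapply flow_u_continuous, HF|apply powp_continuous; lra].
Qed.

Lemma energy_ge0 p U Y r : 2 <= p -> 0 <= energy p U Y r.
Proof.
  intros Hp. pose proof (conj_exp_bounds p Hp). unfold energy.
  apply Rplus_le_le_0_compat; apply Rdiv_le_0_compat; try lra; apply powp_ge0.
Qed.

Lemma energy_zero p U Y r : 2 <= p -> energy p U Y r = 0 -> U r = 0 /\ Y r = 0.
Proof.
  intros Hp H. pose proof (conj_exp_bounds p Hp). unfold energy in H.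
  pose proof (powp_ge0 (Rabs (Y r)) (conj_exp p)) as A. pose proof (powp_ge0 (Rabs (U r)) p) as B.
  assert (A1 : 0 <= powp (Rabs (Y r)) (conj_exp p) / conj_exp p) by (apply Rdiv_le_0_compat; lra).
  assert (B1 : 0 <= powp (Rabs (U r)) p / p) by (apply Rdiv_le_0_compat; lra).
  split.
  - apply abs_eq0. apply (powp_eq0 _ p).
    apply Rmult_eq_reg_r with (/ p); [|apply Rinv_neq_0_compat; lra]. unfold Rdiv in *. lra.
  - apply abs_eq0. apply (powp_eq0 _ (conj_exp p)).
    apply Rmult_eq_reg_r with (/ conj_exp p); [|apply Rinv_neq_0_compat; lra]. unfold Rdiv in *. lra.
Qed.

(** If U 0 = 0 the energy starts at 0 and cannot increase, so U vanishes identically. *)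
Lemma flow_start_nonzero p R U Y : 2 <= p -> radial_flow p 1 R U Y ->
  (exists r, 0 <= r <= R /\ U r <> 0) -> U 0 <> 0.
Proof.
  intros Hp HF [r [Hr Hn]] H0. pose proof (conj_exp_bounds p Hp).
  apply Hn. apply (energy_zero p U Y r Hp).
  apply Rle_antisym; [|now apply energy_ge0].
  replace 0 with (energy p U Y 0).
  - apply (deriv_nonpos_le (energy p U Y) (fun r => - powp (Rabs (Y r)) (conj_exp p) / r)); [lra| | |].
    + intros t Ht. apply (energy_derive p R); auto; lra.
    + intros t Ht. unfold Rdiv. rewrite <- Ropp_mult_distr_l.
      pose proof (powp_ge0 (Rabs (Y t)) (conj_exp p)).
      assert (0 < / t) by (apply Rinv_0_lt_compat; lra). nra.
    + intros t _. now apply (energy_continuous p R).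
  - unfold energy. destruct HF as [_ [_ [-> _]]]. rewrite H0, Rabs_R0, !powp_0. lra.
Qed.

(** The derivative of r^2 E is r (2 E - |Y|^p'), nonnegative because p' <= 2. So E cannot reach 0
    after having been positive near the origin, and U and Y have no common zero. *)
Lemma flow_nonzero p R U Y s : 2 <= p -> radial_flow p 1 R U Y -> U 0 <> 0 -> 0 <= s < R ->
  U s = 0 -> Y s <> 0.
Proof.
  intros Hp HF H0 Hs HUs HYs. pose proof (conj_exp_bounds p Hp).
  destruct (Req_dec s 0) as [->|Hs0]; [easy|].
  destruct (continuous_eps U 0 (Rabs (U 0)) (flow_u_continuous _ _ _ _ _ _ HF) (Rabs_pos_lt _ H0)) as [d [Hd Hc]].
  set (r := Rmin (d / 2) s).
  assert (0 < r) by (apply Rmin_glb_lt; lra).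
  assert (r <= d / 2) by apply Rmin_l. assert (r <= s) by apply Rmin_r.
  assert (HUr : U r <> 0).
  { specialize (Hc r ltac:(rewrite Rminus_0_r, Rabs_pos_eq; lra)). intros E. rewrite E in Hc.
    rewrite Rminus_0_l, Rabs_Ropp in Hc. lra. }
  assert (HE : energy p U Y r * (r * r) <= energy p U Y s * (s * s)).
  { apply (deriv_nonneg_le (fun t => energy p U Y t * (t * t))
      (fun t => t * (2 * energy p U Y t - powp (Rabs (Y t)) (conj_exp p)))); [lra| | |].
    - intros t Ht. pose proof (energy_derive p R U Y t Hp HF ltac:(lra)) as D.
      auto_derive; [now eexists; exact D|].
      replace (Derive (fun x => energy p U Y x) t) with (- powp (Rabs (Y t)) (conj_exp p) / t)
        by (symmetry; now apply is_derive_unique). field. lra.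
    - intros t Ht. apply Rmult_le_pos; [lra|]. unfold energy.
      pose proof (powp_ge0 (Rabs (Y t)) (conj_exp p)) as A. pose proof (powp_ge0 (Rabs (U t)) p) as B.
      assert (0 <= powp (Rabs (U t)) p / p) by (apply Rdiv_le_0_compat; lra).
      assert (powp (Rabs (Y t)) (conj_exp p) / 2 <= powp (Rabs (Y t)) (conj_exp p) / conj_exp p).
      { apply Rmult_le_compat_l; [easy|]. apply Rinv_le_contravar; lra. }
      lra.
    - intros t _. apply (continuous_mult (energy p U Y)); [now apply (energy_continuous p R)|].
      apply is_derive_continuous with (2 * t). auto_derive; auto. ring. }
  assert (Es : energy p U Y s = 0).
  { unfold energy. rewrite HUs, HYs, Rabs_R0, !powp_0. lra. }
  rewrite Es, Rmult_0_l in HE.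
  apply HUr. apply (energy_zero p U Y r Hp). pose proof (energy_ge0 p U Y r Hp).
  assert (0 < r * r) by nra. nra.
Qed.

(** * Uniqueness for the radial equation *)

Lemma between_abs_le x y c B : Rabs x <= B -> Rabs y <= B -> Rmin x y <= c <= Rmax x y -> Rabs c <= B.
Proof.
  intros Hx Hy. apply Rabs_le_between in Hx, Hy. intros Hc. apply Rabs_le_between.
  revert Hc. unfold Rmin, Rmax. destruct (Rle_dec x y); lra.
Qed.

Lemma powp_abs_lip q B x y : 1 < q -> Rabs x <= B -> Rabs y <= B ->
  Rabs (powp (Rabs x) q - powp (Rabs y) q) <= q * powp B (q - 1) * Rabs (x - y).
Proof.
  intros Hq Hx Hy.
  destruct (MVT_gen (fun x => powp (Rabs x) q) y x (fun x => q * phi q x)) as [c [Hc E]].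
  - intros; now apply is_derive_powp.
  - intros; apply continuity_pt_filterlim, powp_continuous; lra.
  - rewrite E, Rabs_mult. apply Rmult_le_compat_r; [apply Rabs_pos|].
    rewrite Rabs_mult, phi_abs, (Rabs_pos_eq q) by lra. apply Rmult_le_compat_l; [lra|].
    apply powp_le; [|lra]. split; [apply Rabs_pos|]. now apply (between_abs_le y x).
Qed.

Lemma phi_lip_unit p x y : 2 <= p -> Rabs x <= 1 -> Rabs y <= 1 ->
  Rabs (phi p x - phi p y) <= (p - 1) * Rabs (x - y).
Proof.
  intros Hp.
  assert (G : forall x y, 0 <= x <= 1 -> Rabs y <= 1 -> Rabs (phi p x - phi p y) <= (p - 1) * Rabs (x - y)).
  { clear x y. intros x y Hx Hy. apply Rabs_le_between in Hy. destruct (Rle_dec 0 y).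
    - rewrite !phi_powp by lra. apply powp_lip; lra.
    - replace y with (- - y) by ring. rewrite phi_opp, !phi_powp by lra.
      replace (powp x (p - 1) - - powp (- y) (p - 1)) with (powp x (p - 1) + powp (- y) (p - 1)) by ring.
      pose proof (powp_ge0 x (p - 1)). pose proof (powp_ge0 (- y) (p - 1)).
      pose proof (powp_le_exp x 1 (p - 1) ltac:(lra) ltac:(lra)) as Hx1.
      pose proof (powp_le_exp (- y) 1 (p - 1) ltac:(lra) ltac:(lra)) as Hy1.
      rewrite powp_1r in Hx1, Hy1 by lra.
      rewrite !Rabs_pos_eq by lra. nra. }
  intros Hx Hy. destruct (Rle_dec 0 x).
  - apply G; [|easy]. apply Rabs_le_between in Hx. lra.
  - replace (phi p x - phi p y) with (- (phi p (- x) - phi p (- y))) by (rewrite !phi_opp; ring).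
    replace (x - y) with (- (- x - - y)) by ring. rewrite !Rabs_Ropp.
    apply G; [|now rewrite Rabs_Ropp]. apply Rabs_le_between in Hx. lra.
Qed.

(** For q <= 2 the slope (q - 1) c^(q-2) is nonincreasing in c > 0, so its value at m bounds it; at
    0 there is no such bound when q < 2. *)
Lemma phi_lip_away q m x y : 1 < q <= 2 -> 0 < m -> m <= x -> m <= y ->
  Rabs (phi q x - phi q y) <= (q - 1) * powp m (q - 2) * Rabs (x - y).
Proof.
  intros Hq Hm Hx Hy.
  assert (Hb : forall c, Rmin y x <= c -> m <= c).
  { intros c. unfold Rmin. destruct (Rle_dec y x); lra. }
  destruct (MVT_gen (phi q) y x (fun c => (q - 1) * powp (Rabs c) (q - 2))) as [c [Hc E]].
  - intros c Hc. apply is_derive_phi. specialize (Hb c). lra.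
  - intros c Hc. apply continuity_pt_filterlim, phi_continuous; lra.
  - rewrite E, Rabs_mult. apply Rmult_le_compat_r; [apply Rabs_pos|].
    specialize (Hb c (proj1 Hc)).
    rewrite Rabs_mult, (Rabs_pos_eq (q - 1)), (Rabs_pos_eq c), (Rabs_pos_eq (powp _ _))
      by (try lra; apply powp_ge0).
    apply Rmult_le_compat_l; [lra|].
    replace (q - 2) with (- (2 - q)) by ring. rewrite !powp_inv by lra.
    apply Rinv_le_contravar; [apply powp_gt0; lra|]. apply powp_le; lra.
Qed.

Lemma phi_lip_near q a x y : 1 < q <= 2 -> a <> 0 -> Rabs (x - a) < Rabs a / 2 -> Rabs (y - a) < Rabs a / 2 ->
  Rabs (phi q x - phi q y) <= (q - 1) * powp (Rabs a / 2) (q - 2) * Rabs (x - y).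
Proof.
  intros Hq Ha Hx Hy. apply Rabs_lt_between in Hx, Hy.
  destruct (Rle_dec 0 a).
  - rewrite (Rabs_pos_eq a) in * by lra. apply phi_lip_away; lra.
  - rewrite (Rabs_left a) in * by lra.
    replace (phi q x - phi q y) with (- (phi q (- x) - phi q (- y))) by (rewrite !phi_opp; ring).
    replace (x - y) with (- (- x - - y)) by ring. rewrite !Rabs_Ropp.
    apply phi_lip_away; lra.
Qed.

Section Uniqueness.
Variables (p b : R) (U Y V Z : R -> R).
Hypothesis Hp : 2 <= p.
Hypothesis HF : radial_flow p 1 b U Y.
Hypothesis HG : radial_flow p 1 b V Z.

(* The Riccati variable Y / phi_p(U) solves a scalar equation that is locally Lipschitz,
   also where Y vanishes and the system itself is not. *)
Lemma riccati_derive (X W : R -> R) r : radial_flow p 1 b X W -> 0 < r < b -> X r <> 0 ->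
  is_derive (fun r => W r / phi p (X r)) r
    (- 1 - W r / phi p (X r) / r - (p - 1) * powp (Rabs (W r / phi p (X r))) (conj_exp p)).
Proof.
  intros [HX [_ [_ HW]]] Hr Hn. pose proof (conj_exp_bounds p Hp). pose proof (conj_exp_inv p Hp).
  specialize (HX r). specialize (HW r Hr). pose proof (phi_neq0 p _ Hn) as Hphi.
  pose proof (is_derive_comp (phi p) X r _ _ (is_derive_phi p (X r) Hn) HX) as D.
  unfold scal in D; simpl in D; unfold mult in D; simpl in D.
  set (g := fun x => phi p (X x)) in *.
  assert (Hq : phi (conj_exp p) (W r) = phi (conj_exp p) (W r / g r) * X r).
  { rewrite <- (phi_inv p (conj_exp p) (X r)) at 1 by lra. rewrite <- phi_mult. f_equal.
    unfold g. field. easy. }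
  apply (is_derive_ext (fun x => W x / g x)); [easy|].
  auto_derive; [repeat split; first [exact I | now eexists; exact HW | now eexists; exact D | easy]|].
  eval_derive.
  rewrite Hq, <- (phi_mul_id (conj_exp p)).
  change (phi p (X r)) with (g r) in *.
  replace (phi (conj_exp p) (W r / g r) * X r * ((p - 1) * powp (Rabs (X r)) (p - 2)))
    with (phi (conj_exp p) (W r / g r) * (p - 1) * g r) by (unfold g, phi; ring).
  change (W r * / g r) with (W r / g r). field. split; first [easy | lra].
Qed.

Lemma ratio_continuous (X W : R -> R) r : radial_flow p 1 b X W -> X r <> 0 ->
  continuous (fun r => W r / phi p (X r)) r.
Proof.
  intros HX Hn. apply (continuous_mult W); [apply HX|].
  apply (continuous_comp (fun r => phi p (X r)) Rinv).
  - apply (continuous_comp X (phi p)); [eapply flow_u_continuous, HX|apply phi_continuous; lra].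
  - apply continuous_Rinv. now apply phi_neq0.
Qed.

Lemma flow_log_derive (X W : R -> R) r : radial_flow p 1 b X W -> X r <> 0 ->
  is_derive X r (phi (conj_exp p) (W r / phi p (X r)) * X r).
Proof.
  intros HX Hn. pose proof (conj_exp_inv p Hp). pose proof (phi_neq0 p _ Hn).
  replace (phi (conj_exp p) (W r / phi p (X r)) * X r) with (phi (conj_exp p) (W r)); [apply HX|].
  rewrite <- (phi_inv p (conj_exp p) (X r)) at 2 by lra. rewrite <- phi_mult. f_equal. field. easy.
Qed.

(** The Riccati variables agree by Gronwall: |z|^p' is locally Lipschitz and - z/r has the right
    sign, so s = 0 is included. Equal Riccati variables mean equal logarithmic derivatives, hence U
    / V is constant. *)
Lemma unique_local_nonzero s : 0 <= s < b -> U s = V s -> Y s = Z s -> U s <> 0 ->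
  exists d, 0 < d /\ forall t, s < t < s + d -> U t = V t /\ Y t = Z t.
Proof.
  intros Hs EU EY Hn. pose proof (conj_exp_bounds p Hp).
  assert (HnV : V s <> 0) by now rewrite <- EU.
  set (z1 := fun r => Y r / phi p (U r)). set (z2 := fun r => Z r / phi p (V r)).
  destruct (continuous_eps U s (Rabs (U s))) as [d1 [Hd1 C1]];
    [eapply flow_u_continuous, HF|now apply Rabs_pos_lt|].
  destruct (continuous_eps V s (Rabs (V s))) as [d2 [Hd2 C2]];
    [eapply flow_u_continuous, HG|now apply Rabs_pos_lt|].
  destruct (continuous_eps z1 s 1) as [d3 [Hd3 C3]]; [now apply ratio_continuous|lra|].
  destruct (continuous_eps z2 s 1) as [d4 [Hd4 C4]]; [now apply ratio_continuous|lra|].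
  set (d := Rmin (Rmin (Rmin d1 d2) (Rmin d3 d4)) (b - s)).
  assert (Hd : 0 < d) by (repeat apply Rmin_glb_lt; lra).
  assert (Hle : d <= d1 /\ d <= d2 /\ d <= d3 /\ d <= d4 /\ d <= b - s).
  { unfold d. pose proof (Rmin_l (Rmin (Rmin d1 d2) (Rmin d3 d4)) (b - s)).
    pose proof (Rmin_r (Rmin (Rmin d1 d2) (Rmin d3 d4)) (b - s)).
    pose proof (Rmin_l (Rmin d1 d2) (Rmin d3 d4)). pose proof (Rmin_r (Rmin d1 d2) (Rmin d3 d4)).
    pose proof (Rmin_l d1 d2). pose proof (Rmin_r d1 d2).
    pose proof (Rmin_l d3 d4). pose proof (Rmin_r d3 d4). lra. }
  exists d. split; [easy|]. intros t Ht.
  assert (Hr : forall r, s <= r <= t -> U r <> 0 /\ V r <> 0 /\ Rabs (z1 r - z1 s) < 1 /\ Rabs (z2 r - z2 s) < 1).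
  { intros r Hr. assert (Habs : Rabs (r - s) < d) by (rewrite Rabs_pos_eq; lra).
    specialize (C1 r ltac:(lra)). specialize (C2 r ltac:(lra)).
    specialize (C3 r ltac:(lra)). specialize (C4 r ltac:(lra)).
    split; [|split; [|easy]]; intros E.
    - rewrite E, Rminus_0_l, Rabs_Ropp in C1. lra.
    - rewrite E, Rminus_0_l, Rabs_Ropp in C2. lra. }
  set (B := Rabs (z1 s) + 1).
  assert (Ez : z1 s = z2 s) by (unfold z1, z2; now rewrite EU, EY).
  assert (HB : forall r, s <= r <= t -> Rabs (z1 r) <= B /\ Rabs (z2 r) <= B).
  { intros r Hr0. destruct (Hr r Hr0) as [_ [_ [A1 A2]]]. rewrite <- Ez in A2. unfold B.
    pose proof (Rabs_triang_inv (z1 r) (z1 s)). pose proof (Rabs_triang_inv (z2 r) (z1 s)). lra. }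
  assert (HB0 : 0 < B) by (unfold B; pose proof (Rabs_pos (z1 s)); lra).
  set (K := conj_exp p * powp B (conj_exp p - 1)).
  assert (HK : 0 <= K) by (apply Rmult_le_pos; [lra|apply powp_ge0]).
  assert (Hz : forall r, s <= r <= t -> z1 r = z2 r).
  { intros r Hr0.
    assert (HD : (z1 r - z2 r) ^ 2 <= exp ((2 * ((p - 1) * K) + 1) * (r - s)) * ((z1 s - z2 s) ^ 2 + 0 ^ 2 * (r - s))).
    { apply (gronwall_diff (fun r => z1 r - z2 r)
       (fun r => (- 1 - z1 r / r - (p - 1) * powp (Rabs (z1 r)) (conj_exp p))
         - (- 1 - z2 r / r - (p - 1) * powp (Rabs (z2 r)) (conj_exp p)))).
      - lra.
      - apply Rmult_le_pos; lra.
      - intros x Hx. destruct (Hr x ltac:(lra)) as [A1 [A2 _]].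
        apply (is_derive_minus z1 z2); apply riccati_derive; auto; lra.
      - intros x Hx. destruct (HB x ltac:(lra)) as [A1 A2].
        pose proof (powp_abs_lip (conj_exp p) B (z1 x) (z2 x) ltac:(lra) A1 A2) as HL. fold K in HL.
        set (P1 := powp (Rabs (z1 x)) (conj_exp p)) in *. set (P2 := powp (Rabs (z2 x)) (conj_exp p)) in *.
        replace ((z1 x - z2 x) * (-1 - z1 x / x - (p - 1) * P1 - (-1 - z2 x / x - (p - 1) * P2)))
          with (- ((z1 x - z2 x) ^ 2 / x) - (p - 1) * ((z1 x - z2 x) * (P1 - P2))) by (field; lra).
        assert (0 <= (z1 x - z2 x) ^ 2 / x) by (apply Rdiv_le_0_compat; [apply pow2_ge_0|lra]).
        assert (- ((z1 x - z2 x) * (P1 - P2)) <= K * (z1 x - z2 x) ^ 2).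
        { eapply Rle_trans; [apply Rle_abs|]. rewrite Rabs_Ropp, Rabs_mult, <- (pow2_abs (z1 x - z2 x)).
          pose proof (Rabs_pos (z1 x - z2 x)). nra. }
        rewrite Rmult_0_l, Rplus_0_r.
        assert ((p - 1) * - ((z1 x - z2 x) * (P1 - P2)) <= (p - 1) * (K * (z1 x - z2 x) ^ 2))
          by (apply Rmult_le_compat_l; lra). lra.
      - intros x Hx. destruct (Hr x ltac:(lra)) as [A1 [A2 _]].
        apply (continuous_minus z1 z2); now apply ratio_continuous. }
    rewrite Ez, Rminus_diag, (pow_i 2), Rmult_0_l, Rplus_0_l, Rmult_0_r in HD by lia.
    pose proof (pow2_ge_0 (z1 r - z2 r)). assert ((z1 r - z2 r) ^ 2 = 0) as E0 by lra.
    rewrite <- Rsqr_pow2 in E0. apply Rsqr_0_uniq in E0. lra. }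
  assert (Hq : U s / V s = U t / V t).
  { apply (deriv_zero_eq (fun r => U r / V r)); [lra| |].
    - intros x Hx. destruct (Hr x ltac:(lra)) as [A1 [A2 _]].
      pose proof (flow_log_derive U Y x HF A1) as D1. pose proof (flow_log_derive V Z x HG A2) as D2.
      fold (z1 x) in D1. fold (z2 x) in D2. rewrite (Hz x) in D1 by lra.
      auto_derive; [repeat split; first [exact I | now eexists; exact D1 | now eexists; exact D2 | easy]|].
      eval_derive.
      field. easy.
    - intros x Hx. destruct (Hr x ltac:(lra)) as [A1 [A2 _]].
      apply (continuous_mult U); [eapply flow_u_continuous, HF|].
      apply (continuous_comp V Rinv); [eapply flow_u_continuous, HG|now apply continuous_Rinv]. }
  rewrite EU in Hq. unfold Rdiv in Hq at 1. rewrite Rinv_r in Hq by easy.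
  destruct (Hr t ltac:(lra)) as [A1 [A2 _]].
  assert (EUt : U t = V t).
  { apply (Rmult_eq_compat_r (V t)) in Hq. unfold Rdiv in Hq. rewrite Rmult_assoc, Rinv_l in Hq by easy. lra. }
  split; [easy|]. specialize (Hz t ltac:(lra)). unfold z1, z2 in Hz. rewrite EUt in Hz.
  pose proof (phi_neq0 p _ A2).
  apply (Rmult_eq_compat_r (phi p (V t))) in Hz. unfold Rdiv in Hz.
  rewrite !Rmult_assoc, !Rinv_l in Hz by easy. lra.
Qed.

(** Complementary case: the Riccati variable blows up, but Y stays away from 0, where phi_{p'} is
    Lipschitz, and phi_p is Lipschitz on bounded sets as p >= 2. Gronwall applies to the squared
    distance, to which friction contributes with the right sign. *)
Lemma unique_local_zero s : 0 < s < b -> U s = 0 -> U s = V s -> Y s = Z s -> Y s <> 0 ->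
  exists d, 0 < d /\ forall t, s < t < s + d -> U t = V t /\ Y t = Z t.
Proof.
  intros Hs E0 EU EY Hn. pose proof (conj_exp_bounds p Hp).
  assert (Hn2 : 0 < Rabs (Y s) / 2) by (pose proof (Rabs_pos_lt _ Hn); lra).
  destruct (continuous_eps U s 1) as [d1 [Hd1 C1]]; [eapply flow_u_continuous, HF|lra|].
  destruct (continuous_eps V s 1) as [d2 [Hd2 C2]]; [eapply flow_u_continuous, HG|lra|].
  destruct (continuous_eps Y s (Rabs (Y s) / 2)) as [d3 [Hd3 C3]]; [apply HF|easy|].
  destruct (continuous_eps Z s (Rabs (Y s) / 2)) as [d4 [Hd4 C4]]; [apply HG|easy|].
  set (d := Rmin (Rmin (Rmin d1 d2) (Rmin d3 d4)) (b - s)).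
  assert (Hd : 0 < d) by (repeat apply Rmin_glb_lt; lra).
  assert (Hle : d <= d1 /\ d <= d2 /\ d <= d3 /\ d <= d4 /\ d <= b - s).
  { unfold d. pose proof (Rmin_l (Rmin (Rmin d1 d2) (Rmin d3 d4)) (b - s)).
    pose proof (Rmin_r (Rmin (Rmin d1 d2) (Rmin d3 d4)) (b - s)).
    pose proof (Rmin_l (Rmin d1 d2) (Rmin d3 d4)). pose proof (Rmin_r (Rmin d1 d2) (Rmin d3 d4)).
    pose proof (Rmin_l d1 d2). pose proof (Rmin_r d1 d2).
    pose proof (Rmin_l d3 d4). pose proof (Rmin_r d3 d4). lra. }
  exists d. split; [easy|]. intros t Ht.
  set (K1 := (conj_exp p - 1) * powp (Rabs (Y s) / 2) (conj_exp p - 2)).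
  assert (HK1 : 0 <= K1) by (apply Rmult_le_pos; [lra|apply powp_ge0]).
  set (q := conj_exp p) in *.
  set (g := fun r => (U r - V r) * (U r - V r) + (Y r - Z r) * (Y r - Z r)).
  assert (HD : g t <= exp ((K1 + (p - 1)) * (t - s)) * (g s + 0 * (t - s))).
  { apply (gronwall g (fun r => 2 * (U r - V r) * (phi q (Y r) - phi q (Z r))
       + 2 * (Y r - Z r) * ((- 1 * phi p (U r) - Y r / r) - (- 1 * phi p (V r) - Z r / r)))); try lra.
    - intros r Hr. destruct HF as [HU [_ [_ HY]]]. destruct HG as [HV [_ [_ HZ]]].
      specialize (HU r). specialize (HV r). specialize (HY r ltac:(lra)). specialize (HZ r ltac:(lra)).
      fold q in HU, HV. unfold g.
      auto_derive; [repeat split; first [exact I | now eexists; exact HU | now eexists; exact HV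
        | now eexists; exact HY | now eexists; exact HZ]|].
      eval_derive.
      field. lra.
    - intros r Hr. assert (Habs : Rabs (r - s) < d) by (rewrite Rabs_pos_eq; lra).
      specialize (C1 r ltac:(lra)). specialize (C2 r ltac:(lra)).
      specialize (C3 r ltac:(lra)). specialize (C4 r ltac:(lra)).
      rewrite E0, Rminus_0_r in C1. rewrite <- EU, E0, Rminus_0_r in C2. rewrite <- EY in C4.
      pose proof (phi_lip_unit p (U r) (V r) Hp ltac:(lra) ltac:(lra)) as L1.
      pose proof (phi_lip_near q (Y s) (Y r) (Z r) ltac:(lra) Hn C3 C4) as L2. fold K1 in L2.
      set (x := U r - V r) in *. set (y := Y r - Z r) in *.
      replace ((- 1 * phi p (U r) - Y r / r) - (- 1 * phi p (V r) - Z r / r))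
        with (- (phi p (U r) - phi p (V r)) - y / r) by (unfold y; field; lra).
      set (A := phi q (Y r) - phi q (Z r)) in *. set (C := phi p (U r) - phi p (V r)) in *.
      change (g r) with (x * x + y * y).
      assert (0 <= y * y / r) by (apply Rdiv_le_0_compat; [nra|lra]).
      replace (2 * x * A + 2 * y * (- C - y / r)) with (2 * (x * A) + 2 * - (y * C) - 2 * (y * y / r)) by (field; lra).
      assert (x * A <= K1 * (Rabs x * Rabs y)).
      { eapply Rle_trans; [apply Rle_abs|]. rewrite Rabs_mult. pose proof (Rabs_pos x). nra. }
      assert (- (y * C) <= (p - 1) * (Rabs x * Rabs y)).
      { eapply Rle_trans; [apply Rle_abs|]. rewrite Rabs_Ropp, Rabs_mult. pose proof (Rabs_pos y). nra. }
      assert (2 * (Rabs x * Rabs y) <= x * x + y * y).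
      { replace (x * x) with (Rabs x * Rabs x) by (rewrite <- Rabs_mult; apply Rabs_pos_eq; nra).
        replace (y * y) with (Rabs y * Rabs y) by (rewrite <- Rabs_mult; apply Rabs_pos_eq; nra).
        pose proof (Rle_0_sqr (Rabs x - Rabs y)) as Hsq. unfold Rsqr in Hsq. lra. }
      assert ((K1 + (p - 1)) * (2 * (Rabs x * Rabs y)) <= (K1 + (p - 1)) * (x * x + y * y))
        by (apply Rmult_le_compat_l; lra).
      lra.
    - intros r Hr.
      assert (CU : continuous (fun r => U r - V r) r).
      { apply (continuous_minus U V); eapply flow_u_continuous; [exact HF|exact HG]. }
      assert (CY : continuous (fun r => Y r - Z r) r) by (apply (continuous_minus Y Z); [apply HF|apply HG]).
      apply (continuous_plus (fun r => (U r - V r) * (U r - V r)) (fun r => (Y r - Z r) * (Y r - Z r))).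
      + now apply (continuous_mult (fun r => U r - V r) (fun r => U r - V r)).
      + now apply (continuous_mult (fun r => Y r - Z r) (fun r => Y r - Z r)). }
  assert (Eg : g s = 0) by (unfold g; rewrite EU, EY; ring).
  rewrite Eg, Rmult_0_l, Rplus_0_l, Rmult_0_r in HD.
  pose proof (Rle_0_sqr (U t - V t)) as S1. pose proof (Rle_0_sqr (Y t - Z t)) as S2.
  change (g t) with ((U t - V t)² + (Y t - Z t)²) in HD.
  assert (A1 : (U t - V t)² = 0) by lra. assert (A2 : (Y t - Z t)² = 0) by lra.
  apply Rsqr_0_uniq in A1, A2. split; lra.
Qed.

(** The two local results continue agreement to the right of every point, since [flow_nonzero]
    excludes a common zero of U and Y. *)
Lemma flow_unique r : U 0 = V 0 -> U 0 <> 0 -> 0 <= r <= b -> U r = V r.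
Proof.
  intros E0 Hn Hr.
  assert (H : Rabs (U r - V r) + Rabs (Y r - Z r) <= 0).
  2:{ pose proof (Rabs_pos (U r - V r)). pose proof (Rabs_pos (Y r - Z r)).
      assert (Rabs (U r - V r) = 0) as A by lra. apply abs_eq0 in A. lra. }
  apply (barrier (fun r => Rabs (U r - V r) + Rabs (Y r - Z r)) 0 r); [lra| | |].
  - destruct HF as [_ [_ [-> _]]]. destruct HG as [_ [_ [-> _]]].
    rewrite E0, !Rminus_diag, Rabs_R0. lra.
  - intros t _. apply (continuous_plus (fun r => Rabs (U r - V r)) (fun r => Rabs (Y r - Z r))).
    + apply (continuous_comp (fun r => U r - V r) Rabs); [|apply continuous_Rabs].
      apply (continuous_minus U V); eapply flow_u_continuous; [exact HF|exact HG].
    + apply (continuous_comp (fun r => Y r - Z r) Rabs); [|apply continuous_Rabs].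
      apply (continuous_minus Y Z); [apply HF|apply HG].
  - intros s Hs Hz.
    pose proof (Rabs_pos (U s - V s)). pose proof (Rabs_pos (Y s - Z s)).
    assert (Rabs (U s - V s) = 0) as A by lra. apply abs_eq0 in A.
    assert (Rabs (Y s - Z s) = 0) as B by lra. apply abs_eq0 in B.
    assert (HL : exists d, 0 < d /\ forall t, s < t < s + d -> U t = V t /\ Y t = Z t).
    { destruct (Req_dec (U s) 0) as [HUs|HUs].
      - apply unique_local_zero; try lra.
        + destruct (proj1 Hs) as [H0s|H0s]; [lra|]. subst s. contradiction.
        + apply (flow_nonzero p b U Y s); auto; lra.
      - apply unique_local_nonzero; auto; lra. }
    destruct HL as [d [Hd HL]]. exists d. split; [easy|]. intros t Ht.
    destruct (HL t Ht) as [-> ->]. rewrite !Rminus_diag, Rabs_R0. lra.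
Qed.
End Uniqueness.

(** * Radial eigenvalues *)

Lemma cos_zero_quarter x : 0 < x -> cos x = 0 -> exists i : nat, x = INR (2 * i + 1) * (PI / 2).
Proof.
  intros Hx Hc. apply cos_eq_0_0 in Hc. destruct Hc as [k Hk].
  pose proof PI_RGT_0.
  assert (Hk0 : (0 <= k)%Z).
  { destruct (Z.le_gt_cases 0 k) as [|Hneg]; [easy|exfalso].
    assert (k <= -1)%Z as Hk1 by lia. apply IZR_le in Hk1. nra. }
  exists (Z.to_nat k). rewrite plus_INR, mult_INR.
  replace (INR (Z.to_nat k)) with (IZR k) by (rewrite INR_IZR_INZ, Z2Nat.id; easy). simpl. lra.
Qed.

Lemma cos_quarter_zero i : cos (INR (2 * i + 1) * (PI / 2)) = 0.
Proof.
  apply cos_eq_0_1. exists (Z.of_nat i).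
  rewrite plus_INR, mult_INR, <- INR_IZR_INZ. simpl. field.
Qed.

Lemma powp_lt_inv x y q : 0 <= x -> 0 <= y -> 0 < q -> powp x q < powp y q -> x < y.
Proof.
  intros Hx Hy Hq H. destruct (Rlt_dec x y) as [|Hn]; [easy|exfalso].
  pose proof (powp_le y x q ltac:(lra) ltac:(lra)). lra.
Qed.

Lemma powp_inj x y q : 0 <= x -> 0 <= y -> 0 < q -> powp x q = powp y q -> x = y.
Proof.
  intros Hx Hy Hq H. destruct (Rtotal_order x y) as [L|[L|L]]; [exfalso|easy|exfalso].
  - pose proof (powp_lt x y q ltac:(lra) Hq). lra.
  - pose proof (powp_lt y x q ltac:(lra) Hq). lra.
Qed.

Section Eigenvalues.
Variables (p : R) (b : R -> R).
Hypothesis Hp : 2 <= p.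
Hypothesis Hb : angle_solution p b.

Lemma angle_pos r : 0 < r -> 0 < b r.
Proof.
  intros Hr. set (a := Rmin (r / 2) (/ (2 * p * p))).
  assert (0 < / (2 * p * p)) by (apply Rinv_0_lt_compat; nra).
  assert (0 < a) by (apply Rmin_glb_lt; lra).
  assert (a <= r / 2) by apply Rmin_l. assert (a <= / (2 * p * p)) by apply Rmin_r.
  pose proof (proj2 Hb a ltac:(lra)).
  pose proof (angle_above p b Hp Hb 0 a r ltac:(lra)) as HA. simpl in HA. lra.
Qed.

Lemma cos_angle_pos_small t : 0 < t -> exists s, 0 < s < t /\ 0 < cos (b s).
Proof.
  intros Ht. set (s := Rmin (t / 2) (/ (2 * p * p))).
  assert (Hi : 0 < / (2 * p * p)) by (apply Rinv_0_lt_compat; nra).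
  assert (0 < s) by (apply Rmin_glb_lt; lra).
  assert (s <= t / 2) by apply Rmin_l. assert (s <= / (2 * p * p)) by apply Rmin_r.
  exists s. split; [lra|].
  pose proof (proj2 Hb s ltac:(lra)).
  assert (p * s <= 1).
  { apply Rle_trans with (p * / (2 * p * p)); [apply Rmult_le_compat_l; lra|].
    replace (p * / (2 * p * p)) with (/ (2 * p)) by (field; lra).
    rewrite <- Rinv_1. apply Rinv_le_contravar; lra. }
  pose proof PI2_1. apply cos_gt_0; lra.
Qed.

Lemma radial_eig_iff mu : radial_eig p mu <->
  exists (i : nat) t, crossing b (2 * i + 1) t /\ mu = powp t p.
Proof.
  destruct (radial_flow_exists p b Hp Hb) as [U [Y [HF Hpol]]].
  assert (HU0 : U 0 <> 0).
  { destruct (cos_angle_pos_small 1 Rlt_0_1) as [s [Hs Hc]].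
    apply (flow_start_nonzero p 1 U Y Hp (HF 1)). exists s. split; [lra|].
    destruct (Hpol s ltac:(lra)) as [A [B [HA [HB [-> _]]]]]. nra. }
  split.
  - intros H. destruct (radial_eig_flow p mu Hp H) as [u [y [Hf [H1 Hn]]]].
    pose proof (flow_eigenvalue_pos p mu u y Hp Hf H1 Hn) as Hmu.
    set (nu := powp mu (/ p)). assert (Hnu : 0 < nu) by now apply powp_gt0.
    assert (Emu : powp nu p = mu).
    { unfold nu. rewrite powp_powp, Rinv_l, powp_1r by lra. easy. }
    assert (Hinu : 0 < / nu) by now apply Rinv_0_lt_compat.
    assert (Hsc : forall c, radial_flow p 1 nu (fun r => c * u (/ nu * r)) (fun r => phi p (c * / nu) * y (/ nu * r))).
    { intros c. pose proof (flow_scale p mu 1 u y (/ nu) c Hp Hinu Hf) as Hs.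
      replace (mu * powp (/ nu) p) with 1 in Hs.
      2:{ rewrite <- Emu, <- powp_mult, Rinv_r, powp_1l by lra. easy. }
      replace (1 / / nu) with nu in Hs by (field; lra). easy. }
    assert (Hu0 : u 0 <> 0).
    { destruct Hn as [r [Hr Hn]].
      assert (Hz : 1 * u (/ nu * 0) <> 0).
      { apply (flow_start_nonzero p nu _ _ Hp (Hsc 1)). exists (nu * r). split; [nra|].
        replace (/ nu * (nu * r)) with r by (field; lra). lra. }
      rewrite Rmult_0_r in Hz. lra. }
    assert (HUnu : U nu = 0).
    (* The stretched eigenfunction is multiplied by U 0 / u 0 so that the initial values agree; u 0
       is nonzero by the energy argument. *)
    { rewrite <- (flow_unique p nu _ _ U Y Hp (Hsc (U 0 / u 0)) (HF nu) nu).
      - replace (/ nu * nu) with 1 by (field; lra). rewrite H1. ring.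
      - rewrite Rmult_0_r. field. easy.
      - rewrite Rmult_0_r. replace (U 0 / u 0 * u 0) with (U 0) by (field; easy). easy.
      - lra. }
    destruct (Hpol nu Hnu) as [A [B [HA [HB [E _]]]]]. rewrite HUnu in E.
    destruct (cos_zero_quarter (b nu) (angle_pos nu Hnu)) as [i Hi]; [nra|].
    exists i, nu. split; [|easy]. split; easy.
  - intros [i [t [Hc ->]]]. pose proof (proj1 Hc) as Ht.
    pose proof (flow_scale p 1 t U Y t 1 Hp Ht (HF t)) as Hs.
    rewrite Rmult_1_l in Hs. replace (t / t) with 1 in Hs by (field; lra).
    apply (flow_radial_eig _ _ _ _ _ Hp (Rle_refl 1) Hs).
    + destruct (Hpol t Ht) as [A [B [HA [HB [E _]]]]].
      rewrite Rmult_1_r, E, (proj2 Hc), cos_quarter_zero. ring.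
    + destruct (cos_angle_pos_small t Ht) as [s [Hs1 Hcs]].
      exists (s / t). split.
      * split; [apply Rdiv_le_0_compat; lra|]. apply Rmult_le_reg_r with t; [easy|].
        unfold Rdiv. rewrite Rmult_assoc, Rinv_l; lra.
      * replace (t * (s / t)) with s by (field; lra).
        destruct (Hpol s ltac:(lra)) as [A [B [HA [HB [E _]]]]]. rewrite E. nra.
Qed.

(** Zeros are indexed from 0: level 2k + 1 is the zero number k + 1, and the k smaller eigenvalues
    come from the levels 1, 3, ..., 2k - 1. *)
Lemma kth_eig_crossing k t : crossing b (2 * k + 1) t -> kth_radial_eig p (S k) (powp t p).
Proof.
  intros Hc. split.
  - apply radial_eig_iff. now exists k, t.
  - assert (HT : forall i : nat, exists t, crossing b (2 * i + 1) t).
    { intros i. apply (crossing_exists p); auto; lia. }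
    apply choice in HT. destruct HT as [T HT].
    assert (HTp : forall i, 0 < T i) by (intros i; apply HT).
    exists (map (fun i => powp (T i) p) (seq 0 k)). split; [|split].
    + apply Injective_map_NoDup; [|apply seq_NoDup].
      intros i j E. apply powp_inj in E; try (try pose proof (HTp i); try pose proof (HTp j); lra).
      destruct (Nat.lt_trichotomy i j) as [L|[L|L]]; [exfalso|easy|exfalso].
      * pose proof (crossing_lt p b Hp Hb _ _ _ _ (HT i) (HT j) ltac:(lia)). lra.
      * pose proof (crossing_lt p b Hp Hb _ _ _ _ (HT j) (HT i) ltac:(lia)). lra.
    + rewrite length_map, length_seq. lia.
    + intros x. rewrite in_map_iff. split.
      * intros [i [<- Hi]]. apply in_seq in Hi. split.
        -- apply radial_eig_iff. now exists i, (T i).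
        -- apply powp_lt; [|lra]. split; [left; apply HTp|].
           apply (crossing_lt p b Hp Hb _ _ _ _ (HT i) Hc). lia.
      * intros [Hx Hlt]. apply radial_eig_iff in Hx. destruct Hx as [i [s [Hs ->]]].
        exists i. split.
        -- f_equal. apply (crossing_unique p b Hp Hb (2 * i + 1)); auto.
        -- apply in_seq. apply powp_lt_inv in Hlt; try lra; [|left; apply Hs|left; apply Hc].
           destruct (Nat.lt_ge_cases i k) as [|Hge]; [lia|exfalso].
           destruct (Nat.eq_dec i k) as [->|].
           ++ pose proof (crossing_unique p b Hp Hb _ _ _ Hs Hc). lra.
           ++ pose proof (crossing_lt p b Hp Hb _ _ _ _ Hc Hs ltac:(lia)). lra.
Qed.
End Eigenvalues.

(** * Bounds on the zeros *)

Lemma flow_ry_derive p b U Y r : radial_flow p 1 b U Y -> 0 < r < b ->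
  is_derive (fun r => r * Y r) r (- (r * phi p (U r))).
Proof.
  intros [_ [_ [_ HY]]] Hr. specialize (HY r Hr).
  auto_derive; [now eexists; exact HY|].
  eval_derive.
  field. lra.
Qed.

Lemma flow_ry_continuous p b U Y r : radial_flow p 1 b U Y -> continuous (fun r => r * Y r) r.
Proof.
  intros H. apply (continuous_mult (fun r => r) Y); [apply continuous_id|apply H].
Qed.

Lemma phi_neg_powp p x : x <= 0 -> phi p x = - powp (- x) (p - 1).
Proof.
  intros Hx. rewrite <- (phi_powp p (- x)) by lra. rewrite phi_opp. ring.
Qed.

Lemma phi_le p x y : 1 < p -> x <= y -> phi p x <= phi p y.
Proof.
  intros Hp Hxy. destruct (Rle_dec 0 x).
  - rewrite !phi_powp by lra. apply powp_le; lra.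
  - rewrite (phi_neg_powp p x) by lra. destruct (Rle_dec 0 y).
    + pose proof (powp_ge0 (- x) (p - 1)). pose proof (phi_ge0 p y ltac:(lra)). lra.
    + rewrite phi_neg_powp by lra. apply Ropp_le_contravar, powp_le; lra.
Qed.

(** With M = U m as maximum, (r Y)' >= - r phi_p(M) gives Y >= - phi_p(M) (r - m). Over a length
    below 1 this means U' >= - M, so U cannot lose the full amount M. *)
Lemma gap_to_zero p b U Y m z : 2 <= p -> radial_flow p 1 b U Y -> 0 <= m < z -> z < b ->
  (forall r, m <= r <= z -> 0 <= U r /\ Y r <= 0) -> Y m = 0 -> 0 < U m -> U z = 0 -> 1 <= z - m.
Proof.
  intros Hp HF Hm Hz Hs HYm HUm HUz. pose proof (conj_exp_bounds p Hp). pose proof (conj_exp_inv p Hp) as Hq.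
  destruct (Rle_dec 1 (z - m)) as [|Hn]; [easy|exfalso].
  set (M := U m) in *.
  assert (HUd : forall r, is_derive U r (phi (conj_exp p) (Y r))) by apply HF.
  assert (HUc : forall r, continuous U r) by (intros; eapply flow_u_continuous, HF).
  assert (HUM : forall r, m <= r <= z -> U r <= M).
  { intros r Hr. apply (deriv_nonpos_le U (fun r => phi (conj_exp p) (Y r))); auto; [lra|].
    intros t Ht. rewrite <- (phi_0 (conj_exp p)). apply phi_le; [lra|]. apply Hs; lra. }
  assert (HYl : forall r, m < r <= z -> - phi p M * (r - m) <= Y r).
  { intros r Hr.
    assert (Hg : m * Y m + phi p M * (m * (m - m)) <= r * Y r + phi p M * (r * (r - m))).
    (* The comparison function r (r - m) has derivative 2 r - m >= r and vanishes at m. *)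
    { apply (deriv_nonneg_le (fun r => r * Y r + phi p M * (r * (r - m)))
       (fun r => - (r * phi p (U r)) + phi p M * (2 * r - m))); [lra| | |].
      - intros t Ht. apply (is_derive_plus (fun r => r * Y r)).
        + apply (flow_ry_derive p b); [easy|lra].
        + auto_derive; auto. ring.
      - intros t Ht. pose proof (phi_le p (U t) M ltac:(lra) (HUM t ltac:(lra))).
        pose proof (phi_ge0 p M ltac:(lra)). nra.
      - intros t Ht. apply (continuous_plus (fun r => r * Y r)); [eapply flow_ry_continuous, HF|].
        apply is_derive_continuous with (phi p M * (2 * t - m)). auto_derive; auto. ring. }
    rewrite HYm, Rminus_diag, !Rmult_0_r, Rplus_0_l in Hg.
    assert (0 <= r * (Y r + phi p M * (r - m))) by lra.
    assert (0 <= Y r + phi p M * (r - m)) by (apply Rmult_le_reg_l with r; lra). lra. }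
  destruct (mean_value U (fun r => phi (conj_exp p) (Y r)) m z) as [c [Hc E]]; auto; [lra|].
  rewrite HUz in E. fold M in E.
  assert (HcY : - M <= phi (conj_exp p) (Y c)).
  { specialize (HYl c ltac:(lra)). pose proof (phi_ge0 p M ltac:(lra)).
    assert (- phi p M <= Y c) by nra.
    replace (- M) with (phi (conj_exp p) (- phi p M)).
    - apply phi_le; lra.
    - rewrite phi_opp, phi_inv by lra. easy. }
  assert (phi (conj_exp p) (Y c) <= 0).
  { rewrite <- (phi_0 (conj_exp p)). apply phi_le; [lra|]. apply Hs; lra. }
  nra.
Qed.

(** With A = U' at a, the decrease of r Y gives Y <= Y a and U <= A (r - a). Hence r Y loses at most
    m Y(a) (m - a)^p / p, which is at most m Y(a) / 2 when m - a < 1. Vanishing at m then forces 2 a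
    <= m < a + 1, against a >= 1. *)
Lemma gap_to_critical p b U Y a m : 2 <= p -> radial_flow p 1 b U Y -> 1 <= a < m -> m < b ->
  (forall r, a <= r <= m -> 0 <= U r /\ 0 <= Y r) -> U a = 0 -> 0 < Y a -> Y m = 0 -> 1 <= m - a.
Proof.
  intros Hp HF Ha Hm Hs HUa HYa HYm. pose proof (conj_exp_bounds p Hp). pose proof (conj_exp_inv p Hp) as Hq.
  destruct (Rle_dec 1 (m - a)) as [|Hn]; [easy|exfalso].
  set (A := phi (conj_exp p) (Y a)) in *.
  assert (HA : 0 < A) by now apply phi_gt0.
  assert (HYA : phi p A = Y a) by (apply phi_inv; lra).
  assert (HUd : forall r, is_derive U r (phi (conj_exp p) (Y r))) by apply HF.
  assert (HUc : forall r, continuous U r) by (intros; eapply flow_u_continuous, HF).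
  assert (HYle : forall r, a <= r <= m -> Y r <= Y a).
  { intros r Hr.
    assert (r * Y r <= a * Y a).
    { apply (deriv_nonpos_le (fun r => r * Y r) (fun r => - (r * phi p (U r)))); [lra| | |].
      - intros t Ht. apply (flow_ry_derive p b); [easy|lra].
      - intros t Ht. pose proof (phi_ge0 p (U t) ltac:(apply Hs; lra)). nra.
      - intros t Ht. eapply flow_ry_continuous, HF. }
    destruct (Hs r Hr). nra. }
  assert (HUle : forall r, a <= r <= m -> U r <= A * (r - a)).
  { intros r Hr. assert (U r - A * (r - a) <= U a - A * (a - a)); [|lra].
    apply (deriv_nonpos_le (fun r => U r - A * (r - a)) (fun r => phi (conj_exp p) (Y r) - A)); [lra| | |].
    - intros t Ht. apply (is_derive_minus U); [apply HUd|]. auto_derive; auto. ring.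
    - intros t Ht. assert (phi (conj_exp p) (Y t) <= A); [|lra].
      apply phi_le; [lra|]. apply HYle; lra.
    - intros t Ht. apply (continuous_minus U); [apply HUc|].
      apply is_derive_continuous with A. auto_derive; auto. ring. }
  set (w := fun r => powp (Rabs (r - a)) p).
  assert (Hw : forall t, is_derive w t (p * phi p (t - a))).
  { intros t. pose proof (is_derive_comp (fun x => powp (Rabs x) p) (fun r => r - a) t (p * phi p (t - a)) 1) as D.
    unfold scal in D; simpl in D; unfold mult in D; simpl in D. rewrite Rmult_1_l in D. apply D.
    - apply is_derive_powp. lra.
    - auto_derive; auto. }
  assert (Hg : a * Y a + m * Y a / p * w a <= m * Y m + m * Y a / p * w m).
  { apply (deriv_nonneg_le (fun r => r * Y r + m * Y a / p * w r)
      (fun r => - (r * phi p (U r)) + m * Y a / p * (p * phi p (r - a)))); [lra| | |].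
    - intros t Ht. apply (is_derive_plus (fun r => r * Y r)).
      + apply (flow_ry_derive p b); [easy|lra].
      + apply (is_derive_scal w), Hw.
    - intros t Ht. pose proof (phi_le p (U t) (A * (t - a)) ltac:(lra) (HUle t ltac:(lra))) as HL.
      rewrite phi_mult, HYA in HL.
      replace (m * Y a / p * (p * phi p (t - a))) with (m * (Y a * phi p (t - a))) by (field; lra).
      pose proof (phi_ge0 p (U t) ltac:(apply Hs; lra)).
      pose proof (phi_ge0 p (t - a) ltac:(lra)).
      assert (t * phi p (U t) <= m * (Y a * phi p (t - a))) by (apply Rmult_le_compat; lra). lra.
    - intros t Ht. apply (continuous_plus (fun r => r * Y r)); [eapply flow_ry_continuous, HF|].
      eapply is_derive_continuous. apply (is_derive_scal w), Hw. }
  assert (Hwa : w a = 0) by (unfold w; now rewrite Rminus_diag, Rabs_R0, powp_0).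
  assert (Hwm : 0 <= w m <= 1).
  { split; [apply powp_ge0|]. apply powp_le_1; [|lra]. rewrite Rabs_pos_eq; lra. }
  rewrite Hwa, HYm, !Rmult_0_r, Rplus_0_l, Rplus_0_r in Hg.
  assert (Hmp : m * Y a / p <= m * Y a / 2).
  { apply Rmult_le_compat_l; [nra|]. apply Rinv_le_contravar; lra. }
  assert (0 <= m * Y a / p) by (apply Rdiv_le_0_compat; nra).
  nra.
Qed.

Lemma cos_shift j x : cos (x - INR j * PI) = (-1) ^ j * cos x.
Proof.
  induction j as [|j IH].
  - simpl. rewrite Rmult_0_l, Rminus_0_r. ring.
  - rewrite S_INR. replace (x - (INR j + 1) * PI) with (x - INR j * PI - PI) by ring.
    rewrite cos_minus, cos_PI, sin_PI, IH. simpl. ring.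
Qed.

Lemma sin_shift j x : sin (x - INR j * PI) = (-1) ^ j * sin x.
Proof.
  induction j as [|j IH].
  - simpl. rewrite Rmult_0_l, Rminus_0_r. ring.
  - rewrite S_INR. replace (x - (INR j + 1) * PI) with (x - INR j * PI - PI) by ring.
    rewrite sin_minus, cos_PI, sin_PI, IH. simpl. ring.
Qed.

Section Bounds.
Variables (p : R) (b U Y : R -> R).
Hypothesis Hp : 2 <= p.
Hypothesis Hb : angle_solution p b.
Hypothesis HF : forall R, radial_flow p 1 R U Y.
Hypothesis Hpol : forall r, 0 < r -> exists A B, 0 < A /\ 0 < B /\ U r = A * cos (b r) /\ Y r = - B * sin (b r).

(** The equation is odd, so a sign change reduces every nodal interval to the sign pattern of the
    gap lemmas. *)
Lemma signed_flow j R : radial_flow p 1 R (fun r => (-1) ^ j * U r) (fun r => (-1) ^ j * Y r).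
Proof.
  assert (E : forall q, phi q ((-1) ^ j) = (-1) ^ j).
  { intros q. unfold phi. rewrite pow_1_abs, powp_1l. ring. }
  destruct (HF R) as [H1 [H2 [H3 H4]]]. split; [|split; [|split]].
  - intros r. rewrite phi_mult, E. apply (is_derive_scal U), H1.
  - intros r. apply (continuous_mult (fun _ => (-1) ^ j) Y); [apply continuous_const|apply H2].
  - rewrite H3. ring.
  - intros r Hr. rewrite phi_mult, E.
    replace (- (1) * ((-1) ^ j * phi p (U r)) - (-1) ^ j * Y r / r)
      with ((-1) ^ j * (- (1) * phi p (U r) - Y r / r)) by (field; lra).
    apply (is_derive_scal Y), H4, Hr.
Qed.

Lemma signed_sin_cos i r : 0 < r ->
  exists A B, 0 < A /\ 0 < B /\ (-1) ^ i * U r = A * cos (b r - INR i * PI) /\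
    (-1) ^ i * Y r = - B * sin (b r - INR i * PI).
Proof.
  intros Hr. destruct (Hpol r Hr) as [A [B [HA [HB [E1 E2]]]]].
  exists A, B. rewrite cos_shift, sin_shift, E1, E2. repeat split; auto; ring.
Qed.

Lemma crossing_level_ge j t r : crossing b j t -> t <= r -> INR j * (PI / 2) <= b r.
Proof.
  intros Hc Hr. destruct (Req_dec t r) as [<-|]; [right; symmetry; apply Hc|].
  left. apply (crossing_after p b Hp Hb j t r Hc). lra.
Qed.

Lemma crossing_level_le j t r : crossing b j t -> 0 < r <= t -> b r <= INR j * (PI / 2).
Proof.
  intros Hc Hr. destruct (Req_dec t r) as [<-|]; [right; apply Hc|].
  left. apply (crossing_before p b Hp Hb j t r Hc). lra.
Qed.

Lemma flow_u0_pos : 0 < U 0.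
Proof.
  assert (HU0 : U 0 <> 0).
  { destruct (cos_angle_pos_small p b Hp Hb 1 Rlt_0_1) as [s [Hs Hc]].
    apply (flow_start_nonzero p 1 U Y Hp (HF 1)). exists s. split; [lra|].
    destruct (Hpol s ltac:(lra)) as [A [B [HA [HB [-> _]]]]]. nra. }
  destruct (Rlt_dec 0 (U 0)) as [|Hn]; [easy|exfalso].
  assert (Hlt : U 0 < 0) by lra.
  destruct (continuous_eps U 0 (- U 0)) as [d [Hd Hcl]]; [eapply flow_u_continuous, (HF 1)|lra|].
  destruct (cos_angle_pos_small p b Hp Hb d Hd) as [s [Hs Hc]].
  specialize (Hcl s ltac:(rewrite Rminus_0_r, Rabs_pos_eq; lra)). apply Rabs_lt_between in Hcl.
  destruct (Hpol s ltac:(lra)) as [A [B [HA [HB [E _]]]]]. nra.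
Qed.

Lemma first_zero_ge t : crossing b 1 t -> 1 <= t.
Proof.
  intros Hc. pose proof (proj1 Hc) as Ht. pose proof PI2_1.
  replace t with (t - 0) by ring.
  apply (gap_to_zero p (t + 1) U Y 0 t Hp (HF _)); try lra.
  - intros r Hr. destruct (Req_dec r 0) as [->|].
    + pose proof flow_u0_pos. destruct (HF 1) as [_ [_ [-> _]]]. lra.
    + pose proof (angle_pos p b Hp Hb r ltac:(lra)) as Hpos.
      pose proof (crossing_level_le 1 t r Hc ltac:(lra)) as Hle. simpl in Hle.
      destruct (Hpol r ltac:(lra)) as [A [B [HA [HB [-> ->]]]]].
      pose proof (cos_ge_0 (b r) ltac:(lra) ltac:(lra)). pose proof (sin_ge_0 (b r) ltac:(lra) ltac:(lra)).
      split; nra.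
  - apply (HF 1).
  - apply flow_u0_pos.
  - destruct (Hpol t Ht) as [A [B [HA [HB [-> _]]]]]. destruct Hc as [_ ->].
    change 1%nat with (2 * 0 + 1)%nat. rewrite cos_quarter_zero. ring.
Qed.

Lemma zero_to_critical_ge i a m : crossing b (2 * i + 1) a -> crossing b (2 * i + 2) m -> 1 <= a -> 1 <= m - a.
Proof.
  intros Ha Hm Ha1. pose proof (crossing_lt p b Hp Hb _ _ _ _ Ha Hm ltac:(lia)) as Hlt.
  pose proof PI2_1.
  assert (Ea : b a - INR (S i) * PI = - (PI / 2)).
  { rewrite (proj2 Ha), plus_INR, mult_INR, (S_INR i). simpl. lra. }
  assert (Em : b m - INR (S i) * PI = 0).
  { rewrite (proj2 Hm), plus_INR, mult_INR, (S_INR i). simpl. lra. }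
  apply (gap_to_critical p (m + 1) (fun r => (-1) ^ S i * U r) (fun r => (-1) ^ S i * Y r) a m Hp (signed_flow _ _)); try lra.
  - intros r Hr. destruct (signed_sin_cos (S i) r ltac:(lra)) as [A [B [HA [HB [-> ->]]]]].
    pose proof (crossing_level_ge _ _ r Ha ltac:(lra)) as L1. pose proof (crossing_level_le _ _ r Hm ltac:(lra)) as L2.
    rewrite <- (proj2 Ha) in L1. rewrite <- (proj2 Hm) in L2.
    set (x := b r - INR (S i) * PI). assert (Hx : - (PI / 2) <= x <= 0) by (unfold x; lra).
    pose proof (cos_ge_0 x ltac:(lra) ltac:(lra)). pose proof (sin_ge_0 (- x) ltac:(lra) ltac:(lra)) as Hsx.
    rewrite sin_neg in Hsx. split; nra.
  - destruct (signed_sin_cos (S i) a ltac:(lra)) as [A [B [HA [HB [-> _]]]]].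
    rewrite Ea, cos_neg, cos_PI2. ring.
  - destruct (signed_sin_cos (S i) a ltac:(lra)) as [A [B [HA [HB [_ ->]]]]].
    rewrite Ea, sin_neg, sin_PI2. lra.
  - destruct (signed_sin_cos (S i) m ltac:(lra)) as [A [B [HA [HB [_ ->]]]]].
    rewrite Em, sin_0. ring.
Qed.

Lemma critical_to_zero_ge i m z : crossing b (2 * i + 2) m -> crossing b (2 * i + 3) z -> 1 <= z - m.
Proof.
  intros Hm Hz. pose proof (crossing_lt p b Hp Hb _ _ _ _ Hm Hz ltac:(lia)) as Hlt.
  pose proof PI2_1. pose proof (proj1 Hm) as Hm0.
  assert (Em : b m - INR (S i) * PI = 0).
  { rewrite (proj2 Hm), plus_INR, mult_INR, (S_INR i). simpl. lra. }
  assert (Ez : b z - INR (S i) * PI = PI / 2).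
  { rewrite (proj2 Hz), plus_INR, mult_INR, (S_INR i). simpl. lra. }
  apply (gap_to_zero p (z + 1) (fun r => (-1) ^ S i * U r) (fun r => (-1) ^ S i * Y r) m z Hp (signed_flow _ _)); try lra.
  - intros r Hr. destruct (signed_sin_cos (S i) r ltac:(lra)) as [A [B [HA [HB [-> ->]]]]].
    pose proof (crossing_level_ge _ _ r Hm ltac:(lra)) as L1. pose proof (crossing_level_le _ _ r Hz ltac:(lra)) as L2.
    rewrite <- (proj2 Hm) in L1. rewrite <- (proj2 Hz) in L2.
    set (x := b r - INR (S i) * PI). assert (Hx : 0 <= x <= PI / 2) by (unfold x; lra).
    pose proof (cos_ge_0 x ltac:(lra) ltac:(lra)). pose proof (sin_ge_0 x ltac:(lra) ltac:(lra)) as Hsx.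
    split; nra.
  - destruct (signed_sin_cos (S i) m ltac:(lra)) as [A [B [HA [HB [_ ->]]]]].
    rewrite Em, sin_0. ring.
  - destruct (signed_sin_cos (S i) m ltac:(lra)) as [A [B [HA [HB [-> _]]]]].
    rewrite Em, cos_0. lra.
  - destruct (signed_sin_cos (S i) z ltac:(lra)) as [A [B [HA [HB [-> _]]]]].
    rewrite Ez, cos_PI2. ring.
Qed.

(** One unit gap leads to the first zero, and each further zero costs two: zero to critical point,
    critical point to zero. *)
Lemma zero_ge_odd k t : crossing b (2 * k + 1) t -> INR (2 * k + 1) <= t.
Proof.
  revert t. induction k as [|k IH]; intros t Ht.
  - simpl. now apply first_zero_ge.
  - replace (2 * S k + 1)%nat with (2 * k + 3)%nat in * by lia.
    destruct (crossing_exists p b Hp Hb (2 * k + 1) ltac:(lia)) as [a Ha].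
    destruct (crossing_exists p b Hp Hb (2 * k + 2) ltac:(lia)) as [m Hm].
    specialize (IH a Ha).
    pose proof (pos_INR k).
    assert (1 <= a).
    { rewrite plus_INR, mult_INR in IH. simpl in IH. lra. }
    pose proof (zero_to_critical_ge k a m Ha Hm H0). pose proof (critical_to_zero_ge k m t Hm Ht).
    replace (2 * k + 3)%nat with (2 * k + 1 + 2)%nat by lia. rewrite (plus_INR (2 * k + 1)). simpl (INR 2). lra.
Qed.

(* Sturm comparison of sqrt r * u with sin: (sqrt r u)'' = - (1 + 1 / (4 r^2)) sqrt r u. *)
Lemma zero_le_linear k t : p = 2 -> crossing b (2 * k + 1) t -> t <= INR (k + 1) * PI.
Proof.
  intros E2 Ht. pose proof PI2_1 as HPI.
  assert (Hq : conj_exp p = 2) by (rewrite E2; unfold conj_exp; field).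
  revert t Ht. induction k as [|k IH]; intros t Ht.
  - simpl. rewrite Rmult_1_l. destruct (Rle_dec t PI) as [|Hn]; [easy|exfalso].
    pose proof (crossing_before p b Hp Hb _ t PI Ht ltac:(lra)) as HbPI. simpl in HbPI. rewrite Rmult_1_l in HbPI.
    (* The comparison potential is singular at 0, so the first zero is treated apart: for p = 2, b'
       = 1 - sin b cos b / r, so r b - r^2 / 2 is nondecreasing, and letting r tend to 0 would give
       b PI >= PI/2. *)
    assert (Hd : forall r, 0 < r -> is_derive (fun r => r * b r - r ^ 2 / 2) r (b r - sin (b r) * cos (b r))).
    { intros r Hr. pose proof (proj1 Hb r Hr) as D. auto_derive; [now eexists; exact D|].
      eval_derive.
      unfold angle_field, angle_drag, angle_num, angle_den. rewrite Hq, E2.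
      rewrite !powp_2 by apply Rabs_pos. rewrite !pow2_abs.
      replace ((2 - 1) * sin (b r) ^ 2 + cos (b r) ^ 2) with 1.
      2:{ pose proof (sin2_cos2 (b r)) as Hsc. rewrite !Rsqr_pow2 in Hsc. lra. }
      field. lra. }
    assert (Hpos : forall x, 0 < x -> 0 <= x - sin x * cos x).
    { intros x Hx. pose proof (sin_le_id x ltac:(lra)). pose proof (sin_abs_le1 x). pose proof (cos_abs_le1 x).
      pose proof (Rle_abs (sin x * cos x)). rewrite Rabs_mult in *. nra. }
    assert (Hmono : forall x y, 0 < x -> x <= y -> x * b x - x ^ 2 / 2 <= y * b y - y ^ 2 / 2).
    { intros x y Hx Hxy. apply (deriv_nonneg_le (fun r => r * b r - r ^ 2 / 2) (fun r => b r - sin (b r) * cos (b r))); auto.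
      - intros r Hr. apply Hd; lra.
      - intros r Hr. apply Hpos, (angle_pos p); auto; lra.
      - intros r Hr. eapply is_derive_continuous, Hd; lra. }
    (* The value at e is at least - e^2 / 2, and e is so small that this exceeds - PI (PI/2 - b PI),
       the value at PI. *)
    set (e := Rmin 1 (Rmin ((PI / 2 - b PI) / 2) (PI / 2))).
    assert (0 < e) by (repeat apply Rmin_glb_lt; lra).
    assert (e <= 1) by apply Rmin_l.
    assert (e <= (PI / 2 - b PI) / 2) by (eapply Rle_trans; [apply Rmin_r|apply Rmin_l]).
    pose proof (Hmono e PI ltac:(lra) ltac:(lra)) as HM. pose proof (angle_pos p b Hp Hb e ltac:(lra)). nra.
  - destruct (crossing_exists p b Hp Hb (2 * k + 1) ltac:(lia)) as [s Hs].
    specialize (IH s Hs).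
    set (j := S k) in *. set (x0 := INR j * PI). set (x1 := INR (j + 1) * PI).
    replace (k + 1)%nat with j in IH by (unfold j; lia). fold x0 in IH.
    assert (Hj : 1 <= INR j) by (unfold j; rewrite S_INR; pose proof (pos_INR k); lra).
    assert (Hx : x1 = x0 + PI) by (unfold x1, x0; rewrite plus_INR; simpl; ring).
    assert (Hx0 : PI <= x0) by (unfold x0; nra).
    destruct (Rle_dec t x1) as [|Hn]; [easy|exfalso].
    assert (Hsgn : forall r, x0 <= r <= x1 -> (r <> x0 -> 0 < (-1) ^ j * U r) /\ 0 <= (-1) ^ j * U r).
    { intros r Hr. destruct (signed_sin_cos j r ltac:(lra)) as [A [B [HA [HB [-> _]]]]].
      pose proof (crossing_level_ge _ _ r Hs ltac:(lra)) as L1.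
      pose proof (crossing_before p b Hp Hb _ _ r Ht ltac:(lra)) as L2.
      set (y := b r - INR j * PI).
      assert (Hy : - (PI / 2) <= y < PI / 2).
      { unfold y, j in *. rewrite plus_INR, mult_INR in L1, L2. rewrite (S_INR k) in *. simpl in L1, L2. lra. }
      split.
      - intros Hne. pose proof (crossing_after p b Hp Hb _ _ r Hs ltac:(lra)) as L3.
        assert (- (PI / 2) < y).
        { unfold y, j in *. rewrite plus_INR, mult_INR in L3. rewrite (S_INR k) in *. simpl in L3. lra. }
        pose proof (cos_gt_0 y ltac:(lra) ltac:(lra)). nra.
      - pose proof (cos_ge_0 y ltac:(lra) ltac:(lra)). nra. }
    set (u := fun r => (-1) ^ j * U r) in *. set (v := fun r => (-1) ^ j * Y r) in *.
    destruct (signed_flow j (x1 + 1)) as [Hu [_ [_ Hv]]]. fold u v in Hu, Hv.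
    rewrite Hq in Hu. rewrite E2 in Hv.
    (* The Wronskian of sqrt r u and sin (r - x0). If u had no zero up to x1, W would strictly
       decrease on [x0, x1], whereas W x0 <= 0 <= W x1. *)
    set (W := fun r => sqrt r * ((v r + u r / (2 * r)) * sin (r - x0) - u r * cos (r - x0))).
    assert (HW : forall r, x0 - 1 < r < x1 + 1 -> is_derive W r (sqrt r * - (u r * sin (r - x0) / (4 * r ^ 2)))).
    { intros r Hr. specialize (Hu r). specialize (Hv r ltac:(lra)). rewrite phi_2 in Hu, Hv.
      change (is_derive u r (v r)) in Hu. change (is_derive v r (- (1) * u r - v r / r)) in Hv.
      unfold W. auto_derive.
      - repeat split; first [exact I | now eexists; exact Hu | now eexists; exact Hv | lra].
      - eval_derive.
        unfold Rminus.
        assert (Hsq : sqrt r * sqrt r = r) by (apply sqrt_sqrt; lra).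
        assert (0 < sqrt r) by (apply sqrt_lt_R0; lra).
        replace (/ (2 * sqrt r)) with (sqrt r / (2 * r)) by (rewrite <- Hsq at 2; field; lra).
        field. lra. }
    destruct (mean_value W (fun r => sqrt r * - (u r * sin (r - x0) / (4 * r ^ 2))) x0 x1) as [c [Hc E]].
    + lra.
    + intros r Hr. apply HW; lra.
    + intros r Hr. eapply is_derive_continuous, HW; lra.
    + assert (HW0 : W x0 = - (sqrt x0 * u x0)).
      { unfold W. rewrite Rminus_diag, sin_0, cos_0. ring. }
      assert (HW1 : W x1 = sqrt x1 * u x1).
      { unfold W. replace (x1 - x0) with PI by lra. rewrite sin_PI, cos_PI. ring. }
      rewrite HW0, HW1 in E.
      pose proof (proj2 (Hsgn x0 ltac:(lra))) as A0. pose proof (proj2 (Hsgn x1 ltac:(lra))) as A1.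
      pose proof (proj1 (Hsgn c ltac:(lra)) ltac:(lra)) as Ac.
      change ((-1) ^ j * U x0) with (u x0) in A0. change ((-1) ^ j * U x1) with (u x1) in A1.
      change ((-1) ^ j * U c) with (u c) in Ac.
      pose proof (sqrt_pos x0). pose proof (sqrt_pos x1).
      assert (0 < sqrt c) by (apply sqrt_lt_R0; lra).
      pose proof (sin_gt_0 (c - x0) ltac:(lra) ltac:(lra)) as Hsc.
      assert (0 < u c * sin (c - x0) / (4 * c ^ 2)).
      { apply Rdiv_lt_0_compat; [nra|]. assert (0 < c) by lra. nra. }
      set (q := u c * sin (c - x0) / (4 * c ^ 2)) in *.
      assert (0 < sqrt c * q) by nra.
      assert (0 <= sqrt x0 * u x0) by nra. assert (0 <= sqrt x1 * u x1) by nra.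
      replace (sqrt c * - q * (x1 - x0)) with (- (sqrt c * q * PI)) in E by (rewrite Hx; ring).
      nra.
Qed.
End Bounds.

(** * Integrals over the square *)

(** The sectors lie in the open square (-1, 1)^2, so every integrand built from a test function
    vanishes off it and the improper iterated integrals reduce to proper ones. *)
Definition off_square (f : R * R -> R) :=
  forall z, 1 <= Rabs (fst z) \/ 1 <= Rabs (snd z) -> f z = 0.

Definition square_integral (f : R * R -> R) : R :=
  RInt (fun x => RInt (fun y => f (x, y)) (-1) 1) (-1) 1.

Lemma is_RInt_zero (g : R -> R) a b : (forall x, Rmin a b < x < Rmax a b -> g x = 0) -> is_RInt g a b 0.
Proof.
  intros H. apply (is_RInt_ext (fun _ => 0)); [intros; symmetry; now apply H|].
  evar_last; [apply (is_RInt_const (V := R_NormedModule))|].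
  unfold scal; simpl; unfold mult; simpl. ring.
Qed.

Lemma RInt_zero (g : R -> R) a b : (forall x, Rmin a b < x < Rmax a b -> g x = 0) -> RInt g a b = 0.
Proof. intros H. apply is_RInt_unique. now apply is_RInt_zero. Qed.

Lemma is_RInt_supported (g : R -> R) a b : (forall x, continuous g x) ->
  (forall x, 1 <= Rabs x -> g x = 0) -> a < -1 -> 1 < b -> is_RInt g a b (RInt g (-1) 1).
Proof.
  intros Hc H0 Ha Hb.
  assert (A1 : is_RInt g a (-1) 0).
  { apply is_RInt_zero. intros x Hx. rewrite Rmin_left, Rmax_right in Hx by lra.
    apply H0. rewrite Rabs_left; lra. }
  assert (A2 : is_RInt g 1 b 0).
  { apply is_RInt_zero. intros x Hx. rewrite Rmin_left, Rmax_right in Hx by lra.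
    apply H0. rewrite Rabs_pos_eq; lra. }
  assert (A3 : is_RInt g (-1) 1 (RInt g (-1) 1)).
  { apply (RInt_correct (V := R_CompleteNormedModule)).
    apply (ex_RInt_continuous (V := R_CompleteNormedModule)). intros; apply Hc. }
  pose proof (is_RInt_Chasles _ _ _ _ _ _ (is_RInt_Chasles _ _ _ _ _ _ A1 A3) A2) as A.
  unfold plus in A; simpl in A. rewrite Rplus_0_l, Rplus_0_r in A. exact A.
Qed.

Lemma is_RInt_gen_supported (g : R -> R) : (forall x, continuous g x) ->
  (forall x, 1 <= Rabs x -> g x = 0) ->
  is_RInt_gen g (Rbar_locally m_infty) (Rbar_locally p_infty) (RInt g (-1) 1).
Proof.
  intros Hc H0 P [eps HP]. unfold filtermapi.
  apply (Filter_prod _ _ _ (fun a => a < -1) (fun b => 1 < b)).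
  - exists (-1). auto.
  - exists 1. auto.
  - intros a b Ha Hb. exists (RInt g (-1) 1). split; [|apply HP, ball_center].
    now apply is_RInt_supported.
Qed.

Lemma RInt_gen_supported (g : R -> R) : (forall x, continuous g x) ->
  (forall x, 1 <= Rabs x -> g x = 0) ->
  RInt_gen g (Rbar_locally m_infty) (Rbar_locally p_infty) = RInt g (-1) 1.
Proof. intros. apply is_RInt_gen_unique. now apply is_RInt_gen_supported. Qed.

Lemma continuous_slice_y (f : R * R -> R) x y : continuous f (x, y) -> continuous (fun y => f (x, y)) y.
Proof.
  intros H. apply (continuous_comp_2 (fun _ => x) (fun y => y) (fun a b => f (a, b))).
  - apply continuous_const.
  - apply continuous_id.
  - apply (continuous_ext f); [now intros [a b]|easy].
Qed.

Lemma continuity_2d_of_continuous (f : R * R -> R) x y : continuous f (x, y) ->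
  continuity_2d_pt (fun a b => f (a, b)) x y.
Proof.
  intros H. apply continuity_2d_pt_filterlim.
  apply (filterlim_ext f); [now intros [a b]|exact H].
Qed.

Section Square.
Variable f : R * R -> R.
Hypothesis Hf : forall z, continuous f z.

Lemma ex_RInt_inner x : ex_RInt (fun y => f (x, y)) (-1) 1.
Proof.
  apply (ex_RInt_continuous (V := R_CompleteNormedModule)). intros y _. now apply continuous_slice_y.
Qed.

(** Uniform continuity of f on the compact rectangle [x - 1, x + 1] times [-1, 1]. *)
Lemma inner_continuous x : continuous (fun x => RInt (fun y => f (x, y)) (-1) 1) x.
Proof.
  apply continuity_pt_filterlim. intros eps Heps.
  assert (He : 0 < eps / 3) by lra.
  destruct (uniform_continuity_2d (fun a b => f (a, b)) (x - 1) (x + 1) (-1) 1) with (eps := mkposreal _ He) as [d Hd].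
  { intros a b _ _. now apply continuity_2d_of_continuous. }
  exists (Rmin d 1). split; [apply Rmin_glb_lt; [apply cond_pos|lra]|].
  intros x' [_ Hx']. simpl in *. unfold Rdist in *.
  assert (H1 : Rabs (x' - x) < d) by (eapply Rlt_le_trans; [apply Hx'|apply Rmin_l]).
  assert (H2 : Rabs (x' - x) < 1) by (eapply Rlt_le_trans; [apply Hx'|apply Rmin_r]).
  apply Rabs_lt_between in H2.
  assert (HL : forall g h, (forall y, continuous g y) -> (forall y, continuous h y) ->
     (forall y, -1 < y < 1 -> g y <= h y + eps / 3) -> RInt g (-1) 1 <= RInt h (-1) 1 + 2 * (eps / 3)).
  { intros g h Hg Hh Hgh.
    assert (Eh : ex_RInt h (-1) 1) by (apply (ex_RInt_continuous (V := R_CompleteNormedModule)); auto).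
    assert (Ec : ex_RInt (fun _ : R => eps / 3) (-1) 1) by apply ex_RInt_const.
    replace (RInt h (-1) 1 + 2 * (eps / 3)) with (RInt (fun y => plus (h y) (eps / 3)) (-1) 1).
    - apply RInt_le; [lra| | |exact Hgh].
      + apply (ex_RInt_continuous (V := R_CompleteNormedModule)); auto.
      + apply (ex_RInt_plus (V := R_NormedModule)); auto.
    - rewrite (RInt_plus (V := R_CompleteNormedModule)) by auto.
      rewrite (RInt_const (V := R_CompleteNormedModule)). unfold plus, scal; simpl. unfold mult; simpl. ring. }
  assert (Hfc : forall a y, continuous (fun y => f (a, y)) y) by (intros; now apply continuous_slice_y).
  assert (A : forall a b, Rabs (a - x) < 1 -> Rabs (b - x) < 1 -> Rabs (a - b) < d ->
     RInt (fun y => f (a, y)) (-1) 1 <= RInt (fun y => f (b, y)) (-1) 1 + 2 * (eps / 3)).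
  { intros a b Ha Hb Hab. apply HL; auto. intros y Hy.
    apply Rabs_lt_between in Ha, Hb.
    specialize (Hd b y a y ltac:(lra) ltac:(lra) ltac:(lra) ltac:(lra) Hab).
    rewrite Rminus_diag, Rabs_R0 in Hd. specialize (Hd (cond_pos d)).
    simpl in Hd. apply Rabs_lt_between in Hd. lra. }
  assert (B0 : Rabs (x - x) < 1) by (rewrite Rminus_diag, Rabs_R0; lra).
  assert (B1 : Rabs (x' - x) < 1) by (apply Rabs_lt_between; lra).
  pose proof (A x' x B1 B0 H1). pose proof (A x x' B0 B1 ltac:(rewrite Rabs_minus_sym; easy)).
  apply Rabs_lt_between. lra.
Qed.

Lemma ex_RInt_outer : ex_RInt (fun x => RInt (fun y => f (x, y)) (-1) 1) (-1) 1.
Proof. apply (ex_RInt_continuous (V := R_CompleteNormedModule)). intros x _. apply inner_continuous. Qed.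

Lemma integral2_square : off_square f -> integral2 f = square_integral f.
Proof.
  intros H0. unfold integral2, square_integral.
  assert (E : forall x, RInt_gen (fun y => f (x, y)) (Rbar_locally m_infty) (Rbar_locally p_infty)
     = RInt (fun y => f (x, y)) (-1) 1).
  { intros x. apply RInt_gen_supported.
    - intros y. now apply continuous_slice_y.
    - intros y Hy. apply H0. now right. }
  set (g := fun x => RInt (fun y => f (x, y)) (-1) 1).
  assert (Hg : forall x, continuous g x) by (intros; apply inner_continuous).
  assert (Hg0 : forall x, 1 <= Rabs x -> g x = 0).
  { intros x Hx. apply RInt_zero. intros y _. apply H0. now left. }
  rewrite <- (RInt_gen_supported g) by easy. symmetry.
  apply (RInt_gen_ext_eq (V := R_CompleteNormedModule)).
  - intros x. symmetry. apply E.
  - eexists. now apply is_RInt_gen_supported.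
Qed.
End Square.

Lemma square_integral_le (f g : R * R -> R) : (forall z, continuous f z) -> (forall z, continuous g z) ->
  (forall z, f z <= g z) -> square_integral f <= square_integral g.
Proof.
  intros Hf Hg H. apply RInt_le; [lra|now apply ex_RInt_outer|now apply ex_RInt_outer|].
  intros x _. apply RInt_le; [lra|now apply ex_RInt_inner|now apply ex_RInt_inner|].
  intros y _. apply H.
Qed.

Lemma square_integral_ext (f g : R * R -> R) : (forall z, f z = g z) -> square_integral f = square_integral g.
Proof. intros H. apply RInt_ext. intros x _. apply RInt_ext. intros y _. apply H. Qed.

Lemma square_integral_plus (f g : R * R -> R) : (forall z, continuous f z) -> (forall z, continuous g z) ->
  square_integral (fun z => f z + g z) = square_integral f + square_integral g.
Proof.
  intros Hf Hg. unfold square_integral.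
  rewrite <- (RInt_plus (V := R_CompleteNormedModule)) by now apply ex_RInt_outer.
  apply RInt_ext. intros x _.
  apply (RInt_plus (V := R_CompleteNormedModule)); now apply ex_RInt_inner.
Qed.

Lemma square_integral_scal c (f : R * R -> R) : (forall z, continuous f z) ->
  square_integral (fun z => c * f z) = c * square_integral f.
Proof.
  intros Hf. unfold square_integral.
  rewrite <- (RInt_scal (V := R_CompleteNormedModule)) by now apply ex_RInt_outer.
  apply RInt_ext. intros x _.
  apply (RInt_scal (V := R_CompleteNormedModule)); now apply ex_RInt_inner.
Qed.

Lemma square_integral_const c : square_integral (fun _ => c) = 4 * c.
Proof.
  unfold square_integral. rewrite !(RInt_const (V := R_CompleteNormedModule)).
  unfold scal; simpl; unfold mult; simpl. ring.
Qed.

Lemma square_integral_ge0 (f : R * R -> R) : (forall z, continuous f z) -> (forall z, 0 <= f z) -> 0 <= square_integral f.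
Proof.
  intros Hf H. replace 0 with (square_integral (fun _ => 0)) by (rewrite square_integral_const; ring).
  apply square_integral_le; auto. intros z. apply continuous_const.
Qed.

Lemma RInt_ge_sub (g : R -> R) c x0 d : (forall x, continuous g x) -> (forall x, 0 <= g x) -> 0 <= d ->
  -1 <= x0 - d -> x0 + d <= 1 -> (forall x, x0 - d <= x <= x0 + d -> c <= g x) -> 2 * d * c <= RInt g (-1) 1.
Proof.
  intros Hc H0 Hd Hl Hr Hg.
  assert (Hex : forall a b, ex_RInt g a b).
  { intros a b. apply (ex_RInt_continuous (V := R_CompleteNormedModule)). intros; apply Hc. }
  assert (Hnn : forall a b, a <= b -> 0 <= RInt g a b).
  { intros a b Hab. apply RInt_ge_0; auto. }
  rewrite <- (RInt_Chasles g (-1) (x0 - d) 1) by apply Hex.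
  rewrite <- (RInt_Chasles g (x0 - d) (x0 + d) 1) by apply Hex.
  unfold plus; simpl.
  pose proof (Hnn (-1) (x0 - d) Hl). pose proof (Hnn (x0 + d) 1 Hr).
  assert (2 * d * c <= RInt g (x0 - d) (x0 + d)); [|lra].
  replace (2 * d * c) with (RInt (fun _ => c) (x0 - d) (x0 + d)).
  - apply RInt_le; [lra|apply ex_RInt_const|apply Hex|]. intros; apply Hg; lra.
  - rewrite (RInt_const (V := R_CompleteNormedModule)). unfold scal; simpl; unfold mult; simpl. ring.
Qed.

Lemma square_integral_ge_sub (f : R * R -> R) c x0 y0 d : (forall z, continuous f z) -> (forall z, 0 <= f z) -> 0 <= d ->
  -1 <= x0 - d -> x0 + d <= 1 -> -1 <= y0 - d -> y0 + d <= 1 ->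
  (forall x y, x0 - d <= x <= x0 + d -> y0 - d <= y <= y0 + d -> c <= f (x, y)) ->
  4 * d ^ 2 * c <= square_integral f.
Proof.
  intros Hf H0 Hd H1 H2 H3 H4 H.
  replace (4 * d ^ 2 * c) with (2 * d * (2 * d * c)) by ring.
  apply (RInt_ge_sub _ _ x0); auto.
  - intros; now apply inner_continuous.
  - intros x. apply RInt_ge_0; [lra|now apply ex_RInt_inner|auto].
  - intros x Hx. apply (RInt_ge_sub _ _ y0); auto. intros y. now apply continuous_slice_y.
Qed.

Lemma square_integral_gt0 (f : R * R -> R) z0 : (forall z, continuous f z) -> (forall z, 0 <= f z) -> off_square f ->
  f z0 <> 0 -> 0 < square_integral f.
Proof.
  intros Hf H0 Hoff Hz. destruct z0 as [x0 y0].
  assert (Hp : 0 < f (x0, y0)) by (specialize (H0 (x0, y0)); lra).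
  assert (Hx : Rabs x0 < 1).
  { destruct (Rlt_dec (Rabs x0) 1); [easy|]. exfalso. apply Hz, Hoff. left. simpl. lra. }
  assert (Hy : Rabs y0 < 1).
  { destruct (Rlt_dec (Rabs y0) 1); [easy|]. exfalso. apply Hz, Hoff. right. simpl. lra. }
  pose proof (continuity_2d_of_continuous f x0 y0 (Hf _)) as Hc.
  assert (He : 0 < f (x0, y0) / 2) by lra.
  destruct (Hc (mkposreal _ He)) as [d Hd]. simpl in Hd.
  apply Rabs_lt_between in Hx, Hy.
  set (e := Rmin (d / 2) (Rmin (Rmin (1 - x0) (1 + x0)) (Rmin (1 - y0) (1 + y0)))).
  pose proof (cond_pos d).
  assert (0 < e) by (repeat apply Rmin_glb_lt; lra).
  assert (e <= d / 2 /\ e <= 1 - x0 /\ e <= 1 + x0 /\ e <= 1 - y0 /\ e <= 1 + y0).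
  { unfold e. pose proof (Rmin_l (d / 2) (Rmin (Rmin (1 - x0) (1 + x0)) (Rmin (1 - y0) (1 + y0)))).
    pose proof (Rmin_r (d / 2) (Rmin (Rmin (1 - x0) (1 + x0)) (Rmin (1 - y0) (1 + y0)))).
    pose proof (Rmin_l (Rmin (1 - x0) (1 + x0)) (Rmin (1 - y0) (1 + y0))).
    pose proof (Rmin_r (Rmin (1 - x0) (1 + x0)) (Rmin (1 - y0) (1 + y0))).
    pose proof (Rmin_l (1 - x0) (1 + x0)). pose proof (Rmin_r (1 - x0) (1 + x0)).
    pose proof (Rmin_l (1 - y0) (1 + y0)). pose proof (Rmin_r (1 - y0) (1 + y0)). lra. }
  apply Rlt_le_trans with (4 * e ^ 2 * (f (x0, y0) / 2)); [apply Rmult_lt_0_compat; nra|].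
  apply (square_integral_ge_sub f _ x0 y0); auto; try lra.
  intros x y Hxx Hyy.
  specialize (Hd x y ltac:(apply Rabs_lt_between; lra) ltac:(apply Rabs_lt_between; lra)).
  simpl in Hd. apply Rabs_lt_between in Hd. lra.
Qed.

Lemma C1_ex1 u x y : C1_2d u -> ex_derive (fun t => u (t, y)) x.
Proof. intros H. now destruct (H (x, y)) as [A _]. Qed.

Lemma C1_ex2 u x y : C1_2d u -> ex_derive (fun t => u (x, t)) y.
Proof. intros H. now destruct (H (x, y)) as [_ [A _]]. Qed.

Lemma C1_continuous u z : C1_2d u -> continuous u z.
Proof. intros H. now destruct (H z) as [_ [_ [A _]]]. Qed.

Lemma C1_d1_continuous u z : C1_2d u -> continuous (d1 u) z.
Proof. intros H. now destruct (H z) as [_ [_ [_ [A _]]]]. Qed.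

Lemma C1_d2_continuous u z : C1_2d u -> continuous (d2 u) z.
Proof. intros H. now destruct (H z) as [_ [_ [_ [_ A]]]]. Qed.

Lemma square_integral_d2 (F G : R * R -> R) : (forall x y, is_derive (fun t => F (x, t)) y (G (x, y))) ->
  (forall z, continuous G z) -> off_square F -> square_integral G = 0.
Proof.
  intros HF HG H0. unfold square_integral.
  apply RInt_zero. intros x _. rewrite (is_RInt_unique _ _ _ (minus (F (x, 1)) (F (x, -1)))).
  - rewrite !H0; [unfold minus, plus, opp; simpl; ring|right; simpl; unfold Rabs; destruct Rcase_abs; lra..].
  - apply (is_RInt_derive (V := R_CompleteNormedModule) (fun y => F (x, y)) (fun y => G (x, y))).
    + intros y _. apply HF.
    + intros y _. now apply continuous_slice_y.
Qed.

(** The variable x is integrated last, so unlike the y-derivative this one needs differentiation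
    under the integral sign before the fundamental theorem. *)
Lemma square_integral_d1 (F G : R * R -> R) : (forall x y, is_derive (fun t => F (t, y)) x (G (x, y))) ->
  (forall z, continuous F z) -> (forall z, continuous G z) -> off_square F -> square_integral G = 0.
Proof.
  intros HF HFc HG H0. unfold square_integral.
  assert (HD : forall x y, Derive (fun t => F (t, y)) x = G (x, y)) by (intros; apply is_derive_unique, HF).
  rewrite (is_RInt_unique _ _ _ (minus (RInt (fun y => F (1, y)) (-1) 1) (RInt (fun y => F (-1, y)) (-1) 1))).
  - assert (Z : forall x, 1 <= Rabs x -> RInt (fun y => F (x, y)) (-1) 1 = 0).
    { intros x Hx. apply RInt_zero. intros y _. apply H0. now left. }
    rewrite !Z; [unfold minus, plus, opp; simpl; ring|unfold Rabs; destruct Rcase_abs; lra..].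
  - apply (is_RInt_derive (V := R_CompleteNormedModule) (fun x => RInt (fun y => F (x, y)) (-1) 1)
      (fun x => RInt (fun y => G (x, y)) (-1) 1)).
    + intros x _. rewrite <- (RInt_ext (fun y => Derive (fun t => F (t, y)) x)) by (intros; apply HD).
      apply (is_derive_RInt_param (fun x y => F (x, y)) (-1) 1 x).
      * exists (mkposreal 1 Rlt_0_1). intros x' _ y _. eexists. apply HF.
      * intros y _. apply (continuity_2d_pt_ext (fun a b => G (a, b))); [intros; symmetry; apply HD|].
        now apply continuity_2d_of_continuous.
      * exists (mkposreal 1 Rlt_0_1). intros x' _. now apply ex_RInt_inner.
    + intros x _. now apply inner_continuous.
Qed.

(** * First eigenvalue as a function of the exponent *)

Lemma exp_convex t x y : 0 <= t <= 1 -> exp ((1 - t) * x + t * y) <= (1 - t) * exp x + t * exp y.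
Proof.
  intros Ht. set (m := (1 - t) * x + t * y).
  assert (H : forall z, exp m * (1 + (z - m)) <= exp z).
  { intros z. replace (exp z) with (exp m * exp (z - m)) by (rewrite <- exp_plus; f_equal; ring).
    apply Rmult_le_compat_l; [left; apply exp_pos|apply exp_ineq1_le]. }
  pose proof (H x). pose proof (H y). pose proof (exp_pos m).
  assert ((1 - t) * (exp m * (1 + (x - m))) <= (1 - t) * exp x) by (apply Rmult_le_compat_l; lra).
  assert (t * (exp m * (1 + (y - m))) <= t * exp y) by (apply Rmult_le_compat_l; lra).
  assert ((1 - t) * (exp m * (1 + (x - m))) + t * (exp m * (1 + (y - m))) = exp m) by (unfold m; ring).
  lra.
Qed.

Lemma young a b t : 0 <= a -> 0 <= b -> 0 <= t <= 1 ->
  powp a (1 - t) * powp b t <= (1 - t) * a + t * b.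
Proof.
  intros [Ha|<-] [Hb|<-] Ht; try (rewrite ?powp_0; nra).
  rewrite !powp_Rpower by easy. unfold Rpower. rewrite <- exp_plus.
  eapply Rle_trans; [now apply exp_convex|]. rewrite !exp_ln by easy. lra.
Qed.

(** Log-linear in the exponent, hence convex. This inequality replaces limit theorems for integrals
    when the exponent of a Rayleigh quotient varies. *)
Lemma powp_convex s a b t : 0 <= s -> 0 <= t <= 1 ->
  powp s ((1 - t) * a + t * b) <= (1 - t) * powp s a + t * powp s b.
Proof.
  intros [Hs|<-] Ht; [|rewrite !powp_0; lra].
  rewrite !powp_Rpower by easy. unfold Rpower.
  replace (((1 - t) * a + t * b) * ln s) with ((1 - t) * (a * ln s) + t * (b * ln s)) by ring.
  now apply exp_convex.
Qed.

Lemma powp_sqrt s p : 0 <= s -> powp (sqrt s) p = powp s (p / 2).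
Proof.
  intros [Hs|<-]; [|now rewrite sqrt_0, !powp_0].
  rewrite powp_Rpower by now apply sqrt_lt_R0.
  rewrite <- Rpower_sqrt by easy. rewrite Rpower_mult, powp_Rpower by easy. f_equal. field.
Qed.

Definition grad_norm (u : R * R -> R) z := sqrt (d1 u z ^ 2 + d2 u z ^ 2).

Lemma grad_norm_ge0 u z : 0 <= grad_norm u z.
Proof. apply sqrt_pos. Qed.

Lemma sum_sq_ge0 x y : 0 <= x ^ 2 + y ^ 2.
Proof. pose proof (pow2_ge_0 x). pose proof (pow2_ge_0 y). lra. Qed.

Lemma continuous_sq (f : R * R -> R) z : continuous f z -> continuous (fun z => f z ^ 2) z.
Proof.
  intros H. apply (continuous_ext (fun z => f z * f z)).
  - intros w. change (@eq R (f w * f w) (f w ^ 2)). ring.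
  - now apply (continuous_mult f f).
Qed.

Lemma continuous_powp_grad p u z : 0 < p -> C1_2d u -> continuous (fun z => powp (grad_norm u z) p) z.
Proof.
  intros Hp Hu.
  apply (continuous_ext (fun z => powp (Rabs (d1 u z ^ 2 + d2 u z ^ 2)) (p / 2))).
  - intros w. unfold grad_norm. pose proof (sum_sq_ge0 (d1 u w) (d2 u w)).
    rewrite Rabs_pos_eq, powp_sqrt; easy.
  - apply (continuous_comp (fun z => d1 u z ^ 2 + d2 u z ^ 2) (fun s => powp (Rabs s) (p / 2))).
    + apply (continuous_plus (fun z => d1 u z ^ 2) (fun z => d2 u z ^ 2)); apply continuous_sq.
      * now apply C1_d1_continuous.
      * now apply C1_d2_continuous.
    + apply powp_continuous. lra.
Qed.

Lemma continuous_powp_abs p (u : R * R -> R) z : 0 < p -> continuous u z -> continuous (fun z => powp (Rabs (u z)) p) z.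
Proof.
  intros Hp Hu. apply (continuous_comp u (fun s => powp (Rabs s) p)); [easy|now apply powp_continuous].
Qed.

Definition admissible (Omega : R * R -> Prop) (u : R * R -> R) :=
  C1_2d u /\ compact_supp_in Omega u /\ exists z, u z <> 0.

Lemma dist2_lt z w d : 0 < d -> Rabs (fst z - fst w) < d / 2 -> Rabs (snd z - snd w) < d / 2 -> dist2 z w < d.
Proof.
  intros Hd H1 H2. unfold dist2. rewrite <- (sqrt_pow2 d) by lra.
  apply sqrt_lt_1; [apply sum_sq_ge0|apply pow2_ge_0|].
  rewrite <- (pow2_abs (fst z - fst w)), <- (pow2_abs (snd z - snd w)).
  pose proof (Rabs_pos (fst z - fst w)). pose proof (Rabs_pos (snd z - snd w)). nra.
Qed.

Lemma supp_locally_zero Omega u z : compact_supp_in Omega u -> ~ Omega z ->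
  exists d, 0 < d /\ forall w, Rabs (fst w - fst z) < d -> Rabs (snd w - snd z) < d -> u w = 0.
Proof.
  intros [d [Hd H]] Hz. exists (d / 2). split; [lra|]. intros w H1 H2.
  destruct (Req_dec (u w) 0) as [|Hn]; [easy|exfalso].
  specialize (H w z Hn Hz). pose proof (dist2_lt w z d Hd H1 H2). lra.
Qed.

Lemma locally_abs (x d : R) (P : R -> Prop) : 0 < d -> (forall y, Rabs (y - x) < d -> P y) -> locally x P.
Proof.
  intros Hd H. exists (mkposreal d Hd). intros y Hy. apply H. exact Hy.
Qed.

Lemma Derive_locally_zero (f : R -> R) x d : 0 < d -> (forall y, Rabs (y - x) < d -> f y = 0) -> Derive f x = 0.
Proof.
  intros Hd H. rewrite (Derive_ext_loc f (fun _ => 0)); [apply Derive_const|].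
  now apply (locally_abs x d).
Qed.

Lemma grad_zero_off Omega u z : compact_supp_in Omega u -> ~ Omega z -> u z = 0 /\ d1 u z = 0 /\ d2 u z = 0.
Proof.
  intros Hu Hz. destruct (supp_locally_zero Omega u z Hu Hz) as [d [Hd H]].
  assert (H0 : forall x, Rabs (x - x) < d) by (intros; rewrite Rminus_diag, Rabs_R0; easy).
  split; [|split].
  - now apply H.
  - apply (Derive_locally_zero _ _ d Hd). intros y Hy. now apply H.
  - apply (Derive_locally_zero _ _ d Hd). intros y Hy. now apply H.
Qed.

Section Bounded.
Variable Omega : R * R -> Prop.
Hypothesis HO : forall z, Omega z -> Rabs (fst z) < 1 /\ Rabs (snd z) < 1.

Lemma off_square_not z : 1 <= Rabs (fst z) \/ 1 <= Rabs (snd z) -> ~ Omega z.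
Proof. intros H Hz. apply HO in Hz. lra. Qed.

Definition dirichlet p (u : R * R -> R) := square_integral (fun z => powp (grad_norm u z) p).
Definition mass p (u : R * R -> R) := square_integral (fun z => powp (Rabs (u z)) p).

Lemma rayleigh_eq p u : 0 < p -> admissible Omega u -> rayleigh p u = dirichlet p u / mass p u.
Proof.
  intros Hp [Hu [Hs _]]. unfold rayleigh. f_equal; [|f_equal].
  - apply (integral2_square (fun z => powp (grad_norm u z) p)).
    + intros z. now apply continuous_powp_grad.
    + intros z Hz. apply off_square_not in Hz. destruct (grad_zero_off Omega u z Hs Hz) as [_ [E1 E2]].
      unfold grad_norm. rewrite E1, E2. replace (0 ^ 2 + 0 ^ 2) with 0 by ring. now rewrite sqrt_0, powp_0.
  - apply integral2_square.
    + intros z. apply continuous_powp_abs; [easy|now apply C1_continuous].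
    + intros z Hz. apply off_square_not in Hz. destruct (grad_zero_off Omega u z Hs Hz) as [E _].
      now rewrite E, Rabs_R0, powp_0.
Qed.

Lemma mass_pos p u : 0 < p -> admissible Omega u -> 0 < mass p u.
Proof.
  intros Hp [Hu [Hs [z Hz]]]. apply (square_integral_gt0 _ z).
  - intros w. apply continuous_powp_abs; [easy|now apply C1_continuous].
  - intros w. apply powp_ge0.
  - intros w Hw. apply off_square_not in Hw. destruct (grad_zero_off Omega u w Hs Hw) as [E _].
    now rewrite E, Rabs_R0, powp_0.
  - apply powp_neq0. now apply Rabs_no_R0.
Qed.

Lemma dirichlet_ge0 p u : 0 < p -> C1_2d u -> 0 <= dirichlet p u.
Proof.
  intros Hp Hu. apply square_integral_ge0.
  - intros. now apply continuous_powp_grad.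
  - intros. apply powp_ge0.
Qed.

Lemma rayleigh_ge0 p u : 0 < p -> admissible Omega u -> 0 <= rayleigh p u.
Proof.
  intros Hp Hu. rewrite rayleigh_eq by easy.
  apply Rdiv_le_0_compat; [apply dirichlet_ge0; [easy|apply Hu]|now apply mass_pos].
Qed.

Lemma rayleigh_lt p u L : 0 < p -> admissible Omega u -> rayleigh p u < L <-> dirichlet p u < L * mass p u.
Proof.
  intros Hp Hu. rewrite rayleigh_eq by easy. pose proof (mass_pos p u Hp Hu) as Hm. split; intros H.
  - apply (Rmult_lt_compat_r (mass p u)) in H; [|easy]. unfold Rdiv in H. rewrite Rmult_assoc, Rinv_l in H; lra.
  - apply Rmult_lt_reg_r with (mass p u); [easy|]. unfold Rdiv. rewrite Rmult_assoc, Rinv_l; lra.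
Qed.

Lemma lambda1_spec p : 0 < p -> (exists u, admissible Omega u) ->
  exists T : R, lambda1 Omega p = Finite T /\
    (forall u, admissible Omega u -> T <= rayleigh p u) /\
    (forall L, T < L -> exists u, admissible Omega u /\ rayleigh p u < L).
Proof.
  intros Hp [u0 Hu0]. unfold lambda1.
  set (E := fun l => exists u, C1_2d u /\ compact_supp_in Omega u /\ (exists z, u z <> 0) /\ l = rayleigh p u).
  assert (HE : forall l, E l <-> exists u, admissible Omega u /\ l = rayleigh p u).
  { intros l. split.
    - intros [u [H1 [H2 [H3 H4]]]]. exists u. split; [split; [|split]|]; auto.
    - intros [u' [[H1 [H2 H3]] H4]]. exists u'. auto. }
  destruct (Glb_Rbar_correct E) as [Hlb Hglb].
  assert (Hfin : exists T : R, Glb_Rbar E = Finite T).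
  { destruct (Glb_Rbar E) as [T| |] eqn:EG.
    - now exists T.
    - exfalso. exact (Hlb (rayleigh p u0) (proj2 (HE _) (ex_intro _ u0 (conj Hu0 eq_refl)))).
    - exfalso. apply (Hglb (Finite 0)). intros l Hl. apply HE in Hl. destruct Hl as [u [Hu ->]].
      now apply rayleigh_ge0. }
  destruct Hfin as [T HT]. exists T. rewrite HT in *. split; [easy|]. split.
  - intros u Hu. apply (Hlb (rayleigh p u)). apply HE. now exists u.
  - intros L HL. apply NNPP. intros Hno.
    assert (Rbar_le (Finite L) (Finite T)); [|simpl in *; lra].
    apply Hglb. intros l Hl. apply HE in Hl. destruct Hl as [u [Hu ->]].
    simpl. destruct (Rle_dec L (rayleigh p u)) as [|Hn]; [easy|]. exfalso. apply Hno. exists u. split; [easy|lra].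
Qed.

(** p - t is the convex combination of p and p - 1 with weights 1 - t and t. *)
Lemma dirichlet_convex p t u : 2 < p -> 0 <= t <= 1 -> C1_2d u ->
  dirichlet (p - t) u <= (1 - t) * dirichlet p u + t * dirichlet (p - 1) u.
Proof.
  intros Hp Ht Hu. unfold dirichlet.
  assert (C : forall q, 0 < q -> forall z, continuous (fun z => powp (grad_norm u z) q) z)
    by (intros; now apply continuous_powp_grad).
  assert (C' : forall c q, 0 < q -> forall z, continuous (fun z => c * powp (grad_norm u z) q) z).
  { intros c q Hq z. apply (continuous_mult (fun _ => c)); [apply continuous_const|now apply C]. }
  rewrite <- !square_integral_scal by (apply C; lra).
  rewrite <- square_integral_plus by (apply C'; lra).
  apply square_integral_le.
  - apply C; lra.
  - intros z. apply (continuous_plus (fun z => (1 - t) * powp (grad_norm u z) p)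
      (fun z => t * powp (grad_norm u z) (p - 1))); apply C'; lra.
  - intros z. replace (p - t) with ((1 - t) * p + t * (p - 1)) by ring.
    apply powp_convex; [apply grad_norm_ge0|easy].
Qed.

(** A lower bound for the mass at p - t is needed, so here p is interpolated between p - t and p +
    1, with weights 1/(1+t) and t/(1+t). *)
Lemma mass_convex p t u : 2 < p -> 0 <= t <= 1 -> C1_2d u ->
  (1 + t) * mass p u <= mass (p - t) u + t * mass (p + 1) u.
Proof.
  intros Hp Ht Hu. unfold mass.
  assert (C : forall q, 0 < q -> forall z, continuous (fun z => powp (Rabs (u z)) q) z).
  { intros. apply continuous_powp_abs; [easy|now apply C1_continuous]. }
  assert (C' : forall c q, 0 < q -> forall z, continuous (fun z => c * powp (Rabs (u z)) q) z).
  { intros c q Hq z. apply (continuous_mult (fun _ => c)); [apply continuous_const|now apply C]. }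
  rewrite <- !square_integral_scal by (apply C; lra).
  rewrite <- square_integral_plus by (first [apply C | apply C']; lra).
  apply square_integral_le.
  - apply C'; lra.
  - intros z. apply (continuous_plus (fun z => powp (Rabs (u z)) (p - t))
      (fun z => t * powp (Rabs (u z)) (p + 1))); [apply C|apply C']; lra.
  - intros z. set (s := Rabs (u z)).
    assert (Hi : / (1 + t) * (1 + t) = 1) by (field; lra).
    assert (0 < / (1 + t)) by (apply Rinv_0_lt_compat; lra).
    pose proof (powp_convex s (p - t) (p + 1) (t / (1 + t)) (Rabs_pos _)) as HC.
    replace ((1 - t / (1 + t)) * (p - t) + t / (1 + t) * (p + 1)) with p in HC by (field; lra).
    specialize (HC ltac:(unfold Rdiv; split; nra)).
    apply (Rmult_le_compat_l (1 + t)) in HC; [|lra].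
    eapply Rle_trans; [apply HC|]. right. field. lra.
Qed.

(** The two convexity bounds perturb the strict inequality dirichlet < L mass by at most t times a
    constant, where t = p - q. *)
Lemma lambda1_left_usc p u L : 2 < p -> admissible Omega u -> rayleigh p u < L ->
  exists d, 0 < d /\ forall q, p - d < q <= p -> rayleigh q u < L.
Proof.
  intros Hp Hu HL. pose proof (rayleigh_ge0 p u ltac:(lra) Hu) as HR0.
  apply rayleigh_lt in HL; [|lra|easy].
  set (A := L * mass p u - dirichlet p u). assert (HA : 0 < A) by (unfold A; lra).
  set (B := Rabs (dirichlet (p - 1) u) + Rabs (dirichlet p u) + L * mass (p + 1) u + L * mass p u).
  assert (HL0 : 0 < L).
  { pose proof (mass_pos p u ltac:(lra) Hu). pose proof (dirichlet_ge0 p u ltac:(lra) (proj1 Hu)). nra. }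
  assert (HB : 0 <= B).
  { pose proof (mass_pos p u ltac:(lra) Hu). pose proof (mass_pos (p + 1) u ltac:(lra) Hu).
    pose proof (Rabs_pos (dirichlet (p - 1) u)). pose proof (Rabs_pos (dirichlet p u)).
    assert (0 <= L * mass (p + 1) u) by nra. assert (0 <= L * mass p u) by nra. unfold B. lra. }
  exists (Rmin 1 (A / (B + 1))).
  assert (0 < A / (B + 1)) by (apply Rdiv_lt_0_compat; lra).
  split; [apply Rmin_glb_lt; lra|]. intros q Hq.
  pose proof (Rmin_l 1 (A / (B + 1))). pose proof (Rmin_r 1 (A / (B + 1))).
  set (t := p - q). assert (Ht : 0 <= t <= 1) by (unfold t; lra).
  replace q with (p - t) by (unfold t; ring).
  apply rayleigh_lt; [lra|easy|].
  pose proof (dirichlet_convex p t u Hp Ht (proj1 Hu)) as HD.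
  pose proof (mass_convex p t u Hp Ht (proj1 Hu)) as HM.
  apply (Rmult_le_compat_l L) in HM; [|lra].
  assert (HtA : t * (B + 1) < A).
  { apply Rlt_le_trans with (A / (B + 1) * (B + 1)); [|right; field; lra].
    apply Rmult_lt_compat_r; [lra|]. unfold t. lra. }
  pose proof (Rle_abs (dirichlet (p - 1) u)).
  pose proof (Rabs_pos (dirichlet p u)). pose proof (Rle_abs (- dirichlet p u)) as Hn. rewrite Rabs_Ropp in Hn.
  pose proof (mass_pos p u ltac:(lra) Hu).
  assert (t * (dirichlet (p - 1) u - dirichlet p u + L * mass (p + 1) u) <= t * B).
  { apply Rmult_le_compat_l; [lra|]. unfold B. assert (0 <= L * mass p u) by nra. lra. }
  assert (0 <= t * (L * mass p u)) by (apply Rmult_le_pos; [lra|nra]).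
  unfold A in *. lra.
Qed.

(* v = |u|^(q/p) as a competitor at exponent p: p lambda_1(p)^(1/p) is nondecreasing in p. *)
Lemma power_competitor p q u lam : 2 <= p < q -> admissible Omega u -> 0 < lam -> rayleigh q u < lam ->
  exists v, admissible Omega v /\ rayleigh p v <= powp (q / p) p * powp lam (p / q).
Proof.
  intros Hpq Hu Hlam HR. pose proof Hu as [HC [Hs [z0 Hz0]]].
  (* s > 1 makes |x|^s a C^1 function, so that the competitor stays admissible. *)
  set (s := q / p). assert (Hs1 : 1 < s).
  { unfold s. apply Rmult_lt_reg_r with p; [lra|]. unfold Rdiv. rewrite Rmult_assoc, Rinv_l; lra. }
  set (v := fun z => powp (Rabs (u z)) s).
  assert (D1 : forall x y, is_derive (fun t => v (t, y)) x (d1 u (x, y) * (s * phi s (u (x, y))))).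
  { intros x y. apply (is_derive_comp (fun w => powp (Rabs w) s) (fun t => u (t, y))).
    - now apply is_derive_powp.
    - apply (Derive_correct (fun t => u (t, y)) x). now apply C1_ex1. }
  assert (D2 : forall x y, is_derive (fun t => v (x, t)) y (d2 u (x, y) * (s * phi s (u (x, y))))).
  { intros x y. apply (is_derive_comp (fun w => powp (Rabs w) s) (fun t => u (x, t))).
    - now apply is_derive_powp.
    - apply (Derive_correct (fun t => u (x, t)) y). now apply C1_ex2. }
  assert (E1 : forall z, d1 v z = d1 u z * (s * phi s (u z))).
  { intros [x y]. apply is_derive_unique, D1. }
  assert (E2 : forall z, d2 v z = d2 u z * (s * phi s (u z))).
  { intros [x y]. apply is_derive_unique, D2. }
  assert (Cphi : forall z, continuous (fun z => s * phi s (u z)) z).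
  { intros z. apply (continuous_mult (fun _ => s)); [apply continuous_const|].
    apply (continuous_comp u (phi s)); [now apply C1_continuous|now apply phi_continuous]. }
  assert (Hv : admissible Omega v).
  { split; [|split].
    - intros [x y]. split; [eexists; apply D1|]. split; [eexists; apply D2|]. split; [|split].
      + apply continuous_powp_abs; [lra|now apply C1_continuous].
      + apply (continuous_ext (fun z => d1 u z * (s * phi s (u z)))); [intros; now rewrite E1|].
        apply (continuous_mult (d1 u)); [now apply C1_d1_continuous|apply Cphi].
      + apply (continuous_ext (fun z => d2 u z * (s * phi s (u z)))); [intros; now rewrite E2|].
        apply (continuous_mult (d2 u)); [now apply C1_d2_continuous|apply Cphi].
    - destruct Hs as [d [Hd H]]. exists d. split; [easy|]. intros z w Hz Hw. apply H; [|easy].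
      intros E. apply Hz. unfold v. now rewrite E, Rabs_R0, powp_0.
    - exists z0. apply powp_neq0. now apply Rabs_no_R0. }
  exists v. split; [easy|].
  assert (Hmass : mass p v = mass q u).
  { apply square_integral_ext. intros z. unfold v. rewrite Rabs_pos_eq by apply powp_ge0.
    rewrite powp_powp by apply Rabs_pos. f_equal. unfold s. field. lra. }
  assert (Hgn : forall z, grad_norm v z = s * (powp (Rabs (u z)) (s - 1) * grad_norm u z)).
  { intros z. unfold grad_norm. rewrite E1, E2.
    replace ((d1 u z * (s * phi s (u z))) ^ 2 + (d2 u z * (s * phi s (u z))) ^ 2)
      with ((s * phi s (u z)) ^ 2 * (d1 u z ^ 2 + d2 u z ^ 2)) by ring.
    rewrite sqrt_mult by (first [apply pow2_ge_0 | apply sum_sq_ge0]).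
    rewrite <- pow2_abs, sqrt_pow2 by apply Rabs_pos.
    rewrite Rabs_mult, phi_abs, (Rabs_pos_eq s) by lra. ring. }
  set (th := p / q). assert (Hth : 0 <= th <= 1).
  { unfold th. split; [apply Rdiv_le_0_compat; lra|].
    apply Rmult_le_reg_r with q; [lra|]. unfold Rdiv. rewrite Rmult_assoc, Rinv_l; lra. }
  set (K := powp s p * powp lam th).
  assert (HK : 0 < K) by (apply Rmult_lt_0_compat; apply powp_gt0; lra).
  assert (Cg : forall c z, continuous (fun z => c * powp (grad_norm u z) q) z).
  { intros c z. apply (continuous_mult (fun _ => c)); [apply continuous_const|apply continuous_powp_grad; [lra|easy]]. }
  assert (Cm : forall c z, continuous (fun z => c * powp (Rabs (u z)) q) z).
  { intros c z. apply (continuous_mult (fun _ => c)); [apply continuous_const|].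
    apply continuous_powp_abs; [lra|now apply C1_continuous]. }
  assert (HD : dirichlet p v <= K * (1 - th) * mass q u + K * th / lam * dirichlet q u).
  { unfold dirichlet, mass.
    rewrite <- !square_integral_scal.
    2:{ intros; apply continuous_powp_grad; [lra|easy]. }
    2:{ intros; apply continuous_powp_abs; [lra|now apply C1_continuous]. }
    rewrite <- square_integral_plus by (first [apply Cm | apply Cg]).
    apply square_integral_le.
    - intros; apply continuous_powp_grad; [lra|apply Hv].
    - intros z. apply (continuous_plus (fun z => K * (1 - th) * powp (Rabs (u z)) q)
       (fun z => K * th / lam * powp (grad_norm u z) q)); [apply Cm|apply Cg].
    - intros z. rewrite Hgn.
      set (a := Rabs (u z)). assert (Ha : 0 <= a) by apply Rabs_pos.
      set (g := grad_norm u z). assert (Hg : 0 <= g) by apply grad_norm_ge0.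
      rewrite powp_mult by (first [lra | apply Rmult_le_pos; [apply powp_ge0|easy]]).
      rewrite powp_mult by (first [easy | apply powp_ge0]).
      rewrite powp_powp by easy.
      (* Pointwise Young with weights 1 - th and th stands in for Hoelder. Scaling the gradient by
         1/lam makes the integrals recombine: dirichlet < lam mass turns the sum into at most K
         times the mass. *)
      pose proof (young (powp a q) (powp g q * / lam) th (powp_ge0 _ _)) as HY.
      assert (Hil : 0 < / lam) by now apply Rinv_0_lt_compat.
      specialize (HY ltac:(apply Rmult_le_pos; [apply powp_ge0|lra]) Hth).
      rewrite powp_powp, powp_mult, powp_powp in HY by (first [easy | lra | apply powp_ge0]).
      replace (q * (1 - th)) with ((s - 1) * p) in HY by (unfold s, th; field; lra).
      replace (q * th) with p in HY by (unfold th; field; lra).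
      assert (Ell : powp lam th * powp (/ lam) th = 1).
      { rewrite <- powp_mult by lra. rewrite Rinv_r, powp_1l by lra. easy. }
      apply (Rmult_le_compat_l K) in HY; [|lra].
      replace (powp s p * (powp a ((s - 1) * p) * powp g p))
        with (K * (powp a ((s - 1) * p) * (powp g p * powp (/ lam) th))).
      2:{ unfold K. replace (powp s p * powp lam th * (powp a ((s - 1) * p) * (powp g p * powp (/ lam) th)))
           with (powp s p * (powp a ((s - 1) * p) * powp g p) * (powp lam th * powp (/ lam) th)) by ring.
          rewrite Ell. ring. }
      eapply Rle_trans; [apply HY|]. right. field. lra. }
  assert (Hle : dirichlet p v <= K * mass p v).
  { rewrite Hmass. apply rayleigh_lt in HR; [|lra|easy].
    assert (K * th / lam * dirichlet q u <= K * th / lam * (lam * mass q u)).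
    { apply Rmult_le_compat_l; [|lra]. apply Rdiv_le_0_compat; [apply Rmult_le_pos; lra|easy]. }
    replace (K * th / lam * (lam * mass q u)) with (K * th * mass q u) in H by (field; lra). lra. }
  rewrite rayleigh_eq by (first [lra | easy]).
  pose proof (mass_pos p v ltac:(lra) Hv).
  apply Rmult_le_reg_r with (mass p v); [easy|]. unfold Rdiv. rewrite Rmult_assoc, Rinv_l by lra. lra.
Qed.
End Bounded.

(** * Lower bound for the sector at exponent two *)

Ltac eq_in_R := match goal with |- ?a = ?b => change (@eq R a b) end.

(** * Real and imaginary parts of (x + i y)^n *)

Fixpoint cre (n : nat) (z : R * R) : R :=
  match n with O => 1 | S n => fst z * cre n z - snd z * cim n z end
with cim (n : nat) (z : R * R) : R :=
  match n with O => 0 | S n => fst z * cim n z + snd z * cre n z end.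

Lemma cpow_polar n r t :
  cre n (r * cos t, r * sin t) = r ^ n * cos (INR n * t) /\
  cim n (r * cos t, r * sin t) = r ^ n * sin (INR n * t).
Proof.
  induction n as [|n [IH1 IH2]].
  - simpl. rewrite Rmult_0_l, cos_0, sin_0. split; ring.
  - simpl cre. simpl cim. rewrite IH1, IH2, S_INR.
    replace ((INR n + 1) * t) with (INR n * t + t) by ring.
    rewrite cos_plus, sin_plus. simpl. split; ring.
Qed.

Lemma cre_S n (x y : R) : cre (S n) (x, y) = x * cre n (x, y) - y * cim n (x, y).
Proof. reflexivity. Qed.

Lemma cim_S n (x y : R) : cim (S n) (x, y) = x * cim n (x, y) + y * cre n (x, y).
Proof. reflexivity. Qed.

Lemma cpow_derive1 n (x y : R) :
  is_derive (fun t : R => cre n (t, y)) x (INR n * cre (n - 1) (x, y)) /\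
  is_derive (fun t : R => cim n (t, y)) x (INR n * cim (n - 1) (x, y)).
Proof.
  induction n as [|n [IH1 IH2]].
  - simpl. rewrite !Rmult_0_l. split; [exact (is_derive_const 1 x)|exact (is_derive_const 0 x)].
  - replace (S n - 1)%nat with n by lia. rewrite S_INR.
    set (f := fun t : R => cre n (t, y)) in *. set (g := fun t : R => cim n (t, y)) in *.
    split.
    + apply (is_derive_ext (fun t => t * f t - y * g t)); [easy|].
      auto_derive; [repeat split; first [exact I | now eexists; exact IH1 | now eexists; exact IH2]|].
      eval_derive.
      unfold f. destruct n as [|n]; [simpl; ring|].
      replace (S n - 1)%nat with n by lia. rewrite ?cre_S, ?cim_S. ring.
    + apply (is_derive_ext (fun t => t * g t + y * f t)); [easy|].
      auto_derive; [repeat split; first [exact I | now eexists; exact IH1 | now eexists; exact IH2]|].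
      eval_derive.
      unfold g. destruct n as [|n]; [simpl; ring|].
      replace (S n - 1)%nat with n by lia. rewrite ?cre_S, ?cim_S. ring.
Qed.

(** Compared with [cpow_derive1], these are the Cauchy-Riemann equations; they make Im(z^n)
    harmonic. *)
Lemma cpow_derive2 n (x y : R) :
  is_derive (fun t : R => cre n (x, t)) y (- (INR n * cim (n - 1) (x, y))) /\
  is_derive (fun t : R => cim n (x, t)) y (INR n * cre (n - 1) (x, y)).
Proof.
  induction n as [|n [IH1 IH2]].
  - simpl. rewrite !Rmult_0_l, Ropp_0. split; [exact (is_derive_const 1 y)|exact (is_derive_const 0 y)].
  - replace (S n - 1)%nat with n by lia. rewrite S_INR.
    set (f := fun t : R => cre n (x, t)) in *. set (g := fun t : R => cim n (x, t)) in *.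
    split.
    + apply (is_derive_ext (fun t => x * f t - t * g t)); [easy|].
      auto_derive; [repeat split; first [exact I | now eexists; exact IH1 | now eexists; exact IH2]|].
      eval_derive.
      unfold g. destruct n as [|n]; [simpl; ring|].
      replace (S n - 1)%nat with n by lia. rewrite ?cre_S, ?cim_S. ring.
    + apply (is_derive_ext (fun t => x * g t + t * f t)); [easy|].
      auto_derive; [repeat split; first [exact I | now eexists; exact IH1 | now eexists; exact IH2]|].
      eval_derive.
      unfold f. destruct n as [|n]; [simpl; ring|].
      replace (S n - 1)%nat with n by lia. rewrite ?cre_S, ?cim_S. ring.
Qed.

Lemma cont2_plus (f g : R * R -> R) z : continuous f z -> continuous g z -> continuous (fun z => f z + g z) z.
Proof. apply (continuous_plus f g). Qed.

Lemma cont2_minus (f g : R * R -> R) z : continuous f z -> continuous g z -> continuous (fun z => f z - g z) z.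
Proof. apply (continuous_minus f g). Qed.

Lemma cont2_opp (f : R * R -> R) z : continuous f z -> continuous (fun z => - f z) z.
Proof. apply (continuous_opp f). Qed.

Lemma cont2_mult (f g : R * R -> R) z : continuous f z -> continuous g z -> continuous (fun z => f z * g z) z.
Proof. apply (continuous_mult f g). Qed.

Lemma cont2_inv (f : R * R -> R) z : continuous f z -> f z <> 0 -> continuous (fun z => / f z) z.
Proof. intros H Hn. apply (continuous_comp f Rinv); [easy|now apply continuous_Rinv]. Qed.

Lemma cont2_const (c : R) (z : R * R) : continuous (fun _ => c) z.
Proof. apply continuous_const. Qed.

Lemma cont2_fst (z : R * R) : continuous (fun z => fst z) z.
Proof. apply (continuous_fst (U := R_UniformSpace) (V := R_UniformSpace)). Qed.

Lemma cont2_snd (z : R * R) : continuous (fun z => snd z) z.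
Proof. apply (continuous_snd (U := R_UniformSpace) (V := R_UniformSpace)). Qed.

Lemma cpow_continuous n z : continuous (cre n) z /\ continuous (cim n) z.
Proof.
  induction n as [|n [IH1 IH2]]; [split; apply cont2_const|].
  split.
  - apply cont2_minus; apply cont2_mult; auto using cont2_fst, cont2_snd.
  - apply cont2_plus; apply cont2_mult; auto using cont2_fst, cont2_snd.
Qed.

Lemma cre_continuous n z : continuous (fun z => cre n z) z.
Proof. exact (proj1 (cpow_continuous n z)). Qed.

Lemma cim_continuous n z : continuous (fun z => cim n z) z.
Proof. exact (proj2 (cpow_continuous n z)). Qed.

Ltac continuity2 :=
  lazymatch goal with
  | H : continuous ?f ?z |- continuous ?f ?z => exact H
  | |- continuous (fun _ => ?c) ?w => exact (cont2_const c w)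
  | |- continuous (fun z => fst z) ?w => exact (cont2_fst w)
  | |- continuous (fun z => snd z) ?w => exact (cont2_snd w)
  | |- continuous (fun z => cre ?n z) ?w => exact (cre_continuous n w)
  | |- continuous (fun z => cim ?n z) ?w => exact (cim_continuous n w)
  | |- continuous (fun z => @?f z + @?g z) ?w => refine (cont2_plus f g w _ _); continuity2
  | |- continuous (fun z => @?f z - @?g z) ?w => refine (cont2_minus f g w _ _); continuity2
  | |- continuous (fun z => @?f z * @?g z) ?w => refine (cont2_mult f g w _ _); continuity2
  | |- continuous (fun z => - @?f z) ?w => refine (cont2_opp f w _); continuity2
  | |- continuous (fun z => / @?f z) ?w => refine (cont2_inv f w _ _); [continuity2|]
  end.

(** [W] may be singular on the boundary and arbitrary outside, but off [Omega] the factor u vanishes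
    in a whole neighbourhood, so u^2 W is differentiable everywhere. *)
Lemma cutoff_derive1 Omega (u W Wx : R * R -> R) : C1_2d u -> compact_supp_in Omega u ->
  (forall x y : R, Omega (x, y) -> is_derive (fun t : R => W (t, y)) x (Wx (x, y))) ->
  forall x y : R, is_derive (fun t : R => u (t, y) * u (t, y) * W (t, y)) x
    (2 * u (x, y) * d1 u (x, y) * W (x, y) + u (x, y) * u (x, y) * Wx (x, y)).
Proof.
  intros HC Hs HW x y. destruct (classic (Omega (x, y))) as [Hz|Hz].
  - pose proof (Derive_correct (fun t : R => u (t, y)) x (C1_ex1 u x y HC)) as D.
    change (Derive (fun t : R => u (t, y)) x) with (d1 u (x, y)) in D.
    specialize (HW x y Hz). set (f := fun t : R => u (t, y)) in *. set (g := fun t : R => W (t, y)) in *.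
    apply (is_derive_ext (fun t => f t * f t * g t)); [easy|].
    auto_derive; [repeat split; first [exact I | now eexists; exact D | now eexists; exact HW]|].
    eval_derive.
    unfold f, g. ring.
  - destruct (grad_zero_off Omega u _ Hs Hz) as [-> [-> _]].
    destruct (supp_locally_zero Omega u _ Hs Hz) as [d [Hd H]]. simpl in H.
    replace (2 * 0 * 0 * W (x, y) + 0 * 0 * Wx (x, y)) with 0 by ring.
    apply (is_derive_ext_loc (fun _ => 0)); [|exact (is_derive_const 0 x)].
    apply (locally_abs x d _ Hd). intros t Ht. rewrite H; [eq_in_R; ring|easy|].
    simpl. rewrite Rminus_diag, Rabs_R0. easy.
Qed.

Lemma cutoff_derive2 Omega (u W Wy : R * R -> R) : C1_2d u -> compact_supp_in Omega u ->
  (forall x y : R, Omega (x, y) -> is_derive (fun t : R => W (x, t)) y (Wy (x, y))) ->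
  forall x y : R, is_derive (fun t : R => u (x, t) * u (x, t) * W (x, t)) y
    (2 * u (x, y) * d2 u (x, y) * W (x, y) + u (x, y) * u (x, y) * Wy (x, y)).
Proof.
  intros HC Hs HW x y. destruct (classic (Omega (x, y))) as [Hz|Hz].
  - pose proof (Derive_correct (fun t : R => u (x, t)) y (C1_ex2 u x y HC)) as D.
    change (Derive (fun t : R => u (x, t)) y) with (d2 u (x, y)) in D.
    specialize (HW x y Hz). set (f := fun t : R => u (x, t)) in *. set (g := fun t : R => W (x, t)) in *.
    apply (is_derive_ext (fun t => f t * f t * g t)); [easy|].
    auto_derive; [repeat split; first [exact I | now eexists; exact D | now eexists; exact HW]|].
    eval_derive.
    unfold f, g. ring.
  - destruct (grad_zero_off Omega u _ Hs Hz) as [-> [_ ->]].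
    destruct (supp_locally_zero Omega u _ Hs Hz) as [d [Hd H]]. simpl in H.
    replace (2 * 0 * 0 * W (x, y) + 0 * 0 * Wy (x, y)) with 0 by ring.
    apply (is_derive_ext_loc (fun _ => 0)); [|exact (is_derive_const 0 y)].
    apply (locally_abs y d _ Hd). intros t Ht. rewrite H; [eq_in_R; ring| |easy].
    simpl. rewrite Rminus_diag, Rabs_R0. easy.
Qed.

Lemma locally_box (z : R * R) d (P : R * R -> Prop) : 0 < d ->
  (forall w, Rabs (fst w - fst z) < d -> Rabs (snd w - snd z) < d -> P w) -> locally z P.
Proof.
  intros Hd H. exists (mkposreal d Hd). intros w [H1 H2]. now apply H.
Qed.

Lemma supp_locally_zero_grad Omega u z : compact_supp_in Omega u -> ~ Omega z ->
  locally z (fun w => u w = 0 /\ d1 u w = 0 /\ d2 u w = 0).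
Proof.
  intros Hs Hz. destruct (supp_locally_zero Omega u z Hs Hz) as [d [Hd H]].
  apply (locally_box z (d / 2)); [lra|]. intros w H1 H2.
  split; [apply H; lra|]. split.
  - apply (Derive_locally_zero _ _ (d / 2)); [lra|]. intros t Ht. apply H; simpl; [|lra].
    replace (t - fst z) with ((t - fst w) + (fst w - fst z)) by ring.
    eapply Rle_lt_trans; [apply Rabs_triang|]. lra.
  - apply (Derive_locally_zero _ _ (d / 2)); [lra|]. intros t Ht. apply H; simpl; [lra|].
    replace (t - snd z) with ((t - snd w) + (snd w - snd z)) by ring.
    eapply Rle_lt_trans; [apply Rabs_triang|]. lra.
Qed.

(** Off [Omega] the function and its gradient vanish near z, hence so does any expression that
    vanishes with them. *)
Lemma cutoff_continuous Omega u (f : R * R -> R) z : compact_supp_in Omega u ->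
  (Omega z -> continuous f z) -> (forall w, u w = 0 -> d1 u w = 0 -> d2 u w = 0 -> f w = 0) -> continuous f z.
Proof.
  intros Hs Hf H0. destruct (classic (Omega z)) as [Hz|Hz]; [now apply Hf|].
  apply (continuous_ext_loc _ (fun _ => 0)); [|apply cont2_const].
  apply (filter_imp (fun w => u w = 0 /\ d1 u w = 0 /\ d2 u w = 0)).
  - intros w [E1 [E2 E3]]. symmetry. now apply H0.
  - now apply (supp_locally_zero_grad Omega).
Qed.

(** * Barta's bound for a field W = grad v / v, for which [Hdiv] reads - Delta v >= L v *)

Section Barta.
Variables (Omega : R * R -> Prop) (W1 W1x W2 W2y : R * R -> R) (L : R).
Hypothesis HO : forall z, Omega z -> Rabs (fst z) < 1 /\ Rabs (snd z) < 1.
Hypothesis HW1 : forall x y : R, Omega (x, y) -> is_derive (fun t : R => W1 (t, y)) x (W1x (x, y)).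
Hypothesis HW2 : forall x y : R, Omega (x, y) -> is_derive (fun t : R => W2 (x, t)) y (W2y (x, y)).
Hypothesis HcW1 : forall z, Omega z -> continuous W1 z.
Hypothesis HcW2 : forall z, Omega z -> continuous W2 z.
Hypothesis HcW1x : forall z, Omega z -> continuous W1x z.
Hypothesis HcW2y : forall z, Omega z -> continuous W2y z.
Hypothesis Hdiv : forall z, Omega z -> W1x z + W2y z + (W1 z ^ 2 + W2 z ^ 2) <= - L.

(* |grad u - u W|^2 >= 0 and the divergence theorem for u^2 W. *)
Lemma rayleigh_ge_of_field u : admissible Omega u -> L <= rayleigh 2 u.
Proof.
  intros Hu. pose proof Hu as [HC [Hs _]].
  set (G1 := fun z => 2 * u z * d1 u z * W1 z + u z * u z * W1x z).
  set (G2 := fun z => 2 * u z * d2 u z * W2 z + u z * u z * W2y z).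
  assert (Cu : forall z, continuous (fun z => u z) z) by (intros; now apply C1_continuous).
  assert (Cd1 : forall z, continuous (fun z => d1 u z) z) by (intros; now apply C1_d1_continuous).
  assert (Cd2 : forall z, continuous (fun z => d2 u z) z) by (intros; now apply C1_d2_continuous).
  assert (CG1 : forall z, continuous G1 z).
  { intros z. apply (cutoff_continuous Omega u); [easy| |].
    - intros Hz. pose proof (HcW1 z Hz : continuous (fun z => W1 z) z).
      pose proof (HcW1x z Hz : continuous (fun z => W1x z) z).
      pose proof (Cu z). pose proof (Cd1 z). unfold G1. continuity2.
    - intros w E E1 E2. unfold G1. rewrite E. ring. }
  assert (CG2 : forall z, continuous G2 z).
  { intros z. apply (cutoff_continuous Omega u); [easy| |].
    - intros Hz. pose proof (HcW2 z Hz : continuous (fun z => W2 z) z).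
      pose proof (HcW2y z Hz : continuous (fun z => W2y z) z).
      pose proof (Cu z). pose proof (Cd2 z). unfold G2. continuity2.
    - intros w E E1 E2. unfold G2. rewrite E. ring. }
  assert (Hoff : forall W : R * R -> R, off_square (fun z => u z * u z * W z)).
  { intros W z Hz. apply (off_square_not Omega HO) in Hz.
    destruct (grad_zero_off Omega u z Hs Hz) as [-> _]. ring. }
  assert (CF1 : forall z, continuous (fun z => u z * u z * W1 z) z).
  { intros z. apply (cutoff_continuous Omega u); [easy| |].
    - intros Hz. pose proof (HcW1 z Hz : continuous (fun z => W1 z) z). pose proof (Cu z). continuity2.
    - intros w E E1 E2. rewrite E. ring. }
  assert (I1 : square_integral G1 = 0).
  { apply (square_integral_d1 (fun z => u z * u z * W1 z)); auto.
    intros x y. now apply (cutoff_derive1 Omega u W1 W1x). }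
  assert (I2 : square_integral G2 = 0).
  { apply (square_integral_d2 (fun z => u z * u z * W2 z)); auto.
    intros x y. now apply (cutoff_derive2 Omega u W2 W2y). }
  rewrite (rayleigh_eq Omega HO) by (first [lra | easy]).
  pose proof (mass_pos Omega HO 2 u ltac:(lra) Hu) as Hm.
  apply Rmult_le_reg_r with (mass 2 u); [easy|]. unfold Rdiv. rewrite Rmult_assoc, Rinv_l, Rmult_1_r by lra.
  assert (Cm : forall z, continuous (fun z => powp (Rabs (u z)) 2) z).
  { intros z. apply continuous_powp_abs; [lra|apply Cu]. }
  assert (Cg : forall z, continuous (fun z => powp (grad_norm u z) 2) z).
  { intros z. apply continuous_powp_grad; [lra|easy]. }
  assert (CLm : forall z, continuous (fun z => L * powp (Rabs (u z)) 2) z).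
  { intros z. apply cont2_mult; [apply cont2_const|apply Cm]. }
  assert (H : L * mass 2 u + (square_integral G1 + square_integral G2) <= dirichlet 2 u); [|lra].
  unfold mass, dirichlet. rewrite <- square_integral_scal by easy.
  rewrite <- square_integral_plus by easy. rewrite <- square_integral_plus.
  2: easy. 2:{ intros z. now apply cont2_plus. }
  apply square_integral_le; [|easy|].
  { intros z. apply cont2_plus; [easy|]. now apply cont2_plus. }
  intros z. rewrite !powp_2 by (first [apply Rabs_pos | apply grad_norm_ge0]).
  rewrite pow2_abs. unfold grad_norm. rewrite pow2_sqrt by apply sum_sq_ge0.
  unfold G1, G2. destruct (classic (Omega z)) as [Hz|Hz].
  - specialize (Hdiv z Hz).
    set (a := u z). set (p := d1 u z). set (q := d2 u z).
    pose proof (pow2_ge_0 (p - a * W1 z)). pose proof (pow2_ge_0 (q - a * W2 z)).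
    assert (a ^ 2 * (W1x z + W2y z + (W1 z ^ 2 + W2 z ^ 2)) <= a ^ 2 * - L)
      by (apply Rmult_le_compat_l; [apply pow2_ge_0|easy]).
    nra.
  - destruct (grad_zero_off Omega u z Hs Hz) as [-> [-> ->]]. nra.
Qed.
End Barta.

Definition rho2 (z : R * R) := fst z * fst z + snd z * snd z.

Lemma sector_props n z : (1 <= n)%nat -> sector n z -> 0 < cim n z /\ 0 <= rho2 z < 1.
Proof.
  intros Hn [r [t [Hr [Ht ->]]]]. destruct (cpow_polar n r t) as [_ ->].
  assert (HnR : 1 <= INR n) by (apply (le_INR 1); easy).
  split.
  - apply Rmult_lt_0_compat; [apply pow_lt; lra|]. apply sin_gt_0; [nra|].
    destruct Ht as [_ Ht]. apply (Rmult_lt_compat_l (INR n)) in Ht; [|lra].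
    replace (INR n * (PI / INR n)) with PI in Ht by (field; lra). easy.
  - unfold rho2. simpl. pose proof (sin2_cos2 t) as E. unfold Rsqr in E.
    replace (r * cos t * (r * cos t) + r * sin t * (r * sin t)) with (r * r) by nra. nra.
Qed.

Lemma sector_in_square n z : (1 <= n)%nat -> sector n z -> Rabs (fst z) < 1 /\ Rabs (snd z) < 1.
Proof.
  intros Hn Hz. destruct (sector_props n z Hn Hz) as [_ Hr]. unfold rho2 in Hr.
  split; apply Rabs_lt_between; nra.
Qed.

Section SectorField.
Variable n : nat.
Hypothesis Hn : (1 <= n)%nat.
Let N := INR n.

(* grad log v for the supersolution v = Im(z^n) (1 - |z|^2) exp(- n |z|^2 / 2). *)
Definition field_drag z := / (1 - rho2 z) + INR n * / 2.
Definition field1 z := INR n * (cim (n - 1) z * / cim n z) - 2 * (fst z * field_drag z).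
Definition field2 z := INR n * (cre (n - 1) z * / cim n z) - 2 * (snd z * field_drag z).
Definition field1x z :=
  INR n * ((INR (n - 1) * cim (n - 1 - 1) z * cim n z - cim (n - 1) z * (INR n * cim (n - 1) z)) * (/ cim n z * / cim n z))
  - 2 * (field_drag z + fst z * (2 * fst z * (/ (1 - rho2 z) * / (1 - rho2 z)))).
Definition field2y z :=
  INR n * ((- (INR (n - 1) * cim (n - 1 - 1) z) * cim n z - cre (n - 1) z * (INR n * cre (n - 1) z)) * (/ cim n z * / cim n z))
  - 2 * (field_drag z + snd z * (2 * snd z * (/ (1 - rho2 z) * / (1 - rho2 z)))).

Lemma field1_derive (x y : R) : sector n (x, y) -> is_derive (fun t : R => field1 (t, y)) x (field1x (x, y)).
Proof.
  intros Hz. destruct (sector_props n _ Hn Hz) as [Hc Hr].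
  destruct (cpow_derive1 n x y) as [_ D]. destruct (cpow_derive1 (n - 1) x y) as [_ E].
  unfold field1, field1x, field_drag, rho2 in *. simpl fst in *. simpl snd in *.
  set (f := fun t : R => cim n (t, y)) in *. set (g := fun t : R => cim (n - 1) (t, y)) in *.
  apply (is_derive_ext (fun t => INR n * (g t * / f t) - 2 * (t * (/ (1 - (t * t + y * y)) + INR n * / 2)))); [easy|].
  change (cim n (x, y)) with (f x) in *.
  auto_derive; [repeat split; first [exact I | now eexists; exact D | now eexists; exact E | lra]|].
  eval_derive.
  change (cim (n - 1) (x, y)) with (g x). field. lra.
Qed.

Lemma field2_derive (x y : R) : sector n (x, y) -> is_derive (fun t : R => field2 (x, t)) y (field2y (x, y)).
Proof.
  intros Hz. destruct (sector_props n _ Hn Hz) as [Hc Hr].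
  destruct (cpow_derive2 n x y) as [_ D]. destruct (cpow_derive2 (n - 1) x y) as [E _].
  unfold field2, field2y, field_drag, rho2 in *. simpl fst in *. simpl snd in *.
  set (f := fun t : R => cim n (x, t)) in *. set (g := fun t : R => cre (n - 1) (x, t)) in *.
  apply (is_derive_ext (fun t => INR n * (g t * / f t) - 2 * (t * (/ (1 - (x * x + t * t)) + INR n * / 2)))); [easy|].
  change (cim n (x, y)) with (f y) in *.
  auto_derive; [repeat split; first [exact I | now eexists; exact D | now eexists; exact E | lra]|].
  eval_derive.
  change (cre (n - 1) (x, y)) with (g y). field. lra.
Qed.

(** With y = 1 - |z|^2 the negative of the left side is n^2 + 6 n + 4/y + n^2 y, because the
    coefficient n/2 in the exponential cancels the terms in n/y. Completing the square, 4/y + n^2 y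
    = 4 n + (2 - n y)^2 / y, which yields n (n + 10). *)
Lemma field_div z : sector n z ->
  field1x z + field2y z + (field1 z ^ 2 + field2 z ^ 2) <= - (INR n * (INR n + 10)).
Proof.
  intros Hz. destruct (sector_props n _ Hn Hz) as [Hc Hr].
  (* Im(z z^(n-1)) = Im(z^n), the Euler relation that evaluates the cross term of the harmonic and
     the radial factor. *)
  assert (Hh : fst z * cim (n - 1) z + snd z * cre (n - 1) z = cim n z).
  { replace n with (S (n - 1)) at 3 by lia. easy. }
  set (h := cim n z) in *. set (y := 1 - rho2 z).
  assert (Hy : 0 < y <= 1) by (unfold y; lra).
  assert (E : field1x z + field2y z + (field1 z ^ 2 + field2 z ^ 2) =
     - (INR n * (INR n + 10)) - (2 - INR n * y) ^ 2 * / y).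
  { unfold field1x, field2y, field1, field2, field_drag. fold h. fold y.
    set (a := cim (n - 1) z) in *. set (b := cre (n - 1) z) in *.
    set (X := fst z) in *. set (V := snd z) in *. set (m := INR n).
    set (k := INR (n - 1) * cim (n - 1 - 1) z).
    assert (Er : X * X + V * V = 1 - y) by (unfold y, rho2, X, V; ring).
    set (i := / y). set (j := / h).
    assert (Ei : y * i = 1) by (unfold i; field; lra).
    assert (Ej : h * j = 1) by (unfold j; field; lra).
    replace (m * ((k * h - a * (m * a)) * (j * j)) - 2 * (i + m * / 2 + X * (2 * X * (i * i))) +
      (m * ((- k * h - b * (m * b)) * (j * j)) - 2 * (i + m * / 2 + V * (2 * V * (i * i)))) +
      ((m * (a * j) - 2 * (X * (i + m * / 2))) ^ 2 + (m * (b * j) - 2 * (V * (i + m * / 2))) ^ 2))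
      with (- 4 * (i + m * / 2) - 4 * (X * X + V * V) * (i * i) + 4 * (X * X + V * V) * (i + m * / 2) ^ 2
        - 4 * m * ((X * a + V * b) * j) * (i + m * / 2)) by (field; lra).
    rewrite Er, Hh, Ej.
    replace ((2 - m * y) ^ 2 * i) with (4 * i - 4 * m * (y * i) + m * m * y * (y * i)) by ring.
    replace (- 4 * (i + m * / 2) - 4 * (1 - y) * (i * i) + 4 * (1 - y) * (i + m * / 2) ^ 2 - 4 * m * 1 * (i + m * / 2))
      with (- 4 * i - 2 * m - 4 * m * (y * i) - m * m * y + m * m - 2 * m * m) by field.
    rewrite Ei. ring. }
  rewrite E. assert (0 <= (2 - INR n * y) ^ 2 * / y); [|lra].
  apply Rmult_le_pos; [apply pow2_ge_0|left; apply Rinv_0_lt_compat; lra].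
Qed.

Lemma rho2_continuous z : continuous (fun z => rho2 z) z.
Proof. unfold rho2. continuity2. Qed.

Theorem sector_rayleigh_lower u : admissible (sector n) u -> INR n * (INR n + 10) <= rayleigh 2 u.
Proof.
  apply (rayleigh_ge_of_field (sector n) field1 field1x field2 field2y).
  - intros z. now apply sector_in_square.
  - apply field1_derive.
  - apply field2_derive.
  - intros z Hz. destruct (sector_props n _ Hn Hz) as [Hc Hr]. pose proof (rho2_continuous z).
    unfold field1, field_drag. continuity2; lra.
  - intros z Hz. destruct (sector_props n _ Hn Hz) as [Hc Hr]. pose proof (rho2_continuous z).
    unfold field2, field_drag. continuity2; lra.
  - intros z Hz. destruct (sector_props n _ Hn Hz) as [Hc Hr]. pose proof (rho2_continuous z).
    unfold field1x, field_drag. continuity2; lra.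
  - intros z Hz. destruct (sector_props n _ Hn Hz) as [Hc Hr]. pose proof (rho2_continuous z).
    unfold field2y, field_drag. continuity2; lra.
  - apply field_div.
Qed.
End SectorField.

(** * Upper bound for the sector at large exponents *)

Definition half_angle (n : nat) := PI / (2 * INR n).
(** With s = sin a, the point of the bisector at distance 1/(1+s) from the vertex is s/(1+s) away
    from both sides and 1 - 1/(1+s), the same number, away from the arc. *)
Definition inradius (n : nat) := sin (half_angle n) / (1 + sin (half_angle n)).
Definition incenter (n : nat) : R * R :=
  (cos (half_angle n) / (1 + sin (half_angle n)), sin (half_angle n) / (1 + sin (half_angle n))).

Lemma half_angle_bounds n : (2 <= n)%nat -> 0 < half_angle n < PI / 2.
Proof.
  intros Hn. assert (HnR : 2 <= INR n) by (apply (le_INR 2); easy).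
  pose proof PI_RGT_0. unfold half_angle. split; [apply Rdiv_lt_0_compat; lra|].
  apply Rmult_lt_compat_l; [lra|]. apply Rinv_lt_contravar; lra.
Qed.

Lemma dist2_sq z w : dist2 z w ^ 2 = (fst z - fst w) ^ 2 + (snd z - snd w) ^ 2.
Proof. unfold dist2. apply pow2_sqrt, sum_sq_ge0. Qed.

Lemma dist2_ge0 z w : 0 <= dist2 z w.
Proof. apply sqrt_pos. Qed.

(** Membership asks for explicit polar coordinates. In coordinates adapted to the bisector it
    amounts to P > 0, P^2 + Q^2 < 1 and |Q/P| < tan a. *)
Lemma incircle_in_sector n w : (2 <= n)%nat -> dist2 w (incenter n) < inradius n -> sector n w.
Proof.
  intros Hn Hw. pose proof (half_angle_bounds n Hn) as Ha. pose proof PI_RGT_0.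
  set (a := half_angle n) in *. set (s := sin a). set (c := cos a).
  assert (Hs : 0 < s) by (apply sin_gt_0; lra).
  assert (Hc : 0 < c) by (apply cos_gt_0; lra).
  pose proof (sin2_cos2 a) as Hsc. fold s c in Hsc. unfold Rsqr in Hsc.
  set (d := / (1 + s)). assert (Hd : 0 < d) by (apply Rinv_0_lt_compat; lra).
  assert (Hds : d * (1 + s) = 1) by (unfold d; field; lra).
  assert (Hw2 : dist2 w (incenter n) ^ 2 < (d * s) ^ 2).
  { replace (d * s) with (inradius n) by (unfold inradius; fold a s; unfold d; field; lra).
    pose proof (dist2_ge0 w (incenter n)). nra. }
  rewrite dist2_sq in Hw2. unfold incenter in Hw2. simpl fst in Hw2. simpl snd in Hw2. fold a s c in Hw2.
  destruct w as [X Y]. simpl fst in Hw2. simpl snd in Hw2.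
  replace (c / (1 + s)) with (d * c) in Hw2 by (unfold d; field; lra).
  replace (s / (1 + s)) with (d * s) in Hw2 by (unfold d; field; lra).
  (* Coordinates along and across the bisector; the centre becomes (d, 0). *)
  set (P := X * c + Y * s). set (Q := Y * c - X * s).
  assert (HX : X = P * c - Q * s) by (unfold P, Q; transitivity (X * (s * s + c * c)); [rewrite Hsc|]; ring).
  assert (HY : Y = P * s + Q * c) by (unfold P, Q; transitivity (Y * (s * s + c * c)); [rewrite Hsc|]; ring).
  assert (HPQ : (P - d) ^ 2 + Q ^ 2 < (d * s) ^ 2).
  { replace ((P - d) ^ 2 + Q ^ 2) with ((X - d * c) ^ 2 + (Y - d * s) ^ 2); [easy|].
    transitivity ((P - d) ^ 2 * (s * s + c * c) + Q ^ 2 * (s * s + c * c)).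
    - rewrite HX, HY. ring.
    - rewrite Hsc. ring. }
  assert (Hs1 : s < 1) by nra.
  assert (HP : 0 < P).
  { pose proof (pow2_ge_0 Q). destruct (Rlt_dec 0 P); [easy|]. exfalso.
    assert (d ^ 2 <= (P - d) ^ 2) by nra. assert (d * s < d) by nra. assert ((d * s) ^ 2 <= d ^ 2) by nra. lra. }
  assert (HPd : P - d < d * s).
  { pose proof (pow2_ge_0 Q). assert (0 < d * s) by nra. nra. }
  assert (Hnorm : P ^ 2 + Q ^ 2 < 1).
  { assert (P ^ 2 + Q ^ 2 < (d * s) ^ 2 - d ^ 2 + 2 * P * d) by nra.
    assert (2 * P * d <= 2 * (d + d * s) * d) by nra.
    assert (((d * s) ^ 2 - d ^ 2 + 2 * (d + d * s) * d) = (d * (1 + s)) ^ 2) as E by ring.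
    rewrite Hds in E. lra. }
  (* The sides are tangent to the circle, so the difference is a perfect square, (P - d c^2)^2. *)
  assert (Htan : Q ^ 2 * c ^ 2 < P ^ 2 * s ^ 2).
  { assert (Q ^ 2 < (d * s) ^ 2 - (P - d) ^ 2) by lra.
    assert (0 < c ^ 2) by nra.
    assert (Q ^ 2 * c ^ 2 < ((d * s) ^ 2 - (P - d) ^ 2) * c ^ 2) by (apply Rmult_lt_compat_r; lra).
    assert (P ^ 2 * s ^ 2 - ((d * s) ^ 2 - (P - d) ^ 2) * c ^ 2 = (P - d * c ^ 2) ^ 2) as E.
    { replace (s ^ 2) with (1 - c ^ 2) by lra. replace ((d * s) ^ 2) with (d ^ 2 * (1 - c ^ 2)).
      - ring.
      - replace ((d * s) ^ 2) with (d ^ 2 * (s * s)) by ring. replace (s * s) with (1 - c ^ 2) by lra. ring. }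
    pose proof (pow2_ge_0 (P - d * c ^ 2)). lra. }
  set (q := Q / P).
  assert (Hq : - tan a < q < tan a).
  { assert (Hqc : (q * c) ^ 2 < s ^ 2).
    { unfold q. replace ((Q / P * c) ^ 2) with (Q ^ 2 * c ^ 2 * / P ^ 2) by (field; lra).
      apply Rmult_lt_reg_r with (P ^ 2); [nra|]. rewrite Rmult_assoc, Rinv_l by nra. lra. }
    assert (- s < q * c < s) by nra.
    unfold tan. fold s c. split.
    - apply Rmult_lt_reg_r with c; [easy|]. replace (- (s / c) * c) with (- s) by (field; lra). lra.
    - apply Rmult_lt_reg_r with c; [easy|]. replace (s / c * c) with s by (field; lra). lra. }
  (* Since P > 0, the polar angle measured from the bisector is atan (Q/P), and the radius is P sqrt
     (1 + q^2). *)
  set (t := atan q).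
  assert (Hat : atan (tan a) = a) by (apply atan_tan; lra).
  assert (Ht : - a < t < a).
  { rewrite <- Hat. rewrite <- atan_opp. split; apply atan_increasing; lra. }
  set (m := sqrt (1 + q ^ 2)). pose proof (pow2_ge_0 q).
  assert (Hm : 0 < m) by (apply sqrt_lt_R0; lra).
  assert (Hmm : m * m = 1 + q ^ 2) by (apply sqrt_sqrt; lra).
  assert (Hct : cos t = 1 / m).
  { unfold t. rewrite cos_atan. unfold m. now rewrite Rsqr_pow2. }
  assert (Hst : sin t = q / m).
  { unfold t. rewrite sin_atan. unfold m. now rewrite Rsqr_pow2. }
  assert (HQ : Q = P * q) by (unfold q; field; lra).
  exists (P * m), (a + t). split; [|split].
  - split; [nra|].
    assert ((P * m) ^ 2 < 1).
    { replace ((P * m) ^ 2) with (P ^ 2 * (m * m)) by ring. rewrite Hmm.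
      replace (P ^ 2 * (1 + q ^ 2)) with (P ^ 2 + Q ^ 2) by (rewrite HQ; ring). easy. }
    assert (0 < P * m) by nra. nra.
  - assert (HnR : 2 <= INR n) by (apply (le_INR 2); easy).
    split; [lra|]. replace (PI / INR n) with (2 * a); [lra|]. unfold a, half_angle. field. lra.
  - rewrite cos_plus, sin_plus, Hct, Hst. fold s c. f_equal.
    + rewrite HX, HQ. field. lra.
    + rewrite HY, HQ. field. lra.
Qed.

(** * A C^1 cone with slope at most 1 *)

Section TestFunction.
Variables (e r : R) (c : R * R).
Hypothesis He : 0 < e.

(** C^1 substitute for the positive part: it vanishes for x <= 0, has slope in [0, 1] and stays
    above x - e. *)
Definition soft_pos x := Rmax 0 x ^ 2 / (Rmax 0 x + e).
Definition soft_pos' x := 1 - (e / (Rmax 0 x + e)) ^ 2.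

Lemma soft_pos_derive x : is_derive soft_pos x (soft_pos' x).
Proof.
  unfold soft_pos'. destruct (Rtotal_order x 0) as [Hx|[->|Hx]].
  - rewrite Rmax_left by lra. replace (1 - (e / (0 + e)) ^ 2) with 0 by (field; lra).
    apply (is_derive_ext_loc (fun _ => 0)); [|exact (is_derive_const 0 x)].
    apply (locally_abs x (- x)); [lra|]. intros y Hy. apply Rabs_lt_between in Hy.
    unfold soft_pos. rewrite Rmax_left by lra. eq_in_R. field. lra.
  - rewrite Rmax_left by lra. replace (1 - (e / (0 + e)) ^ 2) with 0 by (field; lra).
    apply (is_derive_of_quadratic soft_pos (-1) 0 0 (/ e)); [lra|]. intros t _.
    unfold soft_pos. rewrite (Rmax_left 0 0) by lra.
    replace (Rmax 0 t ^ 2 / (Rmax 0 t + e) - 0 ^ 2 / (0 + e) - (t - 0) * 0) with (Rmax 0 t ^ 2 / (Rmax 0 t + e))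
      by (field; split; [lra|pose proof (Rmax_l 0 t); lra]).
    pose proof (Rmax_l 0 t).
    rewrite Rabs_pos_eq by (apply Rdiv_le_0_compat; [apply pow2_ge_0|lra]).
    rewrite Rminus_0_r. unfold Rdiv. rewrite Rmult_comm.
    assert (/ (Rmax 0 t + e) <= / e) by (apply Rinv_le_contravar; lra).
    assert (0 < / (Rmax 0 t + e)) by (apply Rinv_0_lt_compat; lra).
    apply Rmult_le_compat; [lra|apply pow2_ge_0|easy|].
    unfold Rmax. destruct (Rle_dec 0 t); [lra|]. pose proof (pow2_ge_0 t). lra.
  - rewrite Rmax_right by lra.
    apply (is_derive_ext_loc (fun y => y ^ 2 / (y + e))).
    + apply (locally_abs x x); [lra|]. intros y Hy. apply Rabs_lt_between in Hy.
      unfold soft_pos. now rewrite Rmax_right by lra.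
    + auto_derive; [lra|]. field. lra.
Qed.

Lemma soft_pos'_bounds x : 0 <= soft_pos' x <= 1.
Proof.
  unfold soft_pos'. pose proof (Rmax_l 0 x). set (m := Rmax 0 x) in *.
  assert (0 <= e / (m + e) <= 1).
  { split; [apply Rdiv_le_0_compat; lra|]. apply Rmult_le_reg_r with (m + e); [lra|].
    unfold Rdiv. rewrite Rmult_assoc, Rinv_l; lra. }
  nra.
Qed.

Lemma soft_pos'_continuous x : continuous soft_pos' x.
Proof.
  unfold soft_pos'.
  assert (Hm : continuous (fun x => Rmax 0 x) x).
  { apply (lipschitz_continuous_from _ 1 (x - 1)); [|lra]. intros s t _ _.
    rewrite (Rmax_comm 0 t), (Rmax_comm 0 s), Rmult_1_l. apply Rmax_lip. }
  apply (continuous_comp (fun x => Rmax 0 x) (fun m => 1 - (e / (m + e)) ^ 2)); [easy|].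
  pose proof (Rmax_l 0 x).
  apply (ex_derive_continuous (fun m => 1 - (e / (m + e)) ^ 2)). auto_derive. lra.
Qed.

Lemma soft_pos_lower x : x - e <= soft_pos x.
Proof.
  unfold soft_pos. pose proof (Rmax_l 0 x). pose proof (Rmax_r 0 x). set (m := Rmax 0 x) in *.
  apply Rle_trans with (m - e); [lra|]. apply Rmult_le_reg_r with (m + e); [lra|].
  unfold Rdiv. rewrite Rmult_assoc, Rinv_l by lra. nra.
Qed.

Lemma soft_pos_nonpos x : x <= 0 -> soft_pos x = 0.
Proof. intros. unfold soft_pos. rewrite Rmax_left by easy. field. lra. Qed.

(** The distance to [c], smoothed at [c] itself. It dominates the true distance, so the cone stays
    supported in the disk of radius [r]. *)
Definition soft_dist (z : R * R) := sqrt (e ^ 2 + ((fst z - fst c) ^ 2 + (snd z - snd c) ^ 2)).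
Definition cone (z : R * R) := soft_pos (r - soft_dist z).

Lemma soft_dist_sq z : soft_dist z ^ 2 = e ^ 2 + ((fst z - fst c) ^ 2 + (snd z - snd c) ^ 2).
Proof. apply pow2_sqrt. pose proof (sum_sq_ge0 (fst z - fst c) (snd z - snd c)). nra. Qed.

Lemma soft_dist_ge z : e <= soft_dist z.
Proof.
  pose proof (soft_dist_sq z). pose proof (sum_sq_ge0 (fst z - fst c) (snd z - snd c)).
  assert (0 <= soft_dist z) by apply sqrt_pos. nra.
Qed.

Lemma cone_derive1 (x y : R) :
  is_derive (fun t : R => cone (t, y)) x (soft_pos' (r - soft_dist (x, y)) * - ((x - fst c) * / soft_dist (x, y))).
Proof.
  pose proof (soft_dist_ge (x, y)). unfold soft_dist in *. simpl fst in *. simpl snd in *.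
  pose proof (sum_sq_ge0 (x - fst c) (y - snd c)).
  rewrite Rmult_comm.
  apply (is_derive_comp soft_pos (fun t => r - sqrt (e ^ 2 + ((t - fst c) ^ 2 + (y - snd c) ^ 2)))).
  - apply soft_pos_derive.
  - set (X := fst c) in *. set (Y := snd c) in *.
    auto_derive; [unfold Rminus in *; simpl in *; nra|].
    unfold Rminus in *. simpl in *.
    field. lra.
Qed.

Lemma cone_derive2 (x y : R) :
  is_derive (fun t : R => cone (x, t)) y (soft_pos' (r - soft_dist (x, y)) * - ((y - snd c) * / soft_dist (x, y))).
Proof.
  pose proof (soft_dist_ge (x, y)). unfold soft_dist in *. simpl fst in *. simpl snd in *.
  pose proof (sum_sq_ge0 (x - fst c) (y - snd c)).
  rewrite Rmult_comm.
  apply (is_derive_comp soft_pos (fun t => r - sqrt (e ^ 2 + ((x - fst c) ^ 2 + (t - snd c) ^ 2)))).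
  - apply soft_pos_derive.
  - set (X := fst c) in *. set (Y := snd c) in *.
    auto_derive; [unfold Rminus in *; simpl in *; nra|].
    unfold Rminus in *. simpl in *.
    field. lra.
Qed.

Lemma soft_dist_continuous z : continuous (fun z => soft_dist z) z.
Proof.
  apply (continuous_comp (fun z => e ^ 2 + ((fst z - fst c) ^ 2 + (snd z - snd c) ^ 2)) sqrt).
  - apply cont2_plus; [apply cont2_const|].
    apply cont2_plus; apply continuous_sq; apply cont2_minus; auto using cont2_const, cont2_fst, cont2_snd.
  - apply continuity_pt_filterlim, continuity_pt_sqrt.
    pose proof (sum_sq_ge0 (fst z - fst c) (snd z - snd c)). nra.
Qed.

Lemma cone_d1 z : d1 cone z = soft_pos' (r - soft_dist z) * - ((fst z - fst c) * / soft_dist z).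
Proof. destruct z as [x y]. apply is_derive_unique, cone_derive1. Qed.

Lemma cone_d2 z : d2 cone z = soft_pos' (r - soft_dist z) * - ((snd z - snd c) * / soft_dist z).
Proof. destruct z as [x y]. apply is_derive_unique, cone_derive2. Qed.

Lemma cone_C1 : C1_2d cone.
Proof.
  assert (Hd : forall z, continuous (fun z => soft_dist z) z) by apply soft_dist_continuous.
  assert (Hs : forall z, continuous (fun z => soft_pos' (r - soft_dist z)) z).
  { intros z. apply (continuous_comp (fun z => r - soft_dist z) soft_pos'); [|apply soft_pos'_continuous].
    apply cont2_minus; [apply cont2_const|apply Hd]. }
  assert (Hn : forall z, soft_dist z <> 0) by (intros z; pose proof (soft_dist_ge z); lra).
  intros [x y]. split; [eexists; apply cone_derive1|]. split; [eexists; apply cone_derive2|].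
  split; [|split].
  - apply (continuous_comp (fun z => r - soft_dist z) soft_pos).
    + apply cont2_minus; [apply cont2_const|apply Hd].
    + eapply is_derive_continuous, soft_pos_derive.
  - apply (continuous_ext (fun z => soft_pos' (r - soft_dist z) * - ((fst z - fst c) * / soft_dist z))).
    + intros; now rewrite cone_d1.
    + specialize (Hs (x, y)). specialize (Hd (x, y)). continuity2. apply Hn.
  - apply (continuous_ext (fun z => soft_pos' (r - soft_dist z) * - ((snd z - snd c) * / soft_dist z))).
    + intros; now rewrite cone_d2.
    + specialize (Hs (x, y)). specialize (Hd (x, y)). continuity2. apply Hn.
Qed.

Lemma cone_grad_le1 z : grad_norm cone z <= 1.
Proof.
  unfold grad_norm. rewrite <- sqrt_1. apply sqrt_le_1_alt. rewrite cone_d1, cone_d2.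
  pose proof (soft_pos'_bounds (r - soft_dist z)) as Hb.
  pose proof (soft_dist_sq z) as Hsq. pose proof (soft_dist_ge z) as Hge.
  set (k := soft_pos' (r - soft_dist z)) in *. set (S := soft_dist z) in *.
  set (X := fst z - fst c) in *. set (Y := snd z - snd c) in *.
  replace ((k * - (X * / S)) ^ 2 + (k * - (Y * / S)) ^ 2) with (k ^ 2 * ((X ^ 2 + Y ^ 2) * / S ^ 2)) by (field; lra).
  assert (0 <= (X ^ 2 + Y ^ 2) * / S ^ 2 <= 1).
  { assert (0 < S ^ 2) by nra. split.
    - apply Rmult_le_pos; [apply sum_sq_ge0|left; now apply Rinv_0_lt_compat].
    - apply Rmult_le_reg_r with (S ^ 2); [easy|]. rewrite Rmult_assoc, Rinv_l by lra. nra. }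
  assert (0 <= k ^ 2 <= 1) by nra. nra.
Qed.

Lemma cone_support z : cone z <> 0 -> dist2 z c < r.
Proof.
  intros Hz. destruct (Rlt_dec (dist2 z c) r) as [|Hn]; [easy|exfalso]. apply Hz.
  apply soft_pos_nonpos. pose proof (soft_dist_sq z) as H. rewrite <- dist2_sq in H.
  pose proof (soft_dist_ge z). pose proof (dist2_ge0 z c).
  assert (dist2 z c <= soft_dist z) by nra. lra.
Qed.

(** On this box the smoothed distance is at most 2 e, and [soft_pos] loses at most another e. *)
Lemma cone_lower z : Rabs (fst z - fst c) <= e / 2 -> Rabs (snd z - snd c) <= e / 2 -> r - 3 * e <= cone z.
Proof.
  intros H1 H2. eapply Rle_trans; [|apply soft_pos_lower].
  assert (soft_dist z <= 2 * e); [|lra].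
  pose proof (soft_dist_sq z) as H. pose proof (soft_dist_ge z).
  rewrite <- (pow2_abs (fst z - fst c)), <- (pow2_abs (snd z - snd c)) in H.
  pose proof (Rabs_pos (fst z - fst c)). pose proof (Rabs_pos (snd z - snd c)). nra.
Qed.
End TestFunction.

Lemma dist2_triangle x y z : dist2 x z <= dist2 x y + dist2 y z.
Proof.
  pose proof (dist2_ge0 x y). pose proof (dist2_ge0 y z). pose proof (dist2_ge0 x z).
  pose proof (dist2_sq x y) as E1. pose proof (dist2_sq y z) as E2. pose proof (dist2_sq x z) as E3.
  set (a := fst x - fst y) in *. set (b := snd x - snd y) in *.
  set (p := fst y - fst z) in *. set (q := snd y - snd z) in *.
  replace (fst x - fst z) with (a + p) in E3 by (unfold a, p; ring).
  replace (snd x - snd z) with (b + q) in E3 by (unfold b, q; ring).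
  set (A := dist2 x y) in *. set (B := dist2 y z) in *. set (C := dist2 x z) in *.
  assert (HCS : (a * p + b * q) ^ 2 <= (A * B) ^ 2).
  { replace ((A * B) ^ 2) with (A ^ 2 * B ^ 2) by ring. rewrite E1, E2.
    pose proof (pow2_ge_0 (a * q - b * p)). nra. }
  assert (a * p + b * q <= A * B) by (assert (0 <= A * B) by nra; nra).
  nra.
Qed.

Lemma dist2_sym x y : dist2 x y = dist2 y x.
Proof. unfold dist2. f_equal. ring. Qed.

Section SectorUpper.
Variables (n : nat) (e : R).
Hypothesis Hn : (2 <= n)%nat.
Hypothesis He : 0 < e.
Hypothesis HeR : 5 * e < inradius n.

(** Shrinking the radius by e leaves the margin to the complement that compact support demands. *)
Let u := cone e (inradius n - e) (incenter n).

Lemma incircle_square x y : Rabs (x - fst (incenter n)) <= e / 2 -> Rabs (y - snd (incenter n)) <= e / 2 ->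
  Rabs x < 1 /\ Rabs y < 1.
Proof.
  intros Hx Hy. apply (sector_in_square n (x, y)); [lia|]. apply (incircle_in_sector n); [easy|].
  apply Rlt_trans with (2 * e); [|lra]. apply dist2_lt; cbn [fst snd]; lra.
Qed.

Lemma cone_admissible : admissible (sector n) u.
Proof.
  split; [|split].
  - now apply cone_C1.
  - exists e. split; [easy|]. intros z w Hz Hw.
    apply (cone_support e _ _ He) in Hz.
    destruct (Rle_dec e (dist2 z w)) as [|Hlt]; [easy|exfalso]. apply Hw.
    apply incircle_in_sector; [easy|].
    pose proof (dist2_triangle w z (incenter n)). rewrite (dist2_sym w z) in H. lra.
  - exists (incenter n).
    pose proof (cone_lower e (inradius n - e) (incenter n) He (incenter n)) as H.
    rewrite !Rminus_diag, Rabs_R0 in H. specialize (H ltac:(lra) ltac:(lra)). unfold u. lra.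
Qed.

(** The gradient is at most 1 on a square of area 4, while u is at least [inradius n] - 4 e on a box
    of side e around the incenter. *)
Lemma cone_rayleigh p : 2 <= p -> rayleigh p u <= 4 / (e ^ 2 * powp (inradius n - 4 * e) p).
Proof.
  intros Hp. pose proof cone_admissible as Hu.
  assert (HO : forall z, sector n z -> Rabs (fst z) < 1 /\ Rabs (snd z) < 1).
  { intros z. apply sector_in_square. lia. }
  rewrite (rayleigh_eq (sector n) HO) by (first [lra | easy]).
  assert (Hb : 0 < inradius n - 4 * e) by lra.
  pose proof (powp_gt0 _ p Hb) as Hbp.
  assert (Hnum : dirichlet p u <= 4).
  { replace 4 with (square_integral (fun _ => 1)) by (rewrite square_integral_const; ring).
    apply square_integral_le.
    - intros z. apply continuous_powp_grad; [lra|apply Hu].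
    - intros z. apply cont2_const.
    - intros z. apply powp_le_1; [|lra]. split; [apply grad_norm_ge0|now apply cone_grad_le1]. }
  assert (Hden : e ^ 2 * powp (inradius n - 4 * e) p <= mass p u).
  { replace (e ^ 2) with (4 * (e / 2) ^ 2) by field.
    set (x0 := fst (incenter n)). set (y0 := snd (incenter n)).
    assert (HA : forall t, - (e / 2) <= t <= e / 2 -> Rabs t <= e / 2) by (intros; now apply Rabs_le_between).
    destruct (incircle_square (x0 - e / 2) (y0 - e / 2)) as [B1 B2]; [apply HA; unfold x0; lra|apply HA; unfold y0; lra|].
    destruct (incircle_square (x0 + e / 2) (y0 + e / 2)) as [B3 B4]; [apply HA; unfold x0; lra|apply HA; unfold y0; lra|].
    apply Rabs_lt_between in B1, B2, B3, B4.
    apply (square_integral_ge_sub _ _ x0 y0); try lra.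
    - intros z. apply continuous_powp_abs; [lra|apply C1_continuous, Hu].
    - intros z. apply powp_ge0.
    - intros x y Hx Hy. apply powp_le; [|lra]. split; [lra|].
      eapply Rle_trans; [|apply Rle_abs].
      pose proof (cone_lower e (inradius n - e) (incenter n) He (x, y)) as H. cbn [fst snd] in H.
      specialize (H ltac:(apply HA; fold x0; lra) ltac:(apply HA; fold y0; lra)). unfold u. lra. }
  pose proof (dirichlet_ge0 p u ltac:(lra) (proj1 Hu)).
  assert (0 < e ^ 2) by nra.
  unfold Rdiv. apply Rmult_le_compat; [easy| |easy|].
  - left. apply Rinv_0_lt_compat. nra.
  - apply Rinv_le_contravar; [nra|easy].
Qed.
End SectorUpper.

Lemma inradius_pos n : (2 <= n)%nat -> 0 < inradius n.
Proof.
  intros Hn. pose proof (half_angle_bounds n Hn). pose proof PI_RGT_0. unfold inradius.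
  assert (0 < sin (half_angle n)) by (apply sin_gt_0; lra). apply Rdiv_lt_0_compat; lra.
Qed.

Lemma sector_admissible_exists n : (2 <= n)%nat -> exists u, admissible (sector n) u.
Proof.
  intros Hn. pose proof (inradius_pos n Hn). eexists. apply (cone_admissible n (inradius n / 6) Hn); lra.
Qed.

(** The p-th root of the cone bound tends to 1/([inradius n] - 4 e), and the gap between 1/K and the
    inradius leaves room for e. *)
Lemma sector_rayleigh_upper n K : (2 <= n)%nat -> 0 < K -> / K < inradius n ->
  exists P, 2 < P /\ exists u, admissible (sector n) u /\ rayleigh P u < powp K P.
Proof.
  intros Hn HK HR. set (r := inradius n) in *. assert (0 < / K) by now apply Rinv_0_lt_compat.
  (* Then r - 4 e is the midpoint of 1/K and r, still above 1/K. *)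
  set (e := (r - / K) / 8). assert (He : 0 < e) by (unfold e; lra).
  assert (He5 : 5 * e < r) by (unfold e; lra).
  set (b := K * (r - 4 * e)).
  assert (Hb : 1 < b).
  { unfold b. replace 1 with (K * / K) by (field; lra). apply Rmult_lt_compat_l; [easy|]. unfold e. lra. }
  assert (Hln : 0 < ln b) by (rewrite <- ln_1; apply ln_increasing; lra).
  assert (He2 : 0 < e ^ 2) by nra.
  set (M := 4 / e ^ 2). assert (HM : 0 < M) by (apply Rdiv_lt_0_compat; lra).
  (* P ln b > M, so b^P = exp (P ln b) > M already by exp x >= 1 + x; the summand 3 ensures P >
     2. *)
  set (P := M / ln b + 3).
  assert (0 < M / ln b) by (apply Rdiv_lt_0_compat; lra).
  exists P. split; [unfold P; lra|]. exists (cone e (r - e) (incenter n)).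
  split; [now apply cone_admissible|].
  eapply Rle_lt_trans; [apply (cone_rayleigh n e Hn He He5); unfold P; lra|]. fold r.
  assert (Hpos : 0 < r - 4 * e) by lra.
  pose proof (powp_gt0 _ P Hpos) as H1.
  assert (HbP : M < powp b P).
  { rewrite powp_Rpower by lra. unfold Rpower. pose proof (exp_ineq1_le (P * ln b)).
    assert (P * ln b = M + 3 * ln b) by (unfold P; field; lra). lra. }
  unfold b in HbP. rewrite powp_mult in HbP by lra.
  apply Rmult_lt_reg_r with (powp (r - 4 * e) P); [easy|].
  replace (4 / (e ^ 2 * powp (r - 4 * e) P) * powp (r - 4 * e) P) with M; [easy|].
  unfold M. field. lra.
Qed.

(** * Comparison of the two families *)

Lemma PI_bounds : 31 / 10 < PI < 324 / 100.
Proof.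
  pose proof (PI_2_3_7_ineq 0) as H. simpl in H.
  unfold tg_alt, PI_2_3_7_tg, Ratan_seq in H. simpl in H. lra.
Qed.

Lemma sin_cubic_lower x : 0 <= x <= PI -> x - x ^ 3 / 6 <= sin x.
Proof.
  intros Hx. pose proof (sin_bound x 0 (proj1 Hx) (proj2 Hx)) as [H _].
  unfold sin_approx, sin_term in H. simpl in H. simpl. lra.
Qed.

(** Here m = k - 1 and n is the integer part of m pi - 1/10. The second inequality says 1 < 2 m sin
    x with x = pi/(2n), which at first order is n < m pi; the 1/10 pays for the cubic error of the
    sine. *)
Lemma sector_order m : (2 <= m)%nat -> exists n : nat, (6 <= n)%nat /\
  (INR (m + 1) * PI) ^ 2 < INR n * (INR n + 10) /\ / INR (2 * m + 1) < inradius n.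
Proof.
  intros Hm. assert (HmR : 2 <= INR m) by (apply (le_INR 2); easy).
  pose proof PI_bounds as HPI.
  destruct (nfloor_ex (INR m * PI - 1 / 10)) as [n Hn]; [nra|].
  assert (H51 : 5 < INR n) by nra.
  assert (Hn6 : (6 <= n)%nat).
  { assert (5 < n)%nat; [|lia]. apply INR_lt. simpl. lra. }
  exists n. split; [easy|].
  assert (HnR : 6 <= INR n) by (apply (le_INR 6) in Hn6; simpl in Hn6; lra).
  split.
  - rewrite plus_INR. simpl (INR 1).
    assert (HPI2 : PI ^ 2 < 105 / 10) by nra.
    (* For small m the generic estimate of the rounding loss is too coarse, so explicit lower bounds
       on n are used. *)
    assert (Hcases : (m = 2 \/ m = 3 \/ m = 4 \/ 5 <= m)%nat) by lia.
    destruct Hcases as [->|[->|[->|Hm5]]].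
    + replace ((INR 2 + 1) * PI) with (3 * PI) by (simpl; ring). nra.
    + assert (9 <= INR n).
      { simpl (INR 3) in Hn. assert (8 < n)%nat as H8 by (apply INR_lt; simpl; lra).
        apply (le_INR 9) in H8. simpl in H8. lra. }
      replace ((INR 3 + 1) * PI) with (4 * PI) by (simpl; ring). nra.
    + assert (12 <= INR n).
      { simpl (INR 4) in Hn. assert (11 < n)%nat as H8 by (apply INR_lt; simpl; lra).
        apply (le_INR 12) in H8. simpl in H8. lra. }
      replace ((INR 4 + 1) * PI) with (5 * PI) by (simpl; ring). nra.
    + assert (HmR5 : 5 <= INR m) by (apply (le_INR 5) in Hm5; simpl in Hm5; lra).
      assert (15 <= INR n).
      { assert (14 < n)%nat as H8 by (apply INR_lt; simpl; nra).
        apply (le_INR 15) in H8. simpl in H8. lra. }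
      (* Rounding and shift lose at most 1.1 and the additional pi at most 3.24; (n + 4.34)^2 < n (n
         + 10) holds for n >= 15. *)
      assert (0 <= (INR m + 1) * PI < INR n + 434 / 100) by nra.
      nra.
  - rewrite plus_INR, mult_INR. simpl (INR 2). simpl (INR 1).
    pose proof (half_angle_bounds n ltac:(lia)) as Hx. unfold inradius.
    set (x := half_angle n) in *.
    assert (Hxn : x * (2 * INR n) = PI) by (unfold x, half_angle; field; lra).
    assert (Hx27 : x <= 27 / 100) by nra.
    pose proof (sin_cubic_lower x ltac:(lra)) as Hs. set (s := sin x) in *.
    assert (Hs0 : 0 < s) by (apply sin_gt_0; lra).
    assert (Hms : 1 < 2 * INR m * s).
    (* From 2 n x = pi and n <= m pi - 1/10. The gain x/5 outweighs the loss pi x^2 / 6 because x <=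
       0.27. *)
    { assert (A1 : PI + 2 / 10 * x <= 2 * INR m * PI * x) by nra.
      assert (A2 : (PI + 2 / 10 * x) * (x - x ^ 3 / 6) <= 2 * INR m * PI * x * s).
      { assert (0 <= x - x ^ 3 / 6) by nra. apply Rmult_le_compat; lra. }
      assert (A3 : PI * x < (PI + 2 / 10 * x) * (x - x ^ 3 / 6)).
      { assert (PI * x / 6 < 2 / 10 * (1 - x ^ 2 / 6)) by nra.
        assert (0 < x ^ 2) by nra.
        assert (PI * x / 6 * x ^ 2 < 2 / 10 * (1 - x ^ 2 / 6) * x ^ 2) by (apply Rmult_lt_compat_r; lra).
        simpl in *. lra. }
      assert (0 < PI * x) by nra. nra. }
    apply Rmult_lt_reg_r with (1 + s); [lra|].
    replace (s / (1 + s) * (1 + s)) with s by (field; lra).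
    apply Rmult_lt_reg_l with (2 * INR m + 1); [lra|].
    rewrite <- Rmult_assoc, Rinv_r by lra. lra.
Qed.

(** * The intermediate value argument in p *)

Definition clamp a b x := Rmax a (Rmin x b).

Lemma clamp_bounds a b x : a <= b -> a <= clamp a b x <= b.
Proof. intros. unfold clamp. split; [apply Rmax_l|]. apply Rmax_lub; [easy|apply Rmin_r]. Qed.

Lemma clamp_id a b x : a <= x <= b -> clamp a b x = x.
Proof. intros. unfold clamp. rewrite Rmin_left, Rmax_right; lra. Qed.

Lemma clamp_lip a b x y : Rabs (clamp a b x - clamp a b y) <= Rabs (x - y).
Proof.
  unfold clamp, Rmax, Rmin.
  destruct (Rle_dec x b), (Rle_dec y b); repeat destruct Rle_dec;
    unfold Rabs; repeat destruct Rcase_abs; lra.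
Qed.

Section EqualEigenvalues.
Variables (n m : nat) (bb : R -> R -> R) (nu T : R -> R) (P : R).
Hypothesis Hn : (2 <= n)%nat.
Hypothesis Hbb : forall p, 2 <= p -> angle_solution p (bb p).
Hypothesis Hnu : forall p, 2 <= p -> crossing (bb p) (2 * m + 1) (nu p).
Hypothesis HT1 : forall p, 2 <= p -> forall u, admissible (sector n) u -> T p <= rayleigh p u.
Hypothesis HT2 : forall p, 2 <= p -> forall L, T p < L -> exists u, admissible (sector n) u /\ rayleigh p u < L.
Hypothesis HP : 2 < P.

Let mu p := powp (nu p) p.

Lemma sector_square z : sector n z -> Rabs (fst z) < 1 /\ Rabs (snd z) < 1.
Proof. apply sector_in_square. lia. Qed.

(** Continuity of the zero is known on [2, P] only; precomposing with [clamp] gives functions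
    continuous on all of R, to which the composition rules apply. *)
Lemma mu_continuous p eta : 2 <= p <= P -> 0 < eta ->
  exists d, 0 < d /\ forall q, 2 <= q <= P -> Rabs (q - p) < d -> Rabs (mu q - mu p) < eta.
Proof.
  intros Hp Heta. set (c := clamp 2 P).
  assert (Hc : forall x, 2 <= c x <= P) by (intros; apply clamp_bounds; lra).
  assert (Cc : forall x, continuous c x).
  { intros x. apply (lipschitz_continuous_from c 1 (x - 1)); [|lra].
    intros s t _ _. rewrite Rmult_1_l. apply clamp_lip. }
  assert (Hnu0 : forall x, 0 < nu (c x)) by (intros x; apply Hnu, Hc).
  assert (Cnu : forall x, continuous (fun x => nu (c x)) x).
  { intros x. apply continuity_pt_filterlim. intros e He.
    destruct (crossing_continuous (c x) P (bb (c x)) (2 * m + 1) (nu (c x)) e (Hc x)) as [d [Hd H]];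
      [apply Hbb, Hc|apply Hnu, Hc|easy|].
    exists d. split; [easy|]. intros y [_ Hy]. simpl in *. unfold Rdist in *.
    apply (H (c y) (bb (c y))); [apply Hc| |apply Hbb, Hc|apply Hnu, Hc].
    rewrite Rabs_minus_sym. eapply Rle_lt_trans; [apply clamp_lip|easy]. }
  assert (Cmu : continuous (fun x => exp (c x * ln (nu (c x)))) p).
  { apply (continuous_comp (fun x => c x * ln (nu (c x))) exp); [|apply continuous_exp].
    apply (continuous_mult c); [apply Cc|].
    apply (continuous_comp (fun x => nu (c x)) ln); [apply Cnu|].
    apply (is_derive_continuous ln _ (/ nu (c p))). auto_derive; [apply Hnu0|]. ring. }
  destruct (continuous_eps _ p eta Cmu Heta) as [d [Hd H]].
  exists d. split; [easy|]. intros q Hq Hqp. specialize (H q Hqp).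
  unfold mu. rewrite !powp_Rpower by (apply Hnu; lra). unfold Rpower.
  unfold c in H. now rewrite !clamp_id in H by easy.
Qed.

(** A test function whose quotient at p is below the midpoint of T p and mu p keeps its quotient
    below that midpoint for exponents slightly smaller than p, while mu stays above it. *)
Lemma below_left p : 2 < p <= P -> T p < mu p -> exists d, 0 < d /\ forall q, p - d < q < p -> 2 <= q -> T q < mu q.
Proof.
  intros Hp H. set (L := (T p + mu p) / 2).
  destruct (HT2 p ltac:(lra) L ltac:(unfold L; lra)) as [u [Hu HR]].
  destruct (lambda1_left_usc (sector n) sector_square p u L ltac:(lra) Hu HR) as [d1 [Hd1 H1]].
  destruct (mu_continuous p (mu p - L) ltac:(lra) ltac:(unfold L; lra)) as [d2 [Hd2 H2]].
  exists (Rmin d1 d2). split; [now apply Rmin_glb_lt|]. intros q Hq Hq2.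
  pose proof (Rmin_l d1 d2). pose proof (Rmin_r d1 d2).
  specialize (H1 q ltac:(lra)). specialize (H2 q ltac:(lra) ltac:(rewrite Rabs_left; lra)).
  apply Rabs_lt_between in H2. pose proof (HT1 q Hq2 u Hu). lra.
Qed.

(** Otherwise T q <= mu q for some q just above p. A near-minimizer at q, raised to the power q/p,
    then has a quotient at p of at most (q/p)^p L^(p/q), close to L and hence below T p. The margin
    is split in thirds among mu, L and this factor. *)
Lemma above_right p : 2 <= p < P -> mu p < T p -> exists d, 0 < d /\ forall q, p < q < p + d -> q <= P -> mu q < T q.
Proof.
  intros Hp H. set (eta := (T p - mu p) / 3). assert (Heta : 0 < eta) by (unfold eta; lra).
  assert (Hmu : 0 < mu p) by (apply powp_gt0, Hnu; lra).
  set (L := mu p + 2 * eta).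
  assert (Cg : continuous (fun q => Rpower (q / p) p * Rpower L (p / q)) p).
  { unfold Rpower. apply (ex_derive_continuous (fun q => exp (p * ln (q / p)) * exp (p / q * ln L)) p).
    auto_derive. repeat split; try lra. apply Rmult_lt_0_compat; [lra|apply Rinv_0_lt_compat; lra]. }
  destruct (continuous_eps _ p eta Cg Heta) as [d1 [Hd1 H1]].
  destruct (mu_continuous p eta ltac:(lra) Heta) as [d2 [Hd2 H2]].
  exists (Rmin d1 d2). split; [now apply Rmin_glb_lt|]. intros q Hq HqP.
  pose proof (Rmin_l d1 d2). pose proof (Rmin_r d1 d2).
  assert (Habs : Rabs (q - p) = q - p) by (apply Rabs_pos_eq; lra).
  specialize (H1 q ltac:(rewrite Habs; lra)). specialize (H2 q ltac:(lra) ltac:(rewrite Habs; lra)).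
  apply Rabs_lt_between in H1, H2.
  replace (Rpower (p / p) p) with 1 in H1.
  2:{ unfold Rdiv. rewrite Rinv_r by lra. unfold Rpower. rewrite ln_1, Rmult_0_r. symmetry; apply exp_0. }
  replace (p / p) with 1 in H1 by (field; lra). rewrite Rpower_1 in H1 by (unfold L; lra).
  destruct (Rlt_dec (mu q) (T q)) as [|Hn']; [easy|exfalso].
  destruct (HT2 q ltac:(lra) L ltac:(unfold L; lra)) as [u [Hu HR]].
  destruct (power_competitor (sector n) sector_square p q u L ltac:(lra) Hu ltac:(unfold L; lra) HR) as [v [Hv HRv]].
  rewrite !powp_Rpower in HRv by (first [unfold L; lra | apply Rdiv_lt_0_compat; lra]).
  pose proof (HT1 p ltac:(lra) v Hv). unfold L, eta in *. lra.
Qed.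

(** Let s be the largest exponent such that mu <= T on [2, s]. At s, T s < mu s is excluded by
    [below_left] and mu s < T s by [above_right]. No continuity of T is required, and the strict
    signs at 2 and P keep s inside. *)
Lemma eigenvalue_crossing : mu 2 < T 2 -> T P < mu P -> exists p, 2 < p /\ mu p = T p.
Proof.
  intros H2 HPP.
  set (E := fun p => 2 <= p <= P /\ forall q, 2 <= q <= p -> mu q <= T q).
  destruct (completeness E) as [s [Hub Hlub]].
  { exists P. intros p [Hp _]. lra. }
  { exists 2. split; [lra|]. intros q Hq. replace q with 2 by lra. lra. }
  assert (Hs2 : 2 <= s).
  { apply Hub. split; [lra|]. intros q Hq. replace q with 2 by lra. lra. }
  assert (HsP : s <= P) by (apply Hlub; intros p [Hp _]; lra).
  assert (Hbelow : forall q, 2 <= q < s -> mu q <= T q).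
  { intros q Hq. destruct (Rle_dec (mu q) (T q)) as [|Hn']; [easy|exfalso].
    assert (s <= q); [|lra]. apply Hlub. intros p [Hp HE].
    destruct (Rle_dec p q); [easy|exfalso]. apply Hn'. apply HE. lra. }
  assert (Hs : mu s <= T s).
  { destruct (Rle_dec (mu s) (T s)) as [|Hn']; [easy|exfalso].
    assert (Hs2' : 2 < s) by (destruct Hs2 as [|<-]; [easy|lra]).
    destruct (below_left s ltac:(lra) ltac:(lra)) as [d [Hd H]].
    set (q := Rmax 2 (s - d / 2)).
    assert (2 <= q) by apply Rmax_l. assert (s - d / 2 <= q) by apply Rmax_r.
    assert (q < s) by (apply Rmax_lub_lt; lra).
    specialize (H q ltac:(lra) ltac:(lra)). specialize (Hbelow q ltac:(lra)). lra. }
  assert (HsP' : s < P) by (destruct HsP as [|E0]; [easy|rewrite E0 in Hs; lra]).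
  assert (Heq : mu s = T s).
  { destruct Hs as [Hs|]; [exfalso|easy].
    destruct (above_right s ltac:(lra) Hs) as [d [Hd H]].
    set (q := Rmin P (s + d / 2)).
    assert (q <= P) by apply Rmin_l. assert (q <= s + d / 2) by apply Rmin_r.
    assert (s < q) by (apply Rmin_glb_lt; lra).
    assert (q <= s); [|lra]. apply Hub. split; [lra|]. intros r Hr.
    destruct (Rtotal_order r s) as [L|[->|L]].
    - apply Hbelow. lra.
    - lra.
    - left. apply H; lra. }
  exists s. split; [|easy]. destruct Hs2 as [|E2]; [easy|]. rewrite <- E2 in Heq. lra.
Qed.
End EqualEigenvalues.

Theorem theorem1p4 :
  forall k : nat, (3 <= k)%nat ->
  exists (n : nat) (pk : R), (1 <= n)%nat /\ 2 < pk /\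
    exists mu : R, kth_radial_eig pk k mu /\ Finite mu = tau n pk.
Proof.
  (* Zeros are indexed from 0, so the k-th eigenvalue belongs to level 2 m + 1 with m = k - 1. *)
  intros k Hk. set (m := (k - 1)%nat).
  destruct (sector_order m ltac:(unfold m; lia)) as [n [Hn6 [HA HB]]].
  assert (Hn : (2 <= n)%nat) by lia.
  pose proof (sector_admissible_exists n Hn) as Hadm.
  assert (HO : forall z, sector n z -> Rabs (fst z) < 1 /\ Rabs (snd z) < 1).
  { intros z. apply sector_in_square. lia. }
  (* Choice needs total functions of p; below 2 the values are dummies, and the guard 2 <= p is kept
     inside the chosen property. *)
  assert (E1 : forall p, exists b, 2 <= p -> angle_solution p b).
  { intros p. destruct (Rle_dec 2 p) as [Hp|]; [|exists (fun _ => 0); lra].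
    destruct (angle_exists p Hp) as [b Hb]. now exists b. }
  apply choice in E1. destruct E1 as [bb Hbb].
  assert (E2 : forall p, exists t, 2 <= p -> crossing (bb p) (2 * m + 1) t).
  { intros p. destruct (Rle_dec 2 p) as [Hp|]; [|exists 0; lra].
    destruct (crossing_exists p (bb p) Hp (Hbb p Hp) (2 * m + 1) ltac:(lia)) as [t Ht]. now exists t. }
  apply choice in E2. destruct E2 as [nu Hnu].
  assert (E3 : forall p, exists T : R, 2 <= p -> lambda1 (sector n) p = Finite T /\
    (forall u, admissible (sector n) u -> T <= rayleigh p u) /\
    (forall L, T < L -> exists u, admissible (sector n) u /\ rayleigh p u < L)).
  { intros p. destruct (Rle_dec 2 p) as [Hp|]; [|exists 0; lra].
    destruct (lambda1_spec (sector n) HO p ltac:(lra) Hadm) as [T HT]. now exists T. }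
  apply choice in E3. destruct E3 as [T HT].
  set (K := INR (2 * m + 1)).
  assert (HK : 0 < K) by (apply lt_0_INR; lia).
  destruct (sector_rayleigh_upper n K Hn HK HB) as [P [HP [u [Hu HR]]]].
  assert (Hbounds : forall p, 2 <= p -> K <= nu p /\ (p = 2 -> nu p <= INR (m + 1) * PI)).
  { intros p Hp. destruct (radial_flow_exists p (bb p) Hp (Hbb p Hp)) as [U [Y [HF Hpol]]]. split.
    - apply (zero_ge_odd p (bb p) U Y Hp (Hbb p Hp) HF Hpol m (nu p)). now apply Hnu.
    - intros E. apply (zero_le_linear p (bb p) U Y Hp (Hbb p Hp) HF Hpol m (nu p) E). now apply Hnu. }
  destruct (eigenvalue_crossing n m bb nu T P Hn Hbb Hnu) as [p [Hp E]]; auto.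
  - intros p Hp. apply HT; easy.
  - intros p Hp. apply HT; easy.
  - destruct (Hbounds 2 (Rle_refl 2)) as [B1 B2]. specialize (B2 eq_refl).
    rewrite powp_2 by lra.
    assert (nu 2 ^ 2 <= (INR (m + 1) * PI) ^ 2) by (apply pow_incr; lra).
    assert (INR n * (INR n + 10) <= T 2); [|lra].
    destruct (Rle_dec (INR n * (INR n + 10)) (T 2)) as [|Hlt]; [easy|exfalso].
    destruct (HT 2 (Rle_refl 2)) as [_ [_ HT2]].
    destruct (HT2 (INR n * (INR n + 10)) ltac:(lra)) as [v [Hv HRv]].
    pose proof (sector_rayleigh_lower n ltac:(lia) v Hv). lra.
  - destruct (Hbounds P ltac:(lra)) as [B1 _].
    destruct (HT P ltac:(lra)) as [_ [HT1 _]]. specialize (HT1 u Hu).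
    pose proof (powp_le K (nu P) P ltac:(lra) ltac:(lra)). lra.
  - exists n, p. split; [lia|]. split; [easy|].
    exists (powp (nu p) p). split.
    + replace k with (S m) by (unfold m; lia).
      apply (kth_eig_crossing p (bb p)); [lra|apply Hbb; lra|apply Hnu; lra].
    + unfold tau. rewrite E. symmetry. apply HT. lra.
Qed.
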